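(* Let $R:\mathbb{R}^p\to\mathbb{R}\cup\{+\infty\}$ be a proper lower semicontinuous convex function that is bounded from below and mirror-stratifiable with respect to a primal stratification $\mathcal{M}$ of $\mathrm{dom}(\partial R)$ and a dual stratification $\mathcal{M}^*$ of $\mathrm{dom}(\partial R^* )$. Let $\rho$ be a probability measure on $\mathbb{R}^p\times\mathbb{R}$, let $(\mathbf{x},\mathbf{y})\sim\rho$, and assume that $w_0$ is the unique solution of $$\min_{w\in\mathbb{R}^p}\Big\{R(w)\ :\ w\in \operatorname{Argmin}_{w'\in\mathbb{R}^p}\mathbb{E}_\rho\big[(\langle w',\mathbf{x}\rangle-\mathbf{y})^2\big]\Big\}.$$ Suppose that $\mathbb{E}[\|\mathbf{x}\|^4]<+\infty$ and $\mathbb{E}[|\mathbf{y}|^4]<+\infty$. Let $(x_i,y_i)_{i\ge1}$ be i.i.d. pairs sampled from $\rho$, and let $(\lambda_n)_{n\in\mathbb{N}}\subset\,]0,+\infty[$ be such that $$\lambda_n\to0\quad\text{with}\quad\lambda_n\sqrt{n/(\log\log n)}\to+\infty .$$ Then, for $n$ large enough, if $(\widehat w^k)_{k\in\mathbb{N}}$ (with its auxiliary sequence $(\widehat z^k)_{k\in\mathbb{N}}$) is generated by the relaxed stochastic proximal gradient algorithm defined in the context, applied to the data $(x_i,y_i)_{i=1}^n$ with $\lambda=\lambda_n$, under the algorithmic assumptions listed in the context, then for $k$ large enough: $$M_{w_0}\ \le\ M_{\widehat z^k}\ \le\ \mathcal{J}_{R^*}(M^*_{\eta_0})\quad\text{holds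 almost surely},$$ where $\eta_0\in\partial R(w_0)$ is the dual vector defined in the context.
   Context: Here $\partial R$ is the convex subdifferential, $\mathrm{dom}(\partial R)=\{w\in\mathbb{R}^p:\partial R(w)\neq\emptyset\}$, $R^*$ is the Legendre-Fenchel conjugate, $\mathrm{ri}$ is the relative interior, $\mathrm{cl}$ the topological closure, $\mathrm{Prox}_{f}(v)=\operatorname{argmin}_z f(z)+\frac12\|z-v\|^2$. Stratification: a stratification of a set $D\subset\mathbb{R}^p$ is a finite partition $\{M_i\}_{i\in I}$ of $D$ such that for any strata $M,M'$, $M\cap\mathrm{cl}(M')\neq\emptyset\Rightarrow M\subset\mathrm{cl}(M')$. It induces the partial ordering $M\le M'\iff M\subset\mathrm{cl}(M')\iff M\cap\mathrm{cl}(M')\neq\emptyset$. For $w\in\mathrm{dom}(\partial R)$, $M_w$ denotes the unique stratum of $\mathcal{M}$ containing $w$; for $\eta\in\mathrm{dom}(\partial R^* )$, $M^*_\eta$ denotes the unique stratum of $\mathcal{M}^*$ containing $\eta$. Correspondence operator: for $S\subset\mathbb{R}^p$, $\mathcal{J}_R(S)=\bigcup_{x\in S}\mathrm{ri}(\partial R(x))$, and similarly $\mathcal{J}_{R^*}(S)=\bigcup_{\eta\in S}\mathrm{ri}(\partial R^*(\eta))$. Mirror-stratifiability: a proper lower semicontinuous convex $R$ is mirror-stratifiable with respect to a (primal) stratification $\mathcal{M}=\{M_i\}_{i\in I}$ of $\mathrm{dom}(\partial R)$ and a (dual) stratification $\mathcal{M}^*=\{M^*_i\}_{i\in I}$ of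 $\mathrm{dom}(\partial R^* )$ if $\mathcal{J}_R:\mathcal{M}\to\mathcal{M}^*$ is invertible with inverse $\mathcal{J}_{R^*}$ and $\mathcal{J}_R$ is decreasing for the relation $\le$. Dual vector: let $C=\mathbb{E}_\rho[\mathbf{x}\mathbf{x}^\top]\in\mathbb{R}^{p\times p}$ and $C^\dagger$ its Moore-Penrose pseudo-inverse. Then $\eta_0$ is the (unique) optimal solution of $\min\{\langle C^\dagger\eta,\eta\rangle:\eta\in\partial R(w_0)\cap\mathrm{Im}\,C\}$. Algorithm, for solving $\min_{w\in\mathbb{R}^p}\lambda R(w)+\frac1{2n}\sum_{i=1}^n(\langle x_i,w\rangle-y_i)^2$: starting from any initialization $\widehat w^0$, at iteration $k$, $$\widehat d^k=(\langle\widehat w^k,x_{i(k)}\rangle-y_{i(k)})\,x_{i(k)}+\widehat\varepsilon^k,\qquad \widehat z^k=\mathrm{Prox}_{\gamma_k\lambda R}(\widehat w^k-\gamma_k\widehat d^k),\qquad \widehat w^{k+1}=(1-\alpha_k)\widehat w^k+\alpha_k\widehat z^k,$$ where $(x_{i(k)},y_{i(k)})$ are independent random variables drawn among $(x_i,y_i)_{i=1}^n$, the $\widehat\varepsilon^k$ are $\mathbb{R}^p$-valued random variables, and $\gamma_k\in\,]0,+\infty[$ and $\alpha_k\in\,]0,1]$ are deterministic stepsize and relaxation parameters. Algorithmic assumptions, with $L_n=\frac1n\|\sum_{i=1}^n x_ix_i^\top\|$ and $\mathcal{F}_k=\sigma(\widehat w^1,\dots,\widehat w^k)$ the $\sigma$-algebra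 generated by the first $k$ iterates: (1) $\sigma_k\in[0,+\infty[$, $\alpha_k\in\,]0,1]$, $\gamma_k\in\,]0,2/L_n[$; (2) $\mathbb{E}[\widehat\varepsilon^k|\mathcal{F}_k]=0$ and the conditional variance satisfies $\mathrm{Var}[\widehat d^k|\mathcal{F}_k]\le\sigma_k^2$; (3) $\widehat d^k-\mathbb{E}[\widehat d^k|\mathcal{F}_k]$ converges almost surely to $0$; (4) $\sum_{k=1}^\infty\alpha_k\gamma_k^2\sigma_k^2<+\infty$; (5) $\|\widehat w^{k+1}-\widehat w^k\|=o(\alpha_k\gamma_k)$ almost surely. *)

(* Defs.v *)
From HB Require Import structures.
From mathcomp Require Import all_boot all_order all_algebra finmap.
From mathcomp Require Import all_classical all_reals all_analysis.

Set Implicit Arguments.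
Unset Strict Implicit.
Unset Printing Implicit Defensive.

Import Order.TTheory GRing.Theory Num.Theory.
Import numFieldNormedType.Exports.

Local Open Scope classical_set_scope.
Local Open Scope ring_scope.

(* R^p is the type 'cV[K]_p of column vectors over K : realType.  The library
   norm on matrices is the sup norm, which gives the right topology; the
   Euclidean norm is enorm. *)
Notation borel_cV K p := (g_sigma_algebraType (@open 'cV[K]_p)).

Section linear_algebra.
Variable K : realType.

Definition dotp p (u v : 'cV[K]_p) : K := \sum_i u i 0 * v i 0.

Definition enorm p (u : 'cV[K]_p) : K := Num.sqrt (dotp u u).

(* spectral norm *)
Definition opnorm p (A : 'M[K]_p) : K :=
  sup [set enorm (A *m u) | u in [set u | enorm u <= 1]].

Definition is_moore_penrose m n (A : 'M[K]_(m, n)) (B : 'M[K]_(n, m)) : Prop :=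
  [/\ A *m B *m A = A, B *m A *m B = B,
      (A *m B)^T = A *m B & (B *m A)^T = B *m A].

Definition mp_pinv m n (A : 'M[K]_(m, n)) : 'M[K]_(n, m) :=
  xget 0 [set B | is_moore_penrose A B].

Lemma gram_unitmx m n (B : 'M[K]_(m, n)) : row_free B -> B *m B^T \in unitmx.
Proof.
move=> Bfree; rewrite -row_free_unit; apply/row_freeP.
have inj : forall v : 'rV[K]_m, v *m (B *m B^T) = 0 -> v = 0.
  move=> v vG; have vB0 : v *m B = 0.
    have : (v *m B) *m (v *m B)^T = 0.
      by rewrite trmx_mul mulmxA -(mulmxA v) vG mul0mx.
    move=> /matrixP/(_ 0 0); rewrite !mxE => /psumr_eq0P sum0.
    apply/rowP => j; rewrite [RHS]mxE; apply/eqP.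
    have /eqP := sum0 (fun i _ => ltac:(by rewrite [X in _ * X]mxE -expr2 sqr_ge0)) j isT.
    by rewrite [X in _ * X]mxE mulf_eq0 orbb.
  by apply: (row_free_inj Bfree); rewrite vB0 mul0mx.
apply/row_freeP; rewrite -kermx_eq0; apply/eqP/row_matrixP => i.
by rewrite row0; apply: inj; rewrite -row_mul mulmx_ker row0.
Qed.

Lemma mp_pinvP m n (A : 'M[K]_(m, n)) : is_moore_penrose A (mp_pinv A).
Proof.
rewrite /mp_pinv; apply: (@xgetPex _ 0 [set B | is_moore_penrose A B]) => /=.
have [r [B [C [AE uC uB]]]] : exists r (B : 'M[K]_(m, r)) (C : 'M[K]_(r, n)),
    [/\ A = B *m C, C *m C^T \in unitmx & B^T *m B \in unitmx].
  exists (\rank A), (col_base A), (row_base A); split.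
  - by rewrite mulmx_base.
  - exact/gram_unitmx/row_base_free.
  - rewrite -{2}(trmxK (col_base A)) gram_unitmx // /row_free mxrank_tr.
    exact: col_base_full.
exists (C^T *m invmx (C *m C^T) *m (invmx (B^T *m B) *m B^T)).
set iC := invmx (C *m C^T); set iB := invmx (B^T *m B).
have iCs : iC^T = iC by rewrite trmx_inv trmx_mul trmxK.
have iBs : iB^T = iB by rewrite trmx_inv trmx_mul trmxK.
have AX : A *m (C^T *m iC *m (iB *m B^T)) = B *m iB *m B^T.
  by rewrite AE !mulmxA -(mulmxA B C) -(mulmxA B _ iC) mulmxV // mulmx1.
have XA : C^T *m iC *m (iB *m B^T) *m A = C^T *m iC *m C.
  by rewrite AE !mulmxA -(mulmxA _ B^T B) -(mulmxA _ iB) mulVmx // mulmx1.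
rewrite /is_moore_penrose AX XA; split.
- by rewrite AE !mulmxA -(mulmxA _ B^T B) -(mulmxA _ iB) mulVmx // mulmx1.
- by rewrite !mulmxA -(mulmxA _ C C^T) -(mulmxA _ (C *m C^T)) mulmxV // mulmx1.
- by rewrite !trmx_mul trmxK iBs mulmxA.
- by rewrite !trmx_mul trmxK iCs mulmxA.
Qed.

End linear_algebra.

Section convex_analysis.
Variables (K : realType) (p : nat).
Local Notation V := 'cV[K]_p.
Implicit Types (R f : V -> \bar K) (A S : set V).

Definition eproper R : Prop :=
  (forall w, R w != -oo%E) /\ (exists w, (R w < +oo)%E).

Definition econvex R : Prop :=
  forall (u v : V) (t : K), 0 < t < 1 ->
    (R (t *: u + (1 - t) *: v)%R <= t%:E * R u + (1 - t)%:E * R v)%E.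

Definition bounded_below R : Prop :=
  exists m : K, forall w, (m%:E <= R w)%E.

Definition argmin A f : set V :=
  [set u | A u /\ forall v, A v -> (f u <= f v)%E].

Definition subdiff R (w : V) : set V :=
  [set eta | forall v, (R w + (dotp eta (v - w)%R)%:E <= R v)%E].

Definition dom_subdiff R : set V := [set w | subdiff R w !=set0].

Definition fconj R (eta : V) : \bar K :=
  ereal_sup [set ((dotp eta w)%:E - R w)%E | w in setT].

Definition affine_hull S : set V :=
  [set u | exists (m : nat) (s : 'I_m -> V) (a : 'I_m -> K),
    [/\ forall i, S (s i), \sum_i a i = 1 & u = \sum_i a i *: s i]].

Definition rel_interior S : set V :=
  [set u | S u /\ within (affine_hull S) (nbhs u) S].

Definition prox f (v : V) : set V :=
  argmin setT (fun u => f u + (2^-1 * enorm (u - v) ^+ 2)%:E)%E.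

(* A stratification is given as the finite set Ms of its strata. *)
Definition stratification (Ms : set (set V)) (D : set V) : Prop :=
  [/\ finite_set Ms, partition Ms id D &
      forall M M', Ms M -> Ms M' -> M `&` closure M' !=set0 -> M `<=` closure M'].

(* The stratum containing w; meaningful when Ms covers w. *)
Definition stratum (Ms : set (set V)) (w : V) : set V := pblock Ms id w.

Definition strat_le (M M' : set V) : Prop := M `<=` closure M'.

Definition corr_op R S : set V := \bigcup_(w in S) rel_interior (subdiff R w).

(* Decreasing means order-reversing in both directions, so that the inverse
   corr_op (fconj R) is decreasing as well. *)
Definition mirror_stratifiable R (Ms Mds : set (set V)) : Prop :=
  [/\ stratification Ms (dom_subdiff R),
      stratification Mds (dom_subdiff (fconj R)),
      (forall M, Ms M -> Mds (corr_op R M) /\ corr_op (fconj R) (corr_op R M) = M),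
      (forall N, Mds N -> Ms (corr_op (fconj R) N) /\
                          corr_op R (corr_op (fconj R) N) = N) &
      (forall M M', Ms M -> Ms M' ->
        (strat_le M M' <-> strat_le (corr_op R M') (corr_op R M)))].

End convex_analysis.

Section probability_notions.
Variables (K : realType) (d : measure_display) (T : measurableType d).
Variable P : probability T K.

(* Mutual independence of a sequence of families of events. *)
Definition mutual_indep (F : nat -> set (set T)) : Prop :=
  forall (J : {fset nat}) (A : nat -> set T),
    (forall k, k \in J -> F k (A k)) ->
    P (\bigcap_(k in [set` J]) A k) = (\prod_(k <- J) P (A k))%E.

Definition indep2 (F G : set (set T)) : Prop :=
  forall A B, F A -> G B -> P (A `&` B) = (P A * P B)%E.

(* Y is a version of the conditional expectation of X given the
   sub-sigma-algebra F. *)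
Definition is_cexp (F : set (set T)) (X Y : T -> K) : Prop :=
  [/\ P.-integrable setT (EFin \o X),
      P.-integrable setT (EFin \o Y),
      (forall B : set K, measurable B -> F (Y @^-1` B)) &
      (forall A, F A -> (\int[P]_(t in A) (Y t)%:E = \int[P]_(t in A) (X t)%:E)%E)].

Definition is_cexp_cV p (F : set (set T)) (X Y : T -> 'cV[K]_p) : Prop :=
  forall i, is_cexp F (fun t => X t i 0) (fun t => Y t i 0).

End probability_notions.

Section learning.
Variables (K : realType) (p : nat).
Local Notation V := 'cV[K]_p.
Variable rho : probability (borel_cV K p * K)%type K.

Definition risk (w : V) : \bar K := 'E_rho[fun s => (dotp w s.1 - s.2) ^+ 2].

Definition second_moment : 'M[K]_p :=
  \matrix_(i, j) \int[rho]_(s in setT) ((s.1 : V) i 0 * (s.1 : V) j 0).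

Definition is_dual_vector (R : V -> \bar K) (w0 eta0 : V) : Prop :=
  argmin (subdiff R w0 `&` range (mulmx second_moment))
    (fun eta => (dotp (mp_pinv second_moment *m eta) eta)%:E) eta0.

Definition iid_sample d (T : measurableType d) (P : probability T K)
    (s : nat -> T -> borel_cV K p * K) : Prop :=
  [/\ forall i, measurable_fun setT (s i),
      forall i A, measurable A -> pushforward P (s i) A = rho A &
      mutual_indep P (fun i => preimage_set_system setT (s i) measurable)].

End learning.

Section algorithm.
Variables (K : realType) (p n : nat).
Local Notation V := 'cV[K]_p.
Variables (d : measure_display) (T : measurableType d) (Q : probability T K).
Variables (R : V -> \bar K) (lambda : K) (x : 'I_n -> V) (y : 'I_n -> K).
Variables (alpha gamma sigma : nat -> K).
Variables (idx : nat -> T -> 'I_n) (eps w z : nat -> T -> V).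

(* F_k: the sigma-algebra generated by the iterates 1, ..., k. *)
Definition iter_sigma (k : nat) : set (set T) :=
  <<s \bigcup_(j in [set j | (1 <= j <= k)%N])
        preimage_set_system setT (w j : T -> borel_cV K p) measurable >>.

Definition sgd_dir (k : nat) (t : T) : V :=
  (dotp (w k t) (x (idx k t)) - y (idx k t)) *: x (idx k t) + eps k t.

Definition lipschitz_cst : K :=
  n%:R^-1 * opnorm (\sum_i x i *m (x i)^T).

Record rspg_run : Prop := RspgRun {
  run_alpha : forall k, 0 < alpha k <= 1 ;
  run_gamma : forall k, 0 < gamma k ;
  run_idx_meas : forall k (B : set 'I_n), measurable (idx k @^-1` B) ;
  run_idx_unif : forall k j, Q (idx k @^-1` [set j]) = (n%:R^-1)%:E ;
  run_idx_indep :
    mutual_indep Q (fun k => preimage_set_system setT (idx k) setT) ;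
  (* the draw at iteration k is independent of the past iterates *)
  run_idx_fresh : forall k, (0 < k)%N ->
    indep2 Q (preimage_set_system setT (idx k) setT) (iter_sigma k) ;
  run_eps_meas : forall k, measurable_fun setT (eps k : T -> borel_cV K p) ;
  run_w_meas : forall k, measurable_fun setT (w k : T -> borel_cV K p) ;
  run_z : forall k t,
    prox (fun u => (gamma k * lambda)%:E * R u)%E
      (w k t - gamma k *: sgd_dir k t) (z k t) ;
  run_w : forall k t,
    w k.+1 t = (1 - alpha k) *: w k t + alpha k *: z k t }.

(* dbar k is a version of the conditional expectation of sgd_dir k given F_k.
   The bound on gamma k is multiplicative, so that it reads gamma k < +oo when
   the Lipschitz constant vanishes. *)
Record rspg_assumptions (dbar : nat -> T -> V) : Prop := RspgAssumptions {
  asm_sigma : forall k, 0 <= sigma k ;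
  asm_alpha : forall k, 0 < alpha k <= 1 ;
  asm_gamma : forall k, 0 < gamma k /\ gamma k * lipschitz_cst < 2 ;
  asm_eps_mean : forall k, (0 < k)%N ->
    is_cexp_cV Q (iter_sigma k) (eps k) (fun=> 0) ;
  asm_dbar : forall k, (0 < k)%N ->
    is_cexp_cV Q (iter_sigma k) (sgd_dir k) (dbar k) ;
  asm_var : forall k, (0 < k)%N ->
    exists2 v : T -> K,
      is_cexp Q (iter_sigma k) (fun t => enorm (sgd_dir k t - dbar k t) ^+ 2) v &
      {ae Q, forall t, v t <= sigma k ^+ 2} ;
  asm_noise : {ae Q, forall t, (sgd_dir k t - dbar k t) @[k --> \oo] --> (0 : V)} ;
  asm_sum : (\sum_(1 <= k <oo) (alpha k * gamma k ^+ 2 * sigma k ^+ 2)%:E < +oo)%E ;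
  asm_incr : {ae Q, forall t,
    ((fun k => enorm (w k.+1 t - w k t)) : nat -> K^o)
      =o_\oo ((fun k => alpha k * gamma k) : nat -> K^o)} }.

End algorithm.

(* Main.v *)
(* The optimality condition of the proximal step provides eta_k in dR(z_k) with
     lambda eta_k + C_n (z_k - w0) - b_n -> 0,
   where C_n is the empirical covariance and b_n = (1/n) sum (y_i - <x_i, w0>) x_i:
   the noise d_k - E[d_k | F_k] vanishes, the increments are o(alpha_k gamma_k)
   and gamma_k stays below 2 / L_n.

   Such pairs (z, eta) are close to (w0, eta0) when lambda, C_n - C and
   b_n / lambda are small.  Let P = C^+ C.  Since w0 minimizes R uniquely on
   w0 + Ker C, compactness gives a linear growth of R + B |P (. - w0)| away from
   w0, which with the coercivity of C on its image yields z -> w0 and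
   |P (z - w0)| = O(lambda).  Up to a vanishing error, eta is then
   -C (z - w0) / lambda, which is bounded; monotonicity of dR at w0 turns into
   <C^+ eta, eta> <= <C^+ eta0, eta> for every limit eta of these duals, and
   such a limit lies in dR(w0) and in Im C, so it is eta0 by minimality.

   C_n -> C and b_n = o(lambda_n) follow from the upper half of the law of the
   iterated logarithm, obtained up to a constant factor under a second moment:
   on the k-th dyadic block the variables are truncated at
   tau_k = sqrt (2^k / ln k), the truncated sums are controlled by Ville's
   inequality, the remainders by Markov's, and Borel-Cantelli concludes.

   Finally, z belongs to the closure of ri dR*(eta), so that its stratum is below
   J_{R*}(M*_eta); the closeness of z to w0 gives M_w0 <= M_z, and that of eta
   to eta0 gives M*_eta0 <= M*_eta, which J_{R*} reverses. *)

(* The obstacle is that [C] may be singular: the quadratic term sees only the component of z - w0 in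
   Im C, and along Ker C only R can hold z near w0. This is why every estimate keeps P (z - w0) and
   z - w0 apart, and why two tolerances occur. The sampling error b_n lies almost surely in Im C, so
   it meets only the component that the quadratic controls, and o(lambda_n) is enough. The residual
   of the algorithm may point along Ker C, where nothing quadratic absorbs it, so it is required to
   be of order lambda_n^2; for fixed n this is a fixed threshold, reached for k large.

   Stability concerns approximately stationary pairs rather than minimizers of the regularized
   problem. Its constant kappa is chosen before lambda, the data and the run, so the rank from which
   n is large enough serves every run of the algorithm on every probability space.

   Only the order sqrt (n ln ln n) of the centered sums matters, since n lambda_n exceeds it by a
   factor tending to infinity. *)
Require Import Defs.
From HB Require Import structures.
From mathcomp Require Import all_boot all_order all_algebra.
From mathcomp Require Import all_classical all_reals all_analysis.
From mathcomp Require Import measurable_realfun ring lra.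

Set Implicit Arguments.
Unset Strict Implicit.
Unset Printing Implicit Defensive.

Import Order.TTheory GRing.Theory Num.Theory.
Import numFieldNormedType.Exports.

Local Open Scope classical_set_scope.
Local Open Scope ring_scope.

(** * Positive semidefinite matrices and their pseudo-inverses *)

Section euclidean.
Variable (K : realType) (p : nat).
Implicit Types (u v : 'cV[K]_p) (M : 'M[K]_p).

Lemma dotpC u v : dotp u v = dotp v u.
Proof. by apply: eq_bigr => i _; rewrite mulrC. Qed.

Lemma dotpDl u1 u2 v : dotp (u1 + u2) v = dotp u1 v + dotp u2 v.
Proof. by rewrite -big_split; apply: eq_bigr => i _; rewrite mxE mulrDl. Qed.

Lemma dotpZl a u v : dotp (a *: u) v = a * dotp u v.
Proof. by rewrite big_distrr; apply: eq_bigr => i _; rewrite mxE /= mulrA. Qed.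

Lemma dotpDr u v1 v2 : dotp u (v1 + v2) = dotp u v1 + dotp u v2.
Proof. by rewrite dotpC dotpDl !(dotpC u). Qed.

Lemma dotpZr a u v : dotp u (a *: v) = a * dotp u v.
Proof. by rewrite dotpC dotpZl dotpC. Qed.

Lemma dotpNl u v : dotp (- u) v = - dotp u v.
Proof. by rewrite -scaleN1r dotpZl mulN1r. Qed.

Lemma dotpNr u v : dotp u (- v) = - dotp u v.
Proof. by rewrite dotpC dotpNl dotpC. Qed.

Lemma dotp0l v : dotp 0 v = 0 :> K.
Proof. by rewrite -(scale0r (0 : 'cV[K]_p)) dotpZl mul0r. Qed.

Lemma dotp0r v : dotp v 0 = 0 :> K.
Proof. by rewrite dotpC dotp0l. Qed.

Definition dotpE := (dotpDl, dotpDr, dotpZl, dotpZr, dotpNl, dotpNr, dotp0l, dotp0r).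

Lemma dotp_suml I (r : seq I) (P : pred I) (F : I -> 'cV[K]_p) v :
  dotp (\sum_(i <- r | P i) F i) v = \sum_(i <- r | P i) dotp (F i) v.
Proof.
elim/big_rec2 : _ => [|i x y _ <-]; first exact: dotp0l.
by rewrite dotpDl.
Qed.

Lemma dotp_mulmxl q (M : 'M[K]_(q, p)) u (v : 'cV[K]_q) :
  dotp (M *m u) v = dotp u (M^T *m v).
Proof.
rewrite /dotp; under eq_bigr do rewrite mxE big_distrl.
rewrite exchange_big; apply: eq_bigr => j _ /=; rewrite mxE big_distrr /=.
by apply: eq_bigr => i _; rewrite mxE mulrCA mulrA.
Qed.

Lemma dotp_mulmxr M u v : dotp u (M *m v) = dotp (M^T *m u) v.
Proof. by rewrite dotp_mulmxl trmxK. Qed.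

Lemma dotpvv_ge0 u : 0 <= dotp u u.
Proof. by apply: sumr_ge0 => i _; rewrite -expr2 sqr_ge0. Qed.

Lemma dotp_delta i v : dotp (delta_mx i 0) v = v i 0.
Proof.
rewrite /dotp (bigD1 i) //= big1 => [|j ji]; rewrite !mxE ?eqxx ?mul1r ?addr0 //.
by rewrite (negbTE ji) mul0r.
Qed.

Definition psd M := M^T = M /\ forall v, 0 <= dotp (M *m v) v.

Lemma psd_sym M u v : psd M -> dotp (M *m u) v = dotp (M *m v) u.
Proof. by move=> [sM _]; rewrite dotp_mulmxl sM dotpC. Qed.

Lemma psd_CS M u v : psd M ->
  dotp (M *m u) v ^+ 2 <= dotp (M *m u) u * dotp (M *m v) v.
Proof.
move=> psM; set a := dotp (M *m u) u; set b := dotp (M *m u) v.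
set c := dotp (M *m v) v.
have quad x y : 0 <= x ^+ 2 * a + 2 * (x * y) * b + y ^+ 2 * c.
  have := psM.2 (x *: u + y *: v).
  rewrite mulmxDr -!scalemxAr !dotpE (psd_sym v u psM) -/a -/b -/c.
  by congr (0 <= _); ring.
have a0 : 0 <= a by exact: psM.2.
have c0 : 0 <= c by exact: psM.2.
have [c_eq0|c_neq0] := eqVneq c 0.
  have [->|b0] := eqVneq b 0; first by rewrite expr0n mulr_ge0.
  (* With [c = 0] the form is affine in [y]; this choice of [y] gives it the value [- a - 2 < 0]. *)
  have := quad 1 (- (a + 1) / b); rewrite c_eq0 mulr0 addr0 expr1n !mul1r.
  by rewrite -mulrA divfK // => ?; lra.
have cpos : 0 < c by rewrite lt_neqAle eq_sym c_neq0.
have := quad c (- b).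
have -> : c ^+ 2 * a + 2 * (c * - b) * b + (- b) ^+ 2 * c = c * (a * c - b ^+ 2).
  by ring.
by rewrite pmulr_rge0 // subr_ge0.
Qed.

Lemma psd1 : psd 1%:M.
Proof. by split=> [|v]; rewrite ?trmx1 // mul1mx dotpvv_ge0. Qed.

Lemma enorm_ge0 u : 0 <= enorm u. Proof. exact: sqrtr_ge0. Qed.

Lemma enorm_sqr u : enorm u ^+ 2 = dotp u u.
Proof. by rewrite sqr_sqrtr // dotpvv_ge0. Qed.

Lemma dotp_CauchySchwarz u v : `|dotp u v| <= enorm u * enorm v.
Proof.
rewrite -(@ler_pXn2r _ 2) ?nnegrE ?mulr_ge0 ?enorm_ge0 // exprMn !enorm_sqr.
by rewrite real_normK ?num_real //; have := psd_CS u v psd1; rewrite !mul1mx.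
Qed.

Lemma dotp_le u v : dotp u v <= enorm u * enorm v.
Proof. exact: le_trans (ler_norm _) (dotp_CauchySchwarz u v). Qed.

Lemma enormZ a u : enorm (a *: u) = `|a| * enorm u.
Proof. by rewrite /enorm dotpZl dotpZr mulrA -expr2 sqrtrM ?sqr_ge0 // sqrtr_sqr. Qed.

Lemma enormN u : enorm (- u) = enorm u.
Proof. by rewrite -scaleN1r enormZ normrN1 mul1r. Qed.

Lemma enorm0 : enorm (0 : 'cV[K]_p) = 0. Proof. by rewrite /enorm dotp0l sqrtr0. Qed.

Lemma enormB u v : enorm (u - v) = enorm (v - u).
Proof. by rewrite -enormN opprB. Qed.

Lemma enorm_triangle u v : enorm (u + v) <= enorm u + enorm v.
Proof.
rewrite -(@ler_pXn2r _ 2) ?nnegrE ?addr_ge0 ?enorm_ge0 // sqrrD !enorm_sqr.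
rewrite dotpDl !dotpDr (dotpC v u); have := dotp_le u v; lra.
Qed.

Lemma enorm_entry u i : `|u i 0| <= enorm u.
Proof.
rewrite -(@ler_pXn2r _ 2) ?nnegrE ?enorm_ge0 // enorm_sqr real_normK ?num_real //.
rewrite /dotp (bigD1 i) //= -expr2 lerDl.
by apply: sumr_ge0 => j _; rewrite -expr2 sqr_ge0.
Qed.

Lemma enorm_eq0 u : enorm u = 0 -> u = 0.
Proof.
move=> u0; apply/colP => i; rewrite [RHS]mxE; apply/eqP.
by rewrite -normr_le0 -u0 enorm_entry.
Qed.

Lemma enorm_le_entries u a : 0 <= a -> (forall i, `|u i 0| <= a) ->
  enorm u <= p%:R * a.
Proof.
move=> a0 ua; rewrite -(@ler_pXn2r _ 2) ?nnegrE ?mulr_ge0 ?enorm_ge0 //.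
rewrite enorm_sqr (@le_trans _ _ (p%:R * a ^+ 2)) //.
  rewrite mulr_natl -[X in _ *+ X](card_ord p) -sumr_const; apply: ler_sum => i _.
  rewrite -expr2 -(@real_normK _ (u i 0)) ?num_real //.
  by rewrite lerXn2r ?nnegrE.
rewrite exprMn ler_wpM2r ?sqr_ge0 //; case: (p) => [|q]; first by rewrite expr0n.
by rewrite expr2 ler_peMl ?ler1n.
Qed.

(** The Frobenius norm: it dominates the operator norm and, unlike a supremum, is easily bounded
    from the entries. *)
Definition fnorm M : K := Num.sqrt (\sum_i \sum_j M i j ^+ 2).

Lemma fnorm_ge0 M : 0 <= fnorm M. Proof. exact: sqrtr_ge0. Qed.

Lemma enorm_mulmx M u : enorm (M *m u) <= fnorm M * enorm u.
Proof.
rewrite -(@ler_pXn2r _ 2) ?nnegrE ?mulr_ge0 ?enorm_ge0 ?fnorm_ge0 //.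
rewrite exprMn [fnorm _ ^+ 2]sqr_sqrtr; last first.
  by apply: sumr_ge0 => i _; apply: sumr_ge0 => j _; rewrite sqr_ge0.
rewrite !enorm_sqr /(dotp (M *m u)) big_distrl; apply: ler_sum => i _ /=.
have -> : (M *m u) i 0 = dotp (row i M)^T u.
  by rewrite mxE; apply: eq_bigr => j _; rewrite !mxE.
rewrite -expr2; have := psd_CS (row i M)^T u psd1; rewrite !mul1mx.
congr (_ <= _ * _); apply: eq_bigr => j _.
by rewrite !mxE expr2.
Qed.

Lemma fnorm_le_entries M a : 0 <= a -> (forall i j, `|M i j| <= a) ->
  fnorm M <= p%:R * a.
Proof.
move=> a0 Ma; rewrite -(@ler_pXn2r _ 2) ?nnegrE ?mulr_ge0 ?fnorm_ge0 //.
rewrite [fnorm _ ^+ 2]sqr_sqrtr; last first.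
  by apply: sumr_ge0 => i _; apply: sumr_ge0 => j _; rewrite sqr_ge0.
rewrite exprMn expr2 -mulrA !mulr_natl -[X in _ *+ X](card_ord p) -sumr_const.
apply: ler_sum => i _; rewrite -[X in _ *+ X](card_ord p) -sumr_const.
apply: ler_sum => j _; rewrite -(@real_normK _ (M i j)) ?num_real //.
by rewrite lerXn2r ?nnegrE.
Qed.

Lemma opnorm_mulmx M u : enorm (M *m u) <= opnorm M * enorm u.
Proof.
have [u0|u0] := eqVneq (enorm u) 0.
  by rewrite (enorm_eq0 u0) mulmx0 enorm0 mulr0.
have u_gt0 : 0 < enorm u by rewrite lt_neqAle eq_sym u0 enorm_ge0.
have -> : M *m u = enorm u *: (M *m ((enorm u)^-1 *: u)).
  by rewrite -scalemxAr scalerA mulfV // scale1r.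
rewrite enormZ ger0_norm ?enorm_ge0 // mulrC ler_wpM2r ?enorm_ge0 //.
(* [sup] is an upper bound only of bounded sets; here [fnorm M] provides the bound. *)
apply: ub_le_sup => /=.
  exists (fnorm M) => _ [v /= v1 <-]; apply: le_trans (enorm_mulmx M v) _.
  by rewrite ler_piMr ?fnorm_ge0.
exists ((enorm u)^-1 *: u) => //=.
by rewrite enormZ ger0_norm ?invr_ge0 ?enorm_ge0 // mulVf.
Qed.

(* For a positive semidefinite [M], the orthogonal projection on its image. *)
Definition im_proj M := mp_pinv M *m M.

Section psd_pinv.
Variables (C : 'M[K]_p) (psC : psd C).
Let A := mp_pinv C.
Let P := im_proj C.

Lemma im_proj_sym : P^T = P.
Proof. by have [_ _ _ ->] := mp_pinvP C. Qed.

Lemma im_projC : P *m C = C.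
Proof.
have [CAC _ _ _] := mp_pinvP C.
apply: trmx_inj; rewrite trmx_mul im_proj_sym psC.1.
by rewrite /P /im_proj mulmxA.
Qed.

(** [C *m A] and [P] are both symmetric and each absorbs the other, so transposing one absorption
    identity equates them. *)
Lemma im_proj_comm : C *m A = P.
Proof.
have [CAC _ CAs ACs] := mp_pinvP C.
have CCA : C *m A *m C = C by exact: CAC.
have e1 : P *m (C *m A) = C *m A by rewrite mulmxA im_projC.
have e2 : (C *m A) *m P = P.
  apply: trmx_inj; rewrite trmx_mul CAs im_proj_sym.
  rewrite /P /im_proj -/A -[LHS]mulmxA.
  have -> : C *m (C *m A) = C.
    by apply: trmx_inj; rewrite trmx_mul CAs psC.1.
  by [].
have := congr1 trmx e1; rewrite trmx_mul CAs im_proj_sym e2.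
by move=> ->.
Qed.

(** [A^T] is also a pseudo-inverse of the symmetric [C]; the computation is the one that shows
    uniqueness of the Moore-Penrose inverse. *)
Lemma mp_pinv_sym : A^T = A.
Proof.
have [CAC ACA CAs ACs] := mp_pinvP C.
have e1 : A^T *m C = P.
  by rewrite -{1}psC.1 -trmx_mul CAs im_proj_comm.
have e2 : C *m A^T = P.
  by rewrite -{1}psC.1 -trmx_mul ACs.
have -> : A^T = (A *m C *m A)^T by rewrite ACA.
rewrite trmx_mul trmx_mul mulmxA psC.1 e1 /P /im_proj -/A -mulmxA e2.
by rewrite -im_proj_comm mulmxA ACA.
Qed.

Lemma im_proj_idem : P *m P = P.
Proof.
have [CAC ACA _ _] := mp_pinvP C.
by rewrite /P /im_proj mulmxA -/A ACA.
Qed.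

End psd_pinv.

End euclidean.

Section psd_more.
Variables (K : realType) (p : nat) (C : 'M[K]_p) (psC : psd C).
Let P := im_proj C.

Lemma enorm_im_proj (h : 'cV[K]_p) : enorm (P *m h) <= enorm h.
Proof.
have [->|Ph0] := eqVneq (enorm (P *m h)) 0; first exact: enorm_ge0.
have Ph_gt0 : 0 < enorm (P *m h) by rewrite lt_neqAle eq_sym Ph0 enorm_ge0.
rewrite -(ler_pM2l Ph_gt0) -expr2 enorm_sqr dotp_mulmxr im_proj_sym mulmxA.
by rewrite im_proj_idem; exact: dotp_le.
Qed.

(* With [P = C^+ C], [|P h|^2 = <C h, C^+ P h>]; then Cauchy-Schwarz for C. *)
Lemma psd_coercive :
  exists2 c : K, 0 < c & forall h, c * enorm (P *m h) ^+ 2 <= dotp (C *m h) h.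
Proof.
set A := mp_pinv C.
have f1 : 0 < fnorm A + 1 by rewrite ltr_wpDl ?fnorm_ge0.
exists (fnorm A + 1)^-1 => [|h]; first by rewrite invr_gt0.
set q := enorm (P *m h).
have [->|q0] := eqVneq q 0; first by rewrite expr0n mulr0 psC.2.
have q_gt0 : 0 < q by rewrite lt_neqAle eq_sym q0 enorm_ge0.
have e1 : q ^+ 2 = dotp (C *m h) (A *m (P *m h)).
  by rewrite enorm_sqr {1}/P /im_proj -mulmxA dotp_mulmxl -/A (mp_pinv_sym psC).
have e2 : dotp (C *m (A *m (P *m h))) (A *m (P *m h)) <= fnorm A * q ^+ 2.
  rewrite mulmxA (im_proj_comm psC) mulmxA im_proj_idem.
  apply: le_trans (dotp_le _ _) _; rewrite mulrC expr2 mulrA.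
  by rewrite ler_wpM2r ?enorm_ge0 ?enorm_mulmx.
have := psd_CS h (A *m (P *m h)) psC; rewrite -e1.
move=> /le_trans/(_ (ler_wpM2l (psC.2 h) e2)).
rewrite expr2 [in leRHS]mulrA ler_pM2r ?exprn_gt0 // => q2.
rewrite mulrC ler_pdivrMr //; apply: le_trans q2 _.
by rewrite ler_wpM2l ?psC.2 // lerDl.
Qed.

End psd_more.

(** * Topology of the Euclidean norm *)

Section enorm_topology.
Variables (K : realType) (p : nat).
Implicit Types (u v w : 'cV[K]_p).

Lemma nbhs_enormP w (U : set 'cV[K]_p) :
  nbhs w U <-> exists2 e, 0 < e & forall z, enorm (z - w) < e -> U z.
Proof.
split=> [/nbhs_ballP[e /= e0 eU]|[e e0 eU]].
  exists e => // z zw; apply: eU; split=> // i j; rewrite ord1.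
  rewrite /ball /= distrC; apply: le_lt_trans zw.
  by have := enorm_entry (z - w) i; rewrite !mxE.
(* [p.+1] rather than [p] covers [p = 0] and makes the final inequality strict. *)
apply/nbhs_ballP; exists (e / p.+1%:R) => /=; first by rewrite divr_gt0.
move=> z [_ wz]; apply: eU.
have e1 : 0 <= e / p.+1%:R by rewrite divr_ge0 // ltW.
apply: (@le_lt_trans _ _ (p%:R * (e / p.+1%:R))).
  apply: enorm_le_entries => // i; have := wz i 0.
  by rewrite /ball /= distrC !mxE => /ltW.
by rewrite mulrC -mulrA gtr_pMr // mulrC ltr_pdivrMr // mul1r ltr_nat.
Qed.

Lemma near_enorm w e : 0 < e -> \forall z \near w, enorm (z - w) < e.
Proof. by move=> e0; apply/nbhs_enormP; exists e. Qed.

Lemma cvg_enormP {T} (F : set_system T) (FF : Filter F) (f : T -> 'cV[K]_p) w :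
  f @ F --> w <-> forall e, 0 < e -> \forall t \near F, enorm (f t - w) < e.
Proof.
split=> [fw e e0|h U /nbhs_enormP[e e0 eU]]; first exact: fw (near_enorm w e0).
by apply: filterS (h _ e0) => t; exact: eU.
Qed.

Lemma cvg_entry {T} (F : set_system T) (FF : Filter F) (f : T -> 'cV[K]_p) w i :
  f @ F --> w -> f t i 0 @[t --> F] --> w i 0.
Proof.
move=> fw; apply: (@continuous_cvg _ _ _ F FF f (fun M => M i 0) w) => //.
exact: coord_continuous.
Qed.

Lemma cvg_dotp {T} (F : set_system T) (FF : Filter F) (f g : T -> 'cV[K]_p) u v :
  f @ F --> u -> g @ F --> v -> dotp (f t) (g t) @[t --> F] --> dotp u v.
Proof.
move=> fu gv; apply: cvg_big => [|i _]; first exact: add_continuous.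
by apply: cvgM; exact: cvg_entry.
Qed.

Lemma cvg_enorm {T} (F : set_system T) (FF : Filter F) (f : T -> 'cV[K]_p) u :
  f @ F --> u -> enorm (f t) @[t --> F] --> enorm u.
Proof.
move=> fu; apply: (@continuous_cvg _ _ _ F FF (fun t => dotp (f t) (f t))
  Num.sqrt (dotp u u)); [exact: sqrt_continuous|exact: cvg_dotp].
Qed.

Lemma enorm_continuous : continuous (@enorm K p).
Proof. by move=> u; apply: (@cvg_enorm _ (nbhs u) _ id u). Qed.

Lemma cvg_mulmx {T} (F : set_system T) (FF : Filter F) (f : T -> 'cV[K]_p)
    (M : 'M[K]_p) u :
  f @ F --> u -> M *m f t @[t --> F] --> M *m u.
Proof.
move=> /cvg_enormP fu; apply/cvg_enormP => e e0.
have M1 : 0 < fnorm M + 1 by rewrite ltr_wpDl ?fnorm_ge0.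
apply: filterS (fu (e / (fnorm M + 1)) (divr_gt0 e0 M1)) => t.
rewrite ltr_pdivlMr // => h; rewrite -mulmxBr.
apply: le_lt_trans (enorm_mulmx _ _) _; apply: le_lt_trans h.
by rewrite mulrC ler_wpM2l ?enorm_ge0 // lerDl.
Qed.

Lemma mulmx_continuous (M : 'M[K]_p) : continuous (fun u : 'cV[K]_p => M *m u).
Proof. by move=> u; apply: (@cvg_mulmx _ (nbhs u) _ id M u). Qed.

Lemma dotp_continuous (f g : 'cV[K]_p -> 'cV[K]_p) : continuous f -> continuous g ->
  continuous (fun u => dotp (f u) (g u)).
Proof. by move=> cf cg u; exact: (cvg_dotp _ (cf u) (cg u)). Qed.

Lemma compact_enorm (S : set 'cV[K]_p) M :
  closed S -> (forall u, S u -> enorm u <= M) -> compact S.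
Proof.
move=> clS SM.
(* Compactness is transported through transposition from bounded closed sets of row vectors. *)
have tr_cont m n : continuous (trmx : 'M[K]_(m, n) -> 'M[K]_(n, m)).
  move=> u U /nbhs_ballP[e /= e0 eU]; apply/nbhs_ballP; exists e => //= v [_ uv].
  by apply: eU; split=> // i j; rewrite !mxE.
have -> : S = trmx @` [set v : 'rV[K]_p | S v^T].
  apply/seteqP; split=> [u Su|_ [v /= Sv <-] //].
  by exists u^T; rewrite /= ?trmxK.
apply: continuous_compact.
  by apply: continuous_subspaceT => u; exact: tr_cont.
apply: bounded_closed_compact; last first.
  apply: (@preimage_closed _ _ trmx S) => // u _; exact: tr_cont.
exists M; split; first exact: num_real.
move=> N MN v /= /SM vM; rewrite [leLHS](_ : _ = mx_norm v) // mx_normrE.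
apply/bigmax_leP; split=> [|[i j] _ /=].
  exact: le_trans (le_trans (enorm_ge0 _) vM) (ltW MN).
rewrite ord1 (le_trans _ (ltW MN)) // (le_trans _ vM) //.
by have := enorm_entry v^T j; rewrite mxE.
Qed.

End enorm_topology.

(** * Stability of the regularized problem *)

Section deterministic.
Variables (K : realType) (p : nat) (R : 'cV[K]_p -> \bar K).
Hypotheses (hproper : eproper R) (hlsc : lower_semicontinuous R)
  (hconvex : econvex R).
Variables (C : 'M[K]_p) (w0 eta0 : 'cV[K]_p).
Hypothesis psC : psd C.
Let A := mp_pinv C.
Let P := im_proj C.
Hypothesis eta0_sub : subdiff R w0 eta0.
Hypothesis eta0_im : P *m eta0 = eta0.
Hypothesis w0_uniq : forall h, P *m h = 0 -> (R (w0 + h) <= R w0)%E -> h = 0.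
Hypothesis eta0_min : forall q, subdiff R w0 q -> P *m q = q ->
  dotp (A *m eta0) eta0 <= dotp (A *m q) q.

Lemma subdiff_fin w eta : subdiff R w eta -> exists r, R w = r%:E.
Proof.
move=> h; have [nR [v Rv]] := hproper; have := h v.
move: (nR w); case: (R w) => [r _ _|_|//]; first by exists r.
by rewrite addye // leye_eq => /eqP Rvy; rewrite Rvy ltxx in Rv.
Qed.

Lemma subdiff_le w eta r v r' : subdiff R w eta -> R w = r%:E ->
  R v = r'%:E -> r + dotp eta (v - w) <= r'.
Proof. by move=> /(_ v) + Rw Rv; rewrite Rw Rv -EFinD lee_fin. Qed.

Lemma subdiff_mono w eta w' eta' : subdiff R w eta -> subdiff R w' eta' ->
  0 <= dotp (eta - eta') (w - w').
Proof.
move=> h h'; have [[r Rw] [r' Rw']] := (subdiff_fin h, subdiff_fin h').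
have := subdiff_le h Rw Rw'; have := subdiff_le h' Rw' Rw.
rewrite !dotpE; lra.
Qed.

(** On the sphere of radius [delta], [R (w0 + h) + B |P h|] strictly exceeds [R w0]: by uniqueness
    of [w0] when [P h = 0], and otherwise because [eta0 = P eta0] costs at most
    [enorm eta0 * |P h|], less than [B |P h|]. Lower semicontinuity and compactness make the gap
    uniform; convexity along rays extends it linearly outside the sphere. *)
Lemma growth (delta : K) : 0 < delta ->
  exists a B : K, [/\ 0 < a, 0 <= B & forall h, delta <= enorm h ->
    (R w0 + (a * enorm h - B * enorm (P *m h))%:E <= R (w0 + h))%E].
Proof.
move=> d0; have [r0 Rw0] := subdiff_fin eta0_sub.
pose B := enorm eta0 + 1.
have B0 : 0 <= B by rewrite addr_ge0 ?enorm_ge0.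
pose S := [set h : 'cV[K]_p | enorm h = delta].
have cS : compact S.
  apply: (@compact_enorm _ _ _ delta) => [|u ->//].
  have -> : S = @enorm K p @^-1` [set delta] by [].
  apply: preimage_closed => [u _|]; last exact: closed_eq.
  exact: enorm_continuous.
have strict h : S h -> (R w0 + (- B * enorm (P *m h))%:E < R (w0 + h))%E.
  move=> Sh; have [Ph0|Ph0] := eqVneq (P *m h) 0.
    rewrite Ph0 enorm0 mulr0 adde0 ltNge; apply/negP => /(w0_uniq Ph0) h0.
    by move: d0; rewrite -Sh h0 enorm0 ltxx.
  have Phgt0 : 0 < enorm (P *m h).
    by rewrite lt_neqAle enorm_ge0 andbT eq_sym; apply: contra_neq Ph0 => /enorm_eq0.
  have := eta0_sub (w0 + h); apply: lt_le_trans; rewrite Rw0 -!EFinD lte_fin ltrD2l.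
  rewrite addrC addKr -eta0_im dotp_mulmxl im_proj_sym -/P.
  have := dotp_CauchySchwarz eta0 (P *m h); rewrite ler_norml => /andP[+ _].
  by apply: lt_le_trans; rewrite mulNr ltrN2 /B mulrDl mul1r ltrDl.
move/compact_near_coveringP : cS.
pose G (a : K) h := (R w0 + (a * delta - B * enorm (P *m h))%:E <= R (w0 + h))%E.
move=> /(_ _ (0^'+) G _); case.
  move=> h Sh; have := strict h Sh; rewrite Rw0 -EFinD => hs.
  (* The strict gap is cut into pieces of size [e]: one pays for [a * delta], another for the
     variation of [B * enorm (P *m h)] near [h]. *)
  have [e e0 he] : exists2 e : K, 0 < e &
      ((r0 - B * enorm (P *m h) + e + e + e)%:E < R (w0 + h))%E.
    move: hs; case: (R (w0 + h)) => [r| |] //.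
      rewrite lte_fin => hr; exists ((r - (r0 - B * enorm (P *m h))) / 4).
        by rewrite divr_gt0 // subr_gt0 -mulNr.
      rewrite lte_fin; lra.
    by exists 1 => //; rewrite ltry.
  have [V V1 V2] := hlsc he.
  have B1 : 0 < B + 1 by rewrite ltr_wpDl.
  have /nbhs_enormP[e1 e10 e1V] := V1.
  have nA : \forall h' \near h, enorm (h' - h) < e1 by exact: near_enorm.
  have nB : \forall h' \near h, enorm (h' - h) < e / (B + 1).
    by apply: near_enorm; rewrite divr_gt0.
  near=> h' a => /=.
  have hV : V (w0 + h').
    by apply: e1V; rewrite opprD addrACA subrr add0r; near: h'.
  rewrite /G Rw0 -EFinD; apply: le_trans (ltW (V2 _ hV)); rewrite lee_fin.
  have h1 : enorm (h' - h) < e / (B + 1) by near: h'.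
  have h2 : a < e / delta by near: a; apply: nbhs_right_lt; rewrite divr_gt0.
  have {}h2 : a * delta < e by rewrite -ltr_pdivlMr.
  have h3 : enorm (P *m h) <= enorm (P *m h') + enorm (h' - h).
    have -> : P *m h = P *m h' + P *m (h - h') by rewrite -mulmxDr addrC subrK.
    apply: le_trans (enorm_triangle _ _) _; rewrite lerD2l.
    by rewrite (enormB h'); exact: enorm_im_proj.
  have h4 : B * enorm (P *m h) <= B * enorm (P *m h') + e.
    apply: le_trans (ler_wpM2l B0 h3) _; rewrite mulrDr lerD2l.
    apply: le_trans (ler_wpM2l B0 (ltW h1)) _.
    rewrite mulrCA ger_pMr // ler_pdivrMr // mul1r lerDl //.
  by lra.
move=> e /= e0 He; exists (e / 2), B; split=> //; first by rewrite divr_gt0.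
have {He} Ha h : S h -> G (e / 2) h.
  apply: He => /=; last by rewrite divr_gt0.
  by rewrite sub0r normrN gtr0_norm ?divr_gt0 // gtr_pMr // invf_lt1 // ltr1n.
set a := e / 2; have a0 : 0 < a by rewrite divr_gt0.
move=> h hd; have h0 : 0 < enorm h by exact: lt_le_trans hd.
(* [t] brings [h] back to the sphere, and convexity is used on the segment from [w0] to [w0 + h]. As
   [econvex] speaks of [0 < t < 1] only, [t = 1] is treated apart. *)
pose t := delta / enorm h; have t0 : 0 < t by rewrite divr_gt0.
have tS : S (t *: h) by rewrite /S /= enormZ gtr0_norm // divfK ?gt_eqF.
have := Ha _ tS; rewrite /G Rw0 -scalemxAr enormZ (gtr0_norm t0) => G1.
have tE : delta = t * enorm h by rewrite divfK ?gt_eqF.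
have [t1|t1] := eqVneq t 1.
  by move: G1; rewrite t1 scale1r mul1r tE t1 mul1r.
have tlt1 : t < 1.
  by rewrite lt_neqAle t1 /t ler_pdivrMr // mul1r.
have t01 : 0 < t < 1 by rewrite t0.
have := hconvex (w0 + h) w0 t01.
have -> : t *: (w0 + h) + (1 - t) *: w0 = w0 + t *: h.
  by rewrite scalerDr addrAC -scalerDl addrC subrKC scale1r addrC.
move=> /(le_trans G1); rewrite Rw0.
case: (R (w0 + h)) (hproper.1 (w0 + h)) => [r _|_ _|//]; last first.
  by rewrite -EFinD leey.
rewrite -!EFinM -!EFinD !lee_fin tE => G2.
by rewrite -(ler_pM2l t0) /a; lra.
Unshelve. all: by end_near.
Qed.


(** With [d = q - eta0], the assumed inequality and the minimality of [eta0] give [<A d, d> <= 0].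
    Coercivity of [C] at [A *m d], where [C *m (A *m d) = d], then forces [d = 0]. *)
Lemma limit_dual q : subdiff R w0 q -> P *m q = q ->
  dotp (A *m q) q <= dotp (A *m eta0) q -> q = eta0.
Proof.
move=> qs qP qle; have [c c0 hc] := psd_coercive psC.
have imA v : P *m v = v -> C *m (A *m v) = v.
  by move=> vP; rewrite mulmxA (im_proj_comm psC).
have sA u v : dotp (A *m u) v = dotp (A *m v) u.
  by rewrite dotp_mulmxl (mp_pinv_sym psC) dotpC.
pose d := q - eta0.
have dP : P *m d = d by rewrite /d mulmxBr qP eta0_im.
have d_le : dotp (A *m d) d <= 0.
  rewrite /d mulmxBr !dotpE (sA q eta0); have := eta0_min qs qP.
  rewrite -/A; lra.
have Ad0 : P *m (A *m d) = 0.
  apply: enorm_eq0; apply/eqP; rewrite -sqrf_eq0 eq_le sqr_ge0 andbT.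
  rewrite -(ler_pM2l c0) mulr0; apply: le_trans (hc _) _.
  by rewrite imA // dotpC.
have : C *m (P *m (A *m d)) = d.
  have CP : C *m P = C.
    by apply: trmx_inj; rewrite trmx_mul im_proj_sym psC.1 (im_projC psC).
  by rewrite mulmxA CP imA.
by rewrite Ad0 mulmx0 => /esym/eqP; rewrite subr_eq0 => /eqP.
Qed.

(** A [q] at distance at least [delta] from [eta0] fails one of the three requirements of
    [limit_dual]: lying in Im C, being a subgradient at [w0], satisfying the energy inequality. Each
    failure persists for nearby [q] and small tolerances, and compactness of the set of such [q]
    gives a common [e]. *)
Lemma dual_compactness (M delta : K) : 0 < delta ->
  exists2 e, 0 < e & forall z q, subdiff R z q -> enorm (z - w0) <= e ->
    enorm q <= M -> enorm (q - P *m q) <= e ->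
    dotp (A *m q) q - dotp (A *m eta0) q <= e -> enorm (q - eta0) < delta.
Proof.
move=> d0; have [r0 Rw0] := subdiff_fin eta0_sub.
pose S := [set q : 'cV[K]_p | enorm q <= M /\ delta <= enorm (q - eta0)].
pose f q := dotp (A *m q) q - dotp (A *m eta0) q.
have idc : continuous (fun q : 'cV[K]_p => q) by move=> q; exact: cvg_id.
have c1 : continuous (fun q => dotp (A *m q) q).
  exact: (dotp_continuous (@mulmx_continuous _ _ A) idc).
have c2 : continuous (fun q => dotp (A *m eta0) q).
  have cc : continuous (fun _ : 'cV[K]_p => A *m eta0) by exact: cst_continuous.
  exact: (dotp_continuous cc idc).
have f_cont : continuous f by move=> q; exact: (cvgB (c1 q) (c2 q)).
have g_cont : continuous (fun q : 'cV[K]_p => enorm (q - P *m q)).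
  by move=> q; exact: (cvg_enorm _ (cvgB (idc q) (@mulmx_continuous _ _ P q))).
have h_cont : continuous (fun q : 'cV[K]_p => enorm (q - eta0)).
  by move=> q; exact: (cvg_enorm _ (cvgB (idc q) (cvg_cst eta0))).
have cS : compact S.
  apply: (@compact_enorm _ _ _ M) => [|u []//].
  apply: closedI.
    apply: (@preimage_closed _ _ (@enorm K p) [set x | x <= M]).
      by move=> u _; exact: enorm_continuous.
    exact: closed_le.
  apply: (@preimage_closed _ _ (fun q : 'cV[K]_p => enorm (q - eta0)) [set x | delta <= x]).
    by move=> u _; exact: h_cont.
  exact: closed_ge.
move/compact_near_coveringP : cS.
(* [z] is quantified inside [G]: it enters only through its distance to [w0], so compactness is
   needed in [q] alone. *)
pose G (e : K) q := forall z, subdiff R z q -> enorm (z - w0) <= e ->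
    enorm (q - P *m q) <= e -> f q <= e -> False.
move=> /(_ _ (0^'+) G _); case.
  move=> q [qM qd].
  have [qP|qP] := pselect (P *m q = q); last first.
    have g0 : 0 < enorm (q - P *m q).
      rewrite lt_neqAle enorm_ge0 andbT eq_sym; apply/eqP => /enorm_eq0 /eqP.
      by rewrite subr_eq0 => /eqP /esym.
    near=> q' e => /= z _ _ + _; apply/negP; rewrite -ltNge.
    apply: (@lt_trans _ _ (enorm (q - P *m q) / 2)).
      by near: e; apply: nbhs_right_lt; rewrite divr_gt0.
    near: q'; apply: (cvgr_gt _ (g_cont q)).
    by rewrite gtr_pMr // invf_lt1 // ltr1n.
  have [qs|/existsNP[v /negP]] := pselect (subdiff R w0 q); last first.
    rewrite -ltNge Rw0 -EFinD => Rv.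
    have [rv Rv'] : exists rv, R v = rv%:E.
      by move: Rv (hproper.1 v); case: (R v) => [r _ _| |]//; exists r.
    move: Rv; rewrite Rv' lte_fin => rv_lt.
    (* The graph of [subdiff R] is closed. [D] is the amount by which [v] violates the subgradient
       inequality at [w0]: half is spent on lower semicontinuity of [R], a quarter on replacing [q]
       by [q'], a quarter on replacing [w0] by [z]. *)
    pose D := r0 + dotp q (v - w0) - rv.
    have D0 : 0 < D by rewrite subr_gt0.
    have [V V1 V2] : exists2 V, nbhs w0 V & forall y, V y -> ((r0 - D / 2)%:E < R y)%E.
      by apply: hlsc; rewrite Rw0 lte_fin gtrDl oppr_lt0 divr_gt0.
    have /nbhs_enormP[e1 e10 e1V] := V1.
    pose B := enorm (v - w0) + enorm q + 2.
    have B0 : 0 < B by rewrite ltr_wpDl // addr_ge0 ?enorm_ge0.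
    have nA : \forall q' \near q, enorm (q' - q) < D / 4 / B.
      by apply: near_enorm; rewrite !divr_gt0.
    have nB : \forall q' \near q, enorm (q' - q) < 1 by exact: near_enorm.
    near=> q' e => /= z zs ze _ _.
    have e_lt1 : e < e1 by near: e; apply: nbhs_right_lt.
    have e_lt2 : e < D / 4 / B by near: e; apply: nbhs_right_lt; rewrite !divr_gt0.
    have := V2 z (e1V _ (le_lt_trans ze e_lt1)).
    have [rz Rz] := subdiff_fin zs; rewrite Rz lte_fin => rz_gt.
    have := subdiff_le zs Rz Rv'.
    have -> : v - z = (v - w0) - (z - w0) by rewrite opprB addrA subrK.
    have q'E : q' = q + (q' - q) by rewrite addrC subrK.
    have b1 := dotp_CauchySchwarz (q' - q) (v - w0).
    have b2 := dotp_CauchySchwarz q' (z - w0).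
    have b3 : enorm q' <= enorm q + 1.
      rewrite {1}q'E; apply: le_trans (enorm_triangle _ _) _.
      by rewrite lerD2l; apply: ltW; near: q'.
    have b4 : enorm (q' - q) < D / 4 / B by near: q'.
    have DB : D / 4 / B * B = D / 4 by rewrite divfK ?gt_eqF.
    have b5 : enorm (q' - q) * enorm (v - w0) <= D / 4.
      rewrite -DB; apply: ler_pM; rewrite ?enorm_ge0 ?(ltW b4) //.
      by rewrite /B -addrA lerDl addr_ge0 ?enorm_ge0.
    have b6 : enorm q' * enorm (z - w0) < D / 4.
      rewrite mulrC -DB.
      rewrite (@le_lt_trans _ _ (enorm (z - w0) * B)) //; last first.
        by rewrite ltr_pM2r // (le_lt_trans ze).
      rewrite ler_wpM2l ?enorm_ge0 // (le_trans b3) // /B.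
      by have := enorm_ge0 (v - w0); lra.
    have -> : dotp q' (v - w0 - (z - w0)) =
        dotp q (v - w0) + dotp (q' - q) (v - w0) - dotp q' (z - w0).
      by rewrite !dotpE; lra.
    move: b1 b2; rewrite !ler_norml => /andP[b1 _] /andP[_ b2] last.
    by move: rv_lt rz_gt; rewrite /D in b5 b6 *; lra.
  have f0 : 0 < f q.
    rewrite ltNge subr_le0; apply/negP => /(limit_dual qs qP) qE.
    by move: qd; rewrite qE subrr enorm0 leNgt d0.
  near=> q' e => /= z _ _ _; apply/negP; rewrite -ltNge.
  apply: (@lt_trans _ _ (f q / 2)).
    by near: e; apply: nbhs_right_lt; rewrite divr_gt0.
  near: q'; apply: (cvgr_gt _ (f_cont q)).
  by rewrite gtr_pMr // invf_lt1 // ltr1n.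
move=> e /= e0 He; exists (e / 2); first by rewrite divr_gt0.
have {He} He : S `<=` G (e / 2).
  apply: He => /=; last by rewrite divr_gt0.
  by rewrite sub0r normrN gtr0_norm ?divr_gt0 // gtr_pMr // invf_lt1 // ltr1n.
move=> z q qs ze qM qPq fq; rewrite ltNge; apply/negP => qd.
by apply: (He q _ z).
Unshelve. all: by end_near.
Qed.

(** Pairing the residual with [h = z - w0] costs [|g| |h|], and [|h|] is only known to be small; the
    bound [kappa * lam ^+ 2] on the residual is what still yields [|P h| = O(lam)]. The vector [b]
    pairs with [P h] alone, so [kappa * lam] suffices for it. *)
Lemma stability (delta : K) : 0 < delta ->
  exists2 kappa, 0 < kappa & forall (lam : K) (Cn : 'M[K]_p) (b z eta : 'cV[K]_p),
    0 < lam < kappa -> psd Cn -> Cn *m P = Cn -> P *m b = b ->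
    fnorm (Cn - C) <= kappa -> enorm b <= kappa * lam ->
    subdiff R z eta ->
    enorm (lam *: eta + Cn *m (z - w0) - b) <= kappa * lam ^+ 2 ->
    enorm (z - w0) < delta /\ enorm (eta - eta0) < delta.
Proof.
move=> d0; have [c c0 hc] := psd_coercive psC.
pose E := enorm eta0; have E0 : 0 <= E by exact: enorm_ge0.
(* [D] will bound [|P h| / lam], [M] the dual [eta], and [d1] is the radius at which [growth] is
   invoked. [L] collects the constants of the final energy estimate. *)
pose D := 2 / c * (2 + E) + 1.
have D1 : 1 <= D by rewrite lerDr mulr_ge0 ?divr_ge0 ?addr_ge0 ?(ltW c0).
have D0 : 0 <= D by exact: le_trans D1.
pose M := 2 + (fnorm C + 1) * D.
have [e1 e10 hcompact] := dual_compactness M d0.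
pose d1 := Num.min (Num.min delta e1) 1.
have d10 : 0 < d1 by rewrite !lt_min d0 e10 ltr01.
have [a [B [a0 B0 hgrowth]]] := growth d10.
pose F := fnorm A + 1; have F1 : 1 <= F by rewrite lerDr fnorm_ge0.
pose L := (M + E) * F * (2 + D) + 2.
have M0 : 0 <= M.
  by apply: addr_ge0 => //; apply: mulr_ge0 => //; rewrite addr_ge0 ?fnorm_ge0.
have F0 : 0 <= F by exact: le_trans F1.
have L2 : 2 <= L by rewrite lerDr !mulr_ge0 // addr_ge0.
(* Half-way between nothing and a rate: [lam < k2] is exactly what contradicts [s9] below. *)
pose k2 := a * d1 * c / (4 * (1 + B) ^+ 2).
have B1 : 0 < 1 + B by rewrite ltr_wpDr.
have k20 : 0 < k2 by rewrite divr_gt0 ?mulr_gt0 ?exprn_gt0.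
pose kappa := Num.min (Num.min (c / 2) (Num.min (a / 2) 1)) (Num.min k2 (e1 / L)).
have L0 : 0 < L by lra.
exists kappa; first by rewrite !lt_min k20 ltr01 !divr_gt0.
move=> lam Cn b z eta /andP[l0 lk] psn CnP Pb dC bk zs gk.
have : kappa <= kappa by [].
rewrite {2}/kappa !le_min => /andP[/and3P[kc ka k1] /andP[kk2]].
rewrite ler_pdivlMr // => ke1.
set g := _ - b in gk; set h := z - w0 in g gk *.
set x := enorm (P *m h); set H := enorm h.
have x0 : 0 <= x by exact: enorm_ge0.
have H0 : 0 <= H by exact: enorm_ge0.
have xH : x <= H by exact: enorm_im_proj.
have PCn : P *m Cn = Cn.
  by apply: trmx_inj; rewrite trmx_mul im_proj_sym psn.1.
have quadn : c / 2 * x ^+ 2 <= dotp (Cn *m h) h.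
  have -> : dotp (Cn *m h) h = dotp (Cn *m (P *m h)) (P *m h).
    by rewrite mulmxA CnP -{1}PCn -mulmxA dotp_mulmxl im_proj_sym.
  have -> : Cn = C + (Cn - C) by rewrite addrC subrK.
  have := hc (P *m h); rewrite mulmxA im_proj_idem // -/x.
  rewrite mulmxDl dotpDl.
  have := dotp_CauchySchwarz ((Cn - C) *m (P *m h)) (P *m h).
  have : enorm ((Cn - C) *m (P *m h)) * x <= kappa * x ^+ 2.
    rewrite expr2 mulrA ler_wpM2r //; apply: le_trans (enorm_mulmx _ _) _.
    by rewrite ler_wpM2r.
  have : kappa * x ^+ 2 <= c / 2 * x ^+ 2 by rewrite ler_wpM2r // sqr_ge0.
  rewrite -/x ler_norml => h1 h2 /andP[h3 _]; lra.
have l1 : lam <= 1 by exact: le_trans (ltW lk) k1.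
have l2 : lam ^+ 2 <= lam by rewrite expr2 ler_piMr // ltW.
have k0 : 0 < kappa by exact: lt_trans l0 lk.
(* The energy identity: the residual equation paired with [h]. *)
have key : lam * dotp eta h = dotp g h + dotp b h - dotp (Cn *m h) h.
  by rewrite /g !dotpE; lra.
have gh : dotp g h <= kappa * lam ^+ 2 * H.
  by apply: le_trans (dotp_le _ _) _; rewrite ler_wpM2r.
have bh : dotp b h <= kappa * lam * x.
  rewrite -Pb dotp_mulmxl im_proj_sym; apply: le_trans (dotp_le _ _) _.
  by rewrite ler_wpM2r.
have e0h : dotp eta0 h = dotp eta0 (P *m h).
  by rewrite -{1}eta0_im dotp_mulmxl im_proj_sym.
have [r0 Rw0] := subdiff_fin eta0_sub; have [r Rz] := subdiff_fin zs.
(* If [d1 <= H], then growth gives [H = O(x)] in [s7] and coercivity gives [x = O(lam)] in [s8],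
   which bounds [lam] below by [k2]. *)
have Hd1 : H < d1.
  rewrite ltNge; apply/negP => dH.
  have w0h : w0 + h = z by rewrite addrC subrK.
  have := hgrowth h dH; rewrite w0h Rw0 Rz -EFinD lee_fin -/x -/H.
  have := subdiff_le zs Rz Rw0; rewrite -opprB -/h dotpNr => s1 s2.
  have s3 : lam * (a * H - B * x) <= lam * dotp eta h by rewrite ler_pM2l //; lra.
  have s4 : kappa * lam ^+ 2 * H <= a / 2 * (lam * H).
    by rewrite -mulrA ler_pM ?mulr_ge0 ?sqr_ge0 ?ler_wpM2r // ltW.
  have s5 : kappa * lam * x <= lam * x by rewrite -mulrA ler_piMl ?mulr_ge0 // ltW.
  have s6 : a / 2 * (lam * H) + c / 2 * x ^+ 2 <= lam * ((1 + B) * x) by lra.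
  have s7 : a / 2 * H <= (1 + B) * x.
    rewrite -(ler_pM2l l0); have : 0 <= c / 2 * x ^+ 2.
      by rewrite mulr_ge0 ?sqr_ge0 // divr_ge0 // ltW.
    lra.
  have xp : 0 < x.
    rewrite -(pmulr_rgt0 _ B1); apply: lt_le_trans s7.
    by rewrite mulr_gt0 ?divr_gt0 // (lt_le_trans d10).
  have s8 : c / 2 * x <= lam * (1 + B).
    rewrite -(ler_pM2r xp); have : 0 <= a / 2 * (lam * H).
      by rewrite !mulr_ge0 ?invr_ge0 // ltW.
    lra.
  have s9 : a / 2 * d1 * (c / 2) <= (1 + B) ^+ 2 * lam.
    apply: (@le_trans _ _ ((1 + B) * x * (c / 2))).
      rewrite ler_wpM2r ?divr_ge0 ?(ltW c0) //; apply: le_trans s7.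
      by rewrite ler_wpM2l // divr_ge0 // ltW.
    have -> : (1 + B) * x * (c / 2) = (1 + B) * (c / 2 * x) by ring.
    have -> : (1 + B) ^+ 2 * lam = (1 + B) * (lam * (1 + B)) by ring.
    by rewrite ler_wpM2l // ltW.
  have : lam < k2 by exact: lt_le_trans lk kk2.
  rewrite /k2 ltr_pdivlMr ?mulr_gt0 ?exprn_gt0 //; lra.
have [Hd He1 H1] : [/\ H < delta, H < e1 & H < 1].
  by move: Hd1; rewrite !lt_min => /andP[/andP[]].
split=> //.
have mono := subdiff_mono zs eta0_sub; rewrite -/h dotpDl dotpNl in mono.
have e0x : - dotp eta0 h <= E * x.
  rewrite e0h -dotpNr; apply: le_trans (dotp_le _ _) _.
  by rewrite enormN.
have gh2 : dotp g h <= lam ^+ 2.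
  apply: le_trans gh _; rewrite -mulrA mulrCA ler_piMr ?sqr_ge0 //.
  by rewrite mulr_ile1 // ltW.
(* Once [H < 1], monotonicity between [z] and [w0] bounds [dotp eta h] below by [- E * x], and the
   energy identity becomes a quadratic inequality in [x]. *)
have xD : x <= D * lam.
  have t1 : c / 2 * x ^+ 2 <= lam ^+ 2 + (1 + E) * lam * x.
    have : 0 <= lam * dotp eta h - lam * dotp eta0 h by rewrite -mulrBr mulr_ge0 // ltW.
    have : kappa * lam * x <= lam * x by rewrite -mulrA ler_piMl ?mulr_ge0 // ltW.
    have : lam * - dotp eta0 h <= lam * (E * x) by rewrite ler_pM2l.
    lra.
  have [xl|lx] := leP x lam; first by apply: le_trans xl _; rewrite ler_peMl // ltW.
  have xp : 0 < x by exact: lt_trans lx.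
  have t2 : c / 2 * x <= (2 + E) * lam.
    rewrite -(ler_pM2r xp).
    have : lam ^+ 2 <= lam * x by rewrite expr2 ler_pM2l // ltW.
    lra.
  rewrite /D mulrDl mul1r ler_wpDr ?(ltW l0) //.
  rewrite -[leRHS]mulrA -ler_pdivrMl ?divr_gt0 //.
  by rewrite invf_div; apply: le_trans t2.
have etaE : lam *: eta = g + b - Cn *m h.
  by rewrite /g subrK addrK.
have bk1 : enorm b <= lam.
  by apply: le_trans bk _; rewrite ler_piMl // ltW.
have gk1 : enorm g <= kappa * lam.
  by apply: le_trans gk _; rewrite ler_wpM2l // ltW.
have dCh : enorm ((Cn - C) *m (P *m h)) <= kappa * (D * lam).
  apply: le_trans (enorm_mulmx _ _) _.
  by apply: ler_pM; rewrite ?fnorm_ge0 // x0.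
have CnPh : Cn *m h = Cn *m (P *m h) by rewrite mulmxA CnP.
have etaM : enorm eta <= M.
  rewrite -(ler_pM2l l0) -{1}(gtr0_norm l0) -enormZ etaE CnPh.
  have -> : Cn *m (P *m h) = C *m (P *m h) + (Cn - C) *m (P *m h).
    by rewrite -mulmxDl addrC subrK.
  apply: le_trans (enorm_triangle _ _) _; rewrite enormN.
  apply: le_trans (lerD (enorm_triangle _ _) (enorm_triangle _ _)) _.
  have u1 : enorm (C *m (P *m h)) <= fnorm C * (D * lam).
    by apply: le_trans (enorm_mulmx _ _) _; rewrite ler_wpM2l ?fnorm_ge0.
  have u2 : kappa * (D * lam) <= D * lam.
    by rewrite ler_piMl ?mulr_ge0 // ?(ltW l0) //; lra.
  have u3 : kappa * lam <= lam by rewrite ler_piMl // ltW.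
  rewrite /M; lra.
(* [b] and [Cn *m h] lie in Im C, so the part of [lam *: eta] outside it comes from the residual [g]
   alone. *)
have etaP : eta - P *m eta = lam^-1 *: (g - P *m g).
  apply: (scalerI (a := lam)); first by rewrite gt_eqF.
  rewrite scalerA mulfV ?gt_eqF // scale1r scalerBr scalemxAr etaE.
  rewrite (mulmxBr P (g + b)) (mulmxDr P g b) Pb mulmxA PCn.
  by rewrite opprB addrA addrNK opprD addrACA subrr addr0.
have gPg : enorm (g - P *m g) <= 2 * kappa * lam ^+ 2.
  apply: le_trans (enorm_triangle _ _) _; rewrite enormN.
  by have := le_trans (enorm_im_proj C g) gk; rewrite -/P; lra.
have e1kappa : 2 * kappa <= e1.
  by apply: le_trans ke1; rewrite mulrC ler_wpM2l // ltW.
have etaPe : enorm (eta - P *m eta) <= 2 * kappa * lam.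
  rewrite etaP enormZ gtr0_norm ?invr_gt0 // ler_pdivrMl //.
  by apply: le_trans gPg _; rewrite expr2; lra.
apply: (hcompact z) => //; first exact: ltW.
  by apply: le_trans etaPe _; apply: le_trans e1kappa; rewrite ler_piMr // mulr_ge0 // ltW.
pose e := A *m (g + b) - A *m ((Cn - C) *m (P *m h)).
have CnE : Cn *m (P *m h) = C *m (P *m h) + (Cn - C) *m (P *m h).
  by rewrite -mulmxDl addrC subrK.
have ACP : A *m (C *m (P *m h)) = P *m h.
  by rewrite mulmxA -[A *m C]/P mulmxA im_proj_idem.
have AetaE : lam *: (A *m eta) = e - P *m h.
  rewrite scalemxAr etaE CnPh (mulmxBr A (g + b)) /e CnE (mulmxDr A (C *m _)) ACP.
  by rewrite opprD addrA addrAC.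
have e_le : enorm e <= F * (kappa * (2 + D) * lam).
  have A_le v t : enorm v <= t -> enorm (A *m v) <= F * t.
    move=> vt; apply: le_trans (enorm_mulmx _ _) _.
    by apply: ler_pM; rewrite ?fnorm_ge0 ?enorm_ge0 // lerDl.
  apply: le_trans (enorm_triangle _ _) _; rewrite enormN.
  have v1 : enorm (g + b) <= kappa * lam + kappa * lam.
    by apply: le_trans (enorm_triangle _ _) _; rewrite lerD.
  apply: le_trans (lerD (A_le _ _ v1) (A_le _ _ dCh)) _.
  by rewrite -mulrDr; rewrite le_eqVlt; apply/orP; left; apply/eqP; ring.
have sA : dotp (A *m eta0) eta = dotp (A *m eta) eta0.
  by rewrite dotp_mulmxl (mp_pinv_sym psC) dotpC.
(* Multiplied by [lam], the energy gap is [<e - P h, eta - eta0>]. Monotonicity gives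
   [<h, eta - eta0> >= 0], and replacing [h] by [P h] costs only the part of [eta] outside Im C. *)
rewrite sA -(ler_pM2l l0).
have -> : lam * (dotp (A *m eta) eta - dotp (A *m eta) eta0) =
    dotp e (eta - eta0) - dotp (P *m h) (eta - eta0).
  rewrite [RHS](_ : _ = dotp (e - P *m h) (eta - eta0)); last first.
    by rewrite (dotpDl e) dotpNl.
  by rewrite -AetaE !dotpE; ring.
have w1 : dotp e (eta - eta0) <= F * (kappa * (2 + D) * lam) * (M + E).
  apply: le_trans (dotp_le _ _) _; apply: ler_pM; rewrite ?enorm_ge0 //.
  by apply: le_trans (enorm_triangle _ _) _; rewrite enormN lerD2r.
have w2 : - dotp (P *m h) (eta - eta0) <= 2 * kappa * lam.
  have -> : dotp (P *m h) (eta - eta0) =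
      (dotp eta h - dotp eta0 h) - dotp (eta - P *m eta) h.
    rewrite dotp_mulmxl im_proj_sym -/P mulmxBr eta0_im (dotpC h).
    by rewrite (dotpDl (P *m eta)) (dotpDl eta) !dotpNl; ring.
  have w3 : dotp (eta - P *m eta) h <= 2 * kappa * lam.
    apply: le_trans (dotp_le _ _) _; apply: le_trans etaPe.
    by rewrite ler_piMr ?enorm_ge0 // ltW.
  by rewrite opprB lerBlDr ler_wpDr.
apply: le_trans (lerD w1 w2) _.
have -> : F * (kappa * (2 + D) * lam) * (M + E) + 2 * kappa * lam =
    lam * (kappa * L) by rewrite /L; ring.
by rewrite ler_pM2l.
Qed.
End deterministic.

(** * Strata and relative interiors of subdifferentials *)

Section stratification.
Variables (K : realType) (p : nat).
Local Notation V := 'cV[K]_p.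
Implicit Types (Ms : set (set V)) (D : set V) (f : V -> \bar K).

Lemma stratumP Ms D w : stratification Ms D -> D w ->
  Ms (stratum Ms w) /\ stratum Ms w w.
Proof.
move=> [_ [cov _ _] _]; rewrite -cov => -[M MsM Mw].
exact: (@getPex _ [set M | Ms M /\ M w] (ex_intro _ M (conj MsM Mw))).
Qed.

(** By finiteness, the closures of the strata that do not adhere to [w0] form a closed union
    avoiding [w0]. Near [w0] only strata adherent to [w0] are met, and the frontier condition orders
    them. *)
Lemma stratum_le_near Ms D w0 : stratification Ms D -> D w0 ->
  \forall w \near w0, D w -> strat_le (stratum Ms w0) (stratum Ms w).
Proof.
move=> strM Dw0; have [finM _ frontier] := strM.
have [Ms0 Mw0] := stratumP strM Dw0.
pose far := [set M | Ms M /\ ~ closure M w0].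
have clF : closed (\bigcup_(M in far) closure M).
  apply: closed_bigcup => [|M _]; last exact: closed_closure.
  by apply: sub_finite_set finM => M [].
have : nbhs w0 (~` \bigcup_(M in far) closure M).
  apply: open_nbhs_nbhs; split; first by rewrite openC.
  by move=> [M [_ +] Mc]; apply.
apply: filterS => w wfar Dw; have [Msw Mw] := stratumP strM Dw.
have [cl0|ncl0] := pselect (closure (stratum Ms w) w0).
  by apply: (frontier _ _ Ms0 Msw); exists w0.
by exfalso; apply: wfar; exists (stratum Ms w) => //; exact: subset_closure.
Qed.

(** A convex combination in which [w] carries the remaining weight [1 - \sum_i c i]. *)
Lemma subdiff_comb f eta w n (s : 'I_n -> V) (c : 'I_n -> K) :
  subdiff f eta w -> (forall i, subdiff f eta (s i)) ->
  (forall i, 0 <= c i) -> \sum_i c i <= 1 ->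
  subdiff f eta (w + \sum_i c i *: (s i - w)).
Proof.
move=> hw hs c0 c1 v; have := hw v; have hsv i := hs i v.
move: hsv; case: (f eta) => [r| |].
- case: (f v) => [rv|_ _|_]; [|by rewrite leey|by rewrite -EFinD].
  rewrite -EFinD lee_fin => hsv hwv; rewrite -EFinD lee_fin.
  have {}hsv i : dotp (s i) (v - eta) <= rv - r.
    by have := hsv i; rewrite -EFinD lee_fin; lra.
  rewrite dotpDl dotp_suml.
  have -> : \sum_i dotp (c i *: (s i - w)) (v - eta) =
      \sum_i c i * dotp (s i) (v - eta) - (\sum_i c i) * dotp w (v - eta).
    rewrite big_distrl -sumrB; apply: eq_bigr => i _ /=.
    by rewrite dotpZl dotpDl dotpNl mulrBr.
  have : \sum_i c i * dotp (s i) (v - eta) <= (\sum_i c i) * (rv - r).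
    by rewrite big_distrl; apply: ler_sum => i _; exact: ler_wpM2l.
  have : (1 - \sum_i c i) * dotp w (v - eta) <= (1 - \sum_i c i) * (rv - r).
    by rewrite ler_wpM2l ?subr_ge0 //; lra.
  lra.
- by move=> _; rewrite !addye.
- by move=> _ _; rewrite addNye leNye.
Qed.

(** Take a finite family of directions of maximal rank: appending [u - w] cannot raise the rank, so
    [u - w] is already in the span. *)
Lemma affine_directions (S : set V) w : S w ->
  exists (n : nat) (s : 'I_n -> V), (forall i, S (s i)) /\
    forall u, S u -> ((u - w)^T <= \matrix_i (s i - w)^T)%MS.
Proof.
move=> Sw.
pose dirs n (s : 'I_n -> V) := \matrix_i (s i - w)^T.
pose Q (k : nat) := `[< exists n (s : 'I_n -> V), (forall i, S (s i)) /\ \rank (dirs n s) = k >].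
have exQ : exists k, Q k.
  by exists (\rank (dirs 0%N (fun=> w))); apply/asboolP; exists 0%N, (fun=> w).
have Qub k : Q k -> (k <= p)%N.
  by move=> /asboolP[n [s [_ <-]]]; exact: rank_leq_col.
have [k /asboolP[n [s [Ss rk]]] kmax] := ex_maxnP exQ Qub.
exists n, s; split=> // u Su.
pose s' (i : 'I_(n + 1)) := match fintype.split i with inl j => s j | inr _ => u end.
have s'E : dirs _ s' = col_mx (dirs n s) (u - w)^T.
  apply/row_matrixP => i; rewrite rowK /s'; case: (fintype.splitP i) => [j ij|j ij].
    by rewrite (_ : i = lshift 1 j) ?rowKu ?rowK //; exact: val_inj.
  rewrite (_ : i = rshift n j) ?rowKd; last exact: val_inj.
  by apply/rowP => k'; rewrite !mxE !ord1.
have Qs' : Q (\rank (dirs _ s')).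
  apply/asboolP; exists (n + 1)%N, s'; split=> // i.
  by rewrite /s'; case: fintype.split.
have := kmax _ Qs'; rewrite s'E -rk -addsmxE => rk_le.
have [rge req] := mxrank_leqif_sup (addsmxSl (dirs n s) (u - w)^T).
have : (dirs n s + (u - w)^T <= dirs n s)%MS by rewrite -req eqn_leq rge rk_le.
exact: submx_trans (addsmxSr _ _).
Qed.

(* [w + tau * sum (s i - w)], for affinely spanning points [s i] of the set and
   small tau > 0, is a relative interior point. *)
Lemma subdiff_closure_ri f eta w :
  subdiff f eta w -> closure (rel_interior (subdiff f eta)) w.
Proof.
set S := subdiff f eta => Sw.
have [n [s [Ss sdir]]] := affine_directions Sw.
set B := \matrix_i (s i - w)^T in sdir.
pose q : V := \sum_i (s i - w).
move=> U /nbhs_enormP[e e0 eU].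
(* The first bound keeps the sum of [n] coefficients in [[0, 2 tau]] below 1; the second keeps
   [w + tau q] within [e] of [w]. *)
pose tau := Num.min ((2 * n.+1%:R)^-1) (e / 2 / (enorm q + 1)).
have q1 : 0 < enorm q + 1 by rewrite ltr_wpDl ?enorm_ge0.
have tau0 : 0 < tau by rewrite lt_min invr_gt0 mulr_gt0 //= divr_gt0 ?divr_gt0.
have [tau1 tau2] : tau <= (2 * n.+1%:R)^-1 /\ tau <= e / 2 / (enorm q + 1).
  by rewrite /tau !ge_min !lexx orbT.
have comb (c : 'I_n -> K) : (forall i, `|c i - tau| <= tau) ->
    S (w + \sum_i c i *: (s i - w)).
  move=> ctau; apply: subdiff_comb => // [i|].
    by have := ctau i; rewrite ler_norml => /andP[]; lra.
  apply: (@le_trans _ _ (\sum_(i < n) (2 * n.+1%:R)^-1 * 2)).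
    apply: ler_sum => i _; have := ctau i; rewrite ler_norml => /andP[_].
    by move: tau1; set X := (2 * _)^-1; lra.
  rewrite sumr_const card_ord -(mulr_natr _ n).
  have -> : (2 * n.+1%:R)^-1 * 2 * n%:R = n%:R / n.+1%:R :> K.
    by field; apply: lt0r_neq0; have := ler0n K n; lra.
  by rewrite ler_pdivrMr // mul1r ler_nat.
pose m := w + tau *: q.
have mE : m = w + \sum_i tau *: (s i - w) by rewrite /m scaler_sumr.
exists m; split; last first.
  apply: eU; rewrite /m addrC addKr enormZ gtr0_norm //.
  apply: (@le_lt_trans _ _ (e / 2)); last by rewrite gtr_pMr // invf_lt1 // ltr1n.
  move: tau2; rewrite ler_pdivlMr //; apply: le_trans.
  by rewrite ler_wpM2l ?(ltW tau0) // lerDl.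
split; first by rewrite mE; apply: comb => i; rewrite subrr normr0 ltW.
(* [N] bounds the linear forms giving the coordinates of [u - m] on the directions [s i - w], so for
   [u] close to [m] all coefficients stay within [tau] of [tau]. *)
pose N := \sum_j enorm (col j (pinvmx B)).
have N0 : 0 <= N by apply: sumr_ge0 => j _; exact: enorm_ge0.
apply/nbhs_enormP; exists (tau / (N + 1)).
  by rewrite divr_gt0 // ltr_wpDl.
move=> u um [l [t [a [St a1 uE]]]].
have span_aff : ((u - m)^T <= B)%MS.
  have spanB v : S v -> ((v - w)^T <= B)%MS by exact: sdir.
  have -> : u - m = (\sum_i a i *: (t i - w)) - \sum_i tau *: (s i - w).
    rewrite mE uE opprD addrA; congr (_ - _).
    rewrite -[in LHS](scale1r w) -a1 scaler_suml -sumrB.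
    by apply: eq_bigr => i _; rewrite scalerBr.
  rewrite linearB /= addmx_sub //.
    rewrite linear_sum summx_sub // => i _; rewrite linearZ /= scalemx_sub //.
    exact: spanB.
  rewrite -scaleN1r scalemx_sub // linear_sum summx_sub // => i _.
  by rewrite linearZ /= scalemx_sub // spanB.
pose c := (u - m)^T *m pinvmx B.
have cE : u = w + \sum_i (tau + c 0 i) *: (s i - w).
  have : (u - m)^T = c *m B by rewrite mulmxKpV.
  move/(congr1 trmx); rewrite trmxK => umE.
  rewrite -[u](subrK m) umE mE addrCA; congr (_ + _).
  rewrite addrC.
  have -> : (c *m B)^T = \sum_i c 0 i *: (s i - w).
    rewrite mulmx_sum_row linear_sum; apply: eq_bigr => i _.
    by rewrite linearZ /= rowK trmxK.
  by rewrite -big_split; apply: eq_bigr => i _; rewrite scalerDl.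
rewrite cE; apply: comb => i; rewrite addrC addKr.
have -> : c 0 i = dotp (u - m) (col i (pinvmx B)).
  by rewrite mxE; apply: eq_bigr => j _; rewrite !mxE.
apply: le_trans (dotp_CauchySchwarz _ _) _.
have : enorm (col i (pinvmx B)) <= N.
  by rewrite /N (bigD1 i) //= lerDl sumr_ge0 // => j _; exact: enorm_ge0.
move=> cN; apply: (@le_trans _ _ (tau / (N + 1) * (N + 1))).
  apply: ler_pM; rewrite ?enorm_ge0 //; first exact: ltW.
  by rewrite (le_trans cN) // lerDl.
by rewrite divfK // gt_eqF // ltr_wpDl.
Qed.

Lemma fconj_subdiff f w eta : eproper f -> subdiff f w eta ->
  subdiff (fconj f) eta w.
Proof.
move=> hf h eta'; have [r Rw] := subdiff_fin hf h.
have -> : fconj f eta = (dotp eta w - r)%:E.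
  apply/eqP; rewrite eq_le; apply/andP; split.
    apply: ge_ereal_sup => _ [v _ <-]; have := h v; rewrite Rw.
    move: (hf.1 v); case: (f v) => [rv _|_ _|//].
      by rewrite -EFinD -EFinB !lee_fin !dotpE; lra.
    by rewrite /= leNye.
  by apply: ereal_sup_ubound; exists w => //; rewrite Rw.
rewrite -EFinD; apply: ereal_sup_ubound; exists w => //.
by rewrite Rw -EFinB; congr (_%:E); rewrite !dotpE (dotpC w eta') (dotpC w eta); lra.
Qed.

Lemma mirror_near (R : V -> \bar K) (Ms Mds : set (set V)) w0 eta0 :
  eproper R -> mirror_stratifiable R Ms Mds -> subdiff R w0 eta0 ->
  exists2 delta : K, 0 < delta & forall z eta, subdiff R z eta ->
    enorm (z - w0) < delta -> enorm (eta - eta0) < delta ->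
    strat_le (stratum Ms w0) (stratum Ms z) /\
    strat_le (stratum Ms z) (corr_op (fconj R) (stratum Mds eta0)).
Proof.
move=> hR [strM strMd JM JMd Jdecr] h0.
have D0 : dom_subdiff R w0 by exists eta0.
have Dd0 : dom_subdiff (fconj R) eta0 by exists w0; exact: fconj_subdiff.
have /nbhs_enormP[d1 d10 h1] := stratum_le_near strM D0.
have /nbhs_enormP[d2 d20 h2] := stratum_le_near strMd Dd0.
exists (Num.min d1 d2); first by rewrite lt_min d10.
move=> z eta hz; rewrite !lt_min => /andP[z1 _] /andP[_ z2].
have Dz : dom_subdiff R z by exists eta.
have zdual := fconj_subdiff hR hz.
have Ddz : dom_subdiff (fconj R) eta by exists z.
split; first exact: h1.
have [Mdeta etaM] := stratumP strMd Ddz.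
have [Md0 _] := stratumP strMd Dd0.
have [Mz zM] := stratumP strM Dz.
have [Meta JMeta] := JMd _ Mdeta; have [Meta0 JMeta0] := JMd _ Md0.
have le1 : strat_le (stratum Ms z) (corr_op (fconj R) (stratum Mds eta)).
  have [_ _ frontier] := strM; apply: frontier => //; exists z; split=> //.
  apply: closure_subset (subdiff_closure_ri zdual) => v vri.
  by exists eta.
(* The converse half of order reversal for [corr_op R], applied to the images under
   [corr_op (fconj R)]. *)
have le2 : strat_le (corr_op (fconj R) (stratum Mds eta))
                    (corr_op (fconj R) (stratum Mds eta0)).
  by apply/(Jdecr _ _ Meta Meta0); rewrite JMeta JMeta0; exact: h2.
move=> v /le1 vcl.
have := closed_closure (A := corr_op (fconj R) (stratum Mds eta0)).
by rewrite closure_id /strat_le => ->; exact: closure_subset le2 _ vcl.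
Qed.

End stratification.

(** * Ville's inequality for independent sums *)

Section independence.
Variables (K : realType) (d : measure_display) (T : measurableType d).
Variable P : probability T K.

(** Independence on rectangles identifies the joint law with the product of the laws, to which
    Tonelli applies. *)
Lemma indep_integralM (Z W : T -> K) :
  measurable_fun setT Z -> measurable_fun setT W ->
  (forall t, 0 <= Z t) -> (forall t, 0 <= W t) ->
  (forall A B : set K, measurable A -> measurable B ->
    P (Z @^-1` A `&` W @^-1` B) = (P (Z @^-1` A) * P (W @^-1` B))%E) ->
  (\int[P]_t (Z t * W t)%:E = \int[P]_t (Z t)%:E * \int[P]_t (W t)%:E)%E.
Proof.
move=> mZ mW Z0 W0 indepZW.
pose X1 : {RV P >-> K} := mfun_Sub (mem_set mZ).
pose X2 : {RV P >-> K} := mfun_Sub (mem_set mW).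
have mZW : measurable_fun setT (fun t => (Z t, W t)).
  by apply/measurable_fun_pairP; split.
pose X : {RV P >-> (K * K)%type} := mfun_Sub (mem_set mZW).
have mnorm : measurable_fun setT (fun z : K => (`|z|%:E : \bar K)).
  by apply/measurable_EFinP; exact: normr_measurable.
(* Absolute values make the integrand nonnegative on all of [K * K]; they are harmless at the
   nonnegative values of [Z] and [W]. *)
pose f (z : K * K) := (`|z.1| * `|z.2|)%:E.
have mf : measurable_fun setT f.
  apply/measurable_EFinP; apply: measurable_funM.
    by apply: (measurableT_comp (@normr_measurable K setT)); exact: measurable_fst.
  by apply: (measurableT_comp (@normr_measurable K setT)); exact: measurable_snd.
have f0 z : (0 <= f z)%E by rewrite lee_fin mulr_ge0.
have -> : (\int[P]_t (Z t * W t)%:E = \int[P]_t (f \o X) t)%E.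
  by apply: eq_integral => t _; rewrite /f /= !ger0_norm.
rewrite -ge0_integral_distribution //.
have -> : (\int[distribution P X]_y f y =
    \int[distribution P X1 \x distribution P X2]_y f y)%E.
  apply: eq_measure_integral => A mA _; apply/esym.
  by apply: product_measure_unique => // B C mB mC; exact: indepZW.
rewrite fubini_tonelli1 //.
have -> : (\int[P]_t (Z t)%:E = \int[distribution P X1]_z (`|z|)%:E)%E.
  rewrite ge0_integral_distribution //.
  by apply: eq_integral => t _; rewrite /= ger0_norm.
have -> : (\int[P]_t (W t)%:E = \int[distribution P X2]_z (`|z|)%:E)%E.
  rewrite ge0_integral_distribution //.
  by apply: eq_integral => t _; rewrite /= ger0_norm.
rewrite -ge0_integralZr //; last exact: integral_ge0.
apply: eq_integral => z _; rewrite /fubini_F /f /=.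
by rewrite -ge0_integralZl_EFin.
Qed.

Lemma measurable_bool_set (b : T -> bool) :
  measurable_fun setT b -> measurable [set t | b t].
Proof. by move=> mb; rewrite -[X in measurable X]setTI; exact: (mb measurableT [set true]). Qed.

Lemma measurable_ge_set (X : T -> K) (a : K) :
  measurable_fun setT X -> measurable [set t | a <= X t].
Proof.
move=> mX; apply: measurable_bool_set.
exact: measurable_fun_ler (measurable_cst a) mX.
Qed.

Lemma markov_ge0 (X : T -> K) (a : K) : measurable_fun setT X ->
  (forall t, 0 <= X t) -> 0 < a ->
  (a%:E * P [set t | (a <= X t)%R] <= \int[P]_t (X t)%:E)%E.
Proof.
move=> mX X0 a0.
have mA : measurable [set t | (a <= X t)%R] by exact: measurable_ge_set.
rewrite -[in leLHS](setIT [set t | _]) -integral_indic // -ge0_integralZl_EFin //.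
- apply: ge0_le_integral => //.
  + by move=> t _; rewrite mule_ge0 // lee_fin // ltW.
  + apply: measurable_funeM; apply/measurable_EFinP; exact: measurable_indic.
  + exact/measurable_EFinP.
  + move=> t _; rewrite -EFinM lee_fin indicE.
    case: (boolP (t \in [set t | a <= X t])) => [tA|_]; last by rewrite mulr0.
    by rewrite mulr1; move: tA; rewrite inE.
- by apply/measurable_EFinP; exact: measurable_indic.
- exact: ltW.
Qed.

Lemma measurable_fun_sub_sigma d' (T' : measurableType d') (G : set (set T)) (f : T -> T') :
  G `<=` measurable -> measurable_fun setT (f : g_sigma_algebraType G -> T') ->
  measurable_fun setT f.
Proof.
move=> GM mf _ B mB; have := mf measurableT B mB; rewrite !setTI.
by apply: smallest_sub => //; exact: sigma_algebra_measurable.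
Qed.

Section ville.
Variables (G : nat -> set (set T)) (Y : nat -> T -> K).
Hypothesis GM : forall m, G m `<=` measurable.
Hypothesis Ypast : forall j m, (j < m)%N ->
  measurable_fun setT (Y j : g_sigma_algebraType (G m) -> K).
Hypothesis Yindep : forall m A B, <<s G m>> A -> measurable B ->
  P (A `&` Y m @^-1` B) = (P A * P (Y m @^-1` B))%E.
Variables (t x c : K).
Hypotheses (t0 : 0 <= t) (c1 : 1 <= c).
Hypothesis Yexp : forall m, (\int[P]_om (expR (t * Y m om))%:E <= c%:E)%E.

Let S m om := \sum_(j < m) Y j om.

Let stopped m om := has (fun j => x <= S j om) (iota 0 m.+1).

(** Written as a product, so that stopping amounts to a factor 1 and the decision at step [m]
    depends on the past of [m] only. *)
Fixpoint stopped_exp m om : K := if m is m'.+1 then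
    stopped_exp m' om * (if stopped m' om then 1 else expR (t * Y m' om) / c)
  else 1.

Let stoppedS m om : stopped m.+1 om = stopped m om || (x <= S m.+1 om).
Proof. by rewrite /stopped -(addn1 m.+1) iotaD has_cat /= orbF add0n. Qed.

Let measS j m : (j <= m)%N -> measurable_fun setT (S j : g_sigma_algebraType (G m) -> K).
Proof.
move=> jm; apply: measurable_sum => i; apply: Ypast.
exact: leq_trans (ltn_ord i) jm.
Qed.

Let meas_stopped j m : (j <= m)%N ->
  measurable_fun setT (stopped j : g_sigma_algebraType (G m) -> bool).
Proof.
elim: j => [|j ih] jm.
  rewrite (_ : stopped 0 = fun om => x <= S 0 om); last first.
    by apply/funext => om; rewrite /stopped /= orbF.
  exact: measurable_fun_ler (measurable_cst x) (measS jm).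
rewrite (_ : stopped j.+1 = fun om => stopped j om || (x <= S j.+1 om)); last first.
  by apply/funext => om; rewrite stoppedS.
apply: measurable_or; first exact: (ih (ltnW jm)).
exact: measurable_fun_ler (measurable_cst x) (measS jm).
Qed.

Let meas_exp j m : (j < m)%N ->
  measurable_fun setT (fun om : g_sigma_algebraType (G m) => expR (t * Y j om) / c).
Proof.
move=> jm; apply: measurable_funM; last exact: measurable_cst.
apply: measurableT_comp => //; apply: measurable_funM; first exact: measurable_cst.
exact: Ypast.
Qed.

Let meas_stopped_exp j m : (j <= m)%N ->
  measurable_fun setT (stopped_exp j : g_sigma_algebraType (G m) -> K).
Proof.
elim: j => [|j ih] jm /=; first exact: measurable_cst.
apply: measurable_funM; first exact: (ih (ltnW jm)).
apply: measurable_fun_ifT => //; last exact: meas_exp.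
exact: (meas_stopped (ltnW jm)).
Qed.

Let c0 : 0 < c. Proof. exact: lt_le_trans c1. Qed.

Let exp_ge0 m om : 0 <= stopped_exp m om.
Proof.
elim: m => [|m ih] //=; rewrite mulr_ge0 //.
by case: ifP => // _; rewrite divr_ge0 ?expR_ge0 // ltW.
Qed.

(** Frozen at a passage time [j <= m], the process is at least [expR (t * x) / c ^+ j], and [1 <= c]
    lets [j] be replaced by [m]. The induction also carries the exact value before stopping. *)
Let stopped_exp_ge m om : stopped m om ->
  expR (t * x) / c ^+ m <= stopped_exp m om.
Proof.
have cm k : 0 < c ^+ k by rewrite exprn_gt0.
suff [inv1 _] : (stopped m om -> expR (t * x) / c ^+ m <= stopped_exp m om) /\
    (~~ stopped m om -> stopped_exp m om = expR (t * S m om) / c ^+ m).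
  by [].
elim: m => [|m [ih1 ih2]].
  rewrite /stopped /= /S big_ord0 orbF mulr0 expR0 expr0 !divr1; split=> // x0.
  by rewrite -expR0 ler_expR mulr_ge0_le0.
rewrite stoppedS /=.
case: (boolP (stopped m om)) => [/ih1 sm|/ih2 sm] /=.
  split=> // _; rewrite mulr1; apply: le_trans sm.
  rewrite ler_wpM2l ?expR_ge0 // lef_pV2 ?posrE // exprS.
  by rewrite ler_peMl // ltW.
have SE : stopped_exp m om * (expR (t * Y m om) / c) = expR (t * S m.+1 om) / c ^+ m.+1.
  rewrite sm /S big_ord_recr /= mulrDr expRD exprSr invfM; ring.
rewrite SE; split=> // xS.
by rewrite ler_pM2r ?invr_gt0 // ler_expR ler_wpM2l.
Qed.

Let meas_T (f : T -> K) m : measurable_fun setT (f : g_sigma_algebraType (G m) -> K) ->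
  measurable_fun setT (f : T -> K).
Proof. exact: measurable_fun_sub_sigma. Qed.

Let supermartingale m : (\int[P]_om (stopped_exp m om)%:E <= 1)%E.
Proof.
elim: m => [|m ih] /=.
  by rewrite integral_cst // mul1e; exact: probability_le1.
apply: le_trans ih.
pose Z1 om : K := stopped_exp m om * (stopped m om)%:R.
pose Z2 om : K := stopped_exp m om * (~~ stopped m om)%:R.
have mb (b : T -> bool) : measurable_fun setT (b : g_sigma_algebraType (G m) -> bool) ->
    measurable_fun setT (fun om : g_sigma_algebraType (G m) => (b om)%:R : K).
  move=> mb; rewrite (_ : (fun _ => _) = fun om => if b om then 1 else 0 : K).
    exact: measurable_fun_ifT.
  by apply/funext => om; case: (b om).
have mZ1 : measurable_fun setT (Z1 : g_sigma_algebraType (G m) -> K).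
  apply: measurable_funM; first exact: (meas_stopped_exp (leqnn m)).
  exact: (mb _ (meas_stopped (leqnn m))).
have mZ2 : measurable_fun setT (Z2 : g_sigma_algebraType (G m) -> K).
  apply: measurable_funM; first exact: (meas_stopped_exp (leqnn m)).
  apply: (mb (fun om => ~~ stopped m om)); apply: measurable_neg.
  exact: (meas_stopped (leqnn m)).
have Z10 om : 0 <= Z1 om by rewrite mulr_ge0.
have Z20 om : 0 <= Z2 om by rewrite mulr_ge0.
pose W om : K := expR (t * Y m om) / c.
have W0 om : 0 <= W om by rewrite divr_ge0 ?expR_ge0 // ltW.
have mW : measurable_fun setT W by exact: (meas_T (meas_exp (ltnSn m))).
have mYm : measurable_fun setT (Y m) by exact: (meas_T (Ypast (ltnSn m))).
have -> : (\int[P]_om (stopped_exp m om *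
    (if stopped m om then 1 else expR (t * Y m om) / c))%:E =
    \int[P]_om ((Z1 om)%:E + (Z2 om * W om)%:E))%E.
  apply: eq_integral => om _; rewrite -EFinD /Z1 /Z2 /W.
  by case: (stopped m om); rewrite /= ?mulr1 ?mulr0 ?mul0r ?addr0 ?add0r.
have mZW : measurable_fun setT (fun om => (Z2 om * W om)%:E).
  by apply/measurable_EFinP; apply: measurable_funM; [exact: (meas_T mZ2)|].
rewrite ge0_integralD //; last 3 first.
- by move=> om _; rewrite lee_fin.
- by apply/measurable_EFinP; exact: (meas_T mZ1).
- by move=> om _; rewrite lee_fin mulr_ge0.
have mexp : measurable_fun setT (fun y : K => expR (t * y) / c).
  apply: measurable_funM; last exact: measurable_cst.
  by apply: measurableT_comp => //; apply: measurable_funM => //; exact: measurable_cst.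
have indepZW (A B : set K) : measurable A -> measurable B ->
    P (Z2 @^-1` A `&` W @^-1` B) = (P (Z2 @^-1` A) * P (W @^-1` B))%E.
  move=> mA mB; have -> : W @^-1` B = Y m @^-1` ((fun y => expR (t * y) / c) @^-1` B) by [].
  apply: Yindep; first by have := mZ2 measurableT A mA; rewrite setTI.
  by rewrite -[X in measurable X]setTI; exact: mexp.
rewrite (indep_integralM (meas_T mZ2) mW Z20 W0 indepZW).
have EW : (\int[P]_om (W om)%:E <= 1)%E.
  rewrite /W; under eq_integral do rewrite EFinM.
  have mE : measurable_fun setT (fun om => (expR (t * Y m om))%:E).
    apply/measurable_EFinP; apply: measurableT_comp => //.
    by apply: measurable_funM => //; exact: measurable_cst.
  have E0 om : setT om -> (0 <= (expR (t * Y m om))%:E)%E by rewrite lee_fin expR_ge0.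
  have ci0 : (0 <= c^-1%:E)%E by rewrite lee_fin invr_ge0 ltW.
  rewrite ge0_integralZr //.
  rewrite muleC -lee_pdivlMl ?invr_gt0 // invrK mule1.
  exact: Yexp.
have -> : (\int[P]_om (stopped_exp m om)%:E = \int[P]_om (Z1 om)%:E + \int[P]_om (Z2 om)%:E)%E.
  rewrite -ge0_integralD //.
  - apply: eq_integral => om _; rewrite -EFinD /Z1 /Z2.
    by case: (stopped m om); rewrite /= ?mulr1 ?mulr0 ?addr0 ?add0r.
  - by move=> om _; rewrite lee_fin.
  - by apply/measurable_EFinP; exact: (meas_T mZ1).
  - by move=> om _; rewrite lee_fin.
  - by apply/measurable_EFinP; exact: (meas_T mZ2).
apply: leeD2l; rewrite -[leRHS]mule1; apply: lee_wpmul2l => //.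
by apply: integral_ge0 => om _; rewrite lee_fin.
Qed.

(* Ville's inequality: [exp (t S m) / c ^ m], stopped when [S] reaches [x], is a
   supermartingale. *)
Lemma ville_inequality N :
  (P [set om | exists2 m, (m <= N)%N & (x <= \sum_(j < m) Y j om)%R] <=
   (c ^+ N * expR (- (t * x)))%:E)%E.
Proof.
have cN : 0 < c ^+ N by rewrite exprn_gt0.
set a := expR (t * x) / c ^+ N.
have a0 : 0 < a by rewrite divr_gt0 ?expR_gt0.
have mM : measurable_fun setT (stopped_exp N) by exact: (meas_T (meas_stopped_exp (leqnn N))).
have := markov_ge0 mM (exp_ge0 N) a0.
move=> /le_trans /(_ (supermartingale N)).
rewrite -lee_pdivlMl // mule1 {2}/a invf_div -expRN => h.
apply: le_trans h; apply: le_measure; rewrite ?inE.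
- rewrite (_ : [set _ | _] = [set om | stopped N om]).
    apply: measurable_bool_set.
    exact: (measurable_fun_sub_sigma (GM (m:=N)) (meas_stopped (leqnn N))).
  apply/seteqP; split=> om /=.
    move=> [m mN xS]; apply/hasP; exists m => //.
    by rewrite mem_iota add0n ltnS.
  by move/hasP => [m]; rewrite mem_iota add0n ltnS => mN xS; exists m.
- exact: measurable_ge_set.
- move=> om [m mN xS] /=; apply: stopped_exp_ge.
  by apply/hasP; exists m => //; rewrite mem_iota add0n ltnS.
Qed.

End ville.

End independence.

(** * Independence of a sample from the preceding ones *)

Section iid_past.
Variables (K : realType) (d d' : measure_display) (T : measurableType d)
  (U : measurableType d') (P : probability T K) (s : nat -> T -> U).
Hypothesis ms : forall i, measurable_fun setT (s i).
Hypothesis indep_s : mutual_indep P (fun i => preimage_set_system setT (s i) measurable).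

(** Cylinders rather than a sigma-algebra: they form a pi-system that generates the sigma-algebra of
    the first [m] samples. *)
Definition past (m : nat) : set (set T) :=
  [set A | exists2 B : nat -> set U, (forall k, measurable (B k)) &
    A = \bigcap_(k in `I_m) s k @^-1` B k].

Let meas_preimage k (B : set U) : measurable B -> measurable (s k @^-1` B).
Proof. by move=> mB; rewrite -[X in measurable X]setTI; exact: ms. Qed.

Lemma past_sub_measurable m : past m `<=` measurable.
Proof.
move=> _ [B mB ->]; apply: fin_bigcap_measurable => [|k _]; first exact: finite_II.
exact: meas_preimage.
Qed.

Lemma past_measurable j m : (j < m)%N ->
  measurable_fun setT (s j : g_sigma_algebraType (past m) -> U).
Proof.
move=> jm _ B mB; rewrite setTI; apply: sub_sigma_algebra.
exists (fun k => if k == j then B else setT); first by move=> k; case: ifP.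
apply/seteqP; split=> [om sB k _|om /(_ j jm)]; last by rewrite eqxx.
by case: eqP => // ->.
Qed.

Lemma past_indep m A (B : set U) : <<s past m>> A -> measurable B ->
  P (A `&` s m @^-1` B) = (P A * P (s m @^-1` B))%E.
Proof.
move=> pA mB; pose E := s m @^-1` B; have mE : measurable E by exact: meas_preimage.
have PE : (fine (P E))%:E = P E by rewrite fineK // fin_num_measure.
have PE0 : (0 <= fine (P E))%R by rewrite fine_ge0.
pose r := NngNum PE0.
have := @g_sigma_algebra_measure_unique _ K T (past m) (@past_sub_measurable m)
  (fun=> setT) _ _ (mrestr P mE) (mscale r P).
move=> /(_ _ _ _ _ _ A pA); rewrite /= /mrestr /mscale /= PE muleC; apply.
- by move=> _; exists (fun=> setT) => //; apply/seteqP; split.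
- by rewrite bigcup_const //; exists 0%N.
- move=> _ _ [B1 mB1 ->] [B2 mB2 ->]; exists (fun k => B1 k `&` B2 k).
    by move=> k; exact: measurableI.
  by rewrite -bigcapI.
- move=> _ [B1 mB1 ->].
  pose D k := s k @^-1` (if k == m then B else B1 k).
  have Dsys k : preimage_set_system setT (s k) measurable (D k).
    exists (if k == m then B else B1 k); first by case: ifP.
    by rewrite setTI.
  have fm : finite_set `I_m by exact: finite_II.
  have capJ : \bigcap_(k in `I_m) D k = \bigcap_(k in `I_m) s k @^-1` B1 k.
    by apply: eq_bigcapr => k km; rewrite /D (ltn_eqF km).
  have := indep_s (J := fset_set `I_m) (fun k _ => Dsys k).
  have := indep_s (J := fset_set (m |` `I_m)) (fun k _ => Dsys k).
  rewrite !fset_setK //; last by rewrite finite_setU; split.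
  rewrite fset_setU1 // finmap.big_fsetU1 /=; last first.
    by rewrite in_fset_set // notin_setE /= ltnn.
  move=> eU eJ; move: eU; rewrite -eJ bigcap_setU1 capJ /D eqxx setIC => ->.
  by [].
- by move=> _; rewrite -ge0_fin_numE ?measure_ge0 ?fin_num_measure //; exact: measurableI.
Qed.

End iid_past.

(** * Truncated sums over a block *)

Section block.
Variables (K : realType) (d d' : measure_display) (T : measurableType d)
  (U : measurableType d') (P : probability T K) (rho : probability U K)
  (s : nat -> T -> U).
Hypothesis ms : forall i, measurable_fun setT (s i).
Hypothesis ls : forall i A, measurable A -> pushforward P (s i) A = rho A.
Hypothesis indep_s : mutual_indep P (fun i => preimage_set_system setT (s i) measurable).

Lemma ge0_integral_sample i (f : U -> K) : measurable_fun setT f ->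
  (forall u, 0 <= f u) ->
  (\int[P]_om (f (s i om))%:E = \int[rho]_u (f u)%:E)%E.
Proof.
move=> mf f0; pose X : {RV P >-> U} := mfun_Sub (mem_set (ms i)).
transitivity (\int[distribution P X]_u (f u)%:E)%E.
  rewrite ge0_integral_distribution //; exact/measurable_EFinP.
by apply: eq_measure_integral => A mA _; exact: ls.
Qed.

(** [expR u <= (1 - u)^-1], and [(1 + u + 2 u^2) (1 - u) = 1 + u^2 (1 - 2 u)]. *)
Lemma expR_le_quad (u : K) : u <= 2^-1 -> expR u <= 1 + u + 2 * u ^+ 2.
Proof.
move=> u2; have u1 : 0 < 1 - u by lra.
rewrite -[u in expR u]opprK expRN.
apply: (@le_trans _ _ (1 - u)^-1).
  by rewrite lef_pV2 ?posrE ?expR_gt0 // expR_ge1Dx.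
rewrite -(ler_pM2r u1) mulVf ?gt_eqF //.
have : 0 <= u ^+ 2 * (1 - 2 * u) by rewrite mulr_ge0 ?sqr_ge0 //; lra.
lra.
Qed.

Variables (phi : U -> K) (v : K).
Hypothesis mphi : measurable_fun setT phi.
Hypothesis iphi : rho.-integrable setT (EFin \o phi).
Hypothesis phi0 : (\int[rho]_u (phi u)%:E = 0)%E.
Hypothesis phi2 : (\int[rho]_u (phi u ^+ 2)%:E <= v%:E)%E.

Let v0 : 0 <= v.
Proof.
rewrite -lee_fin; apply: le_trans phi2.
by apply: integral_ge0 => u _; rewrite lee_fin sqr_ge0.
Qed.

Definition trunc (tau : K) u : K := if `|phi u| <= tau then phi u else 0.

Lemma measurable_trunc tau : measurable_fun setT (trunc tau).
Proof.
apply: measurable_fun_ifT => //; apply: measurable_fun_ler => //.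
exact: measurableT_comp.
Qed.

(* The truncated variable need not be centered: its mean is at most
   [E phi^2 / tau], of the same order as the second-order term. *)
Lemma exp_moment_trunc tau : 0 < tau ->
  (\int[rho]_u (expR ((2 * tau)^-1 * trunc tau u))%:E <=
   (expR (v / tau ^+ 2))%:E)%E.
Proof.
move=> tau0; pose t := (2 * tau)^-1; have t0 : 0 < t by rewrite invr_gt0 mulr_gt0.
have tau_t : t * tau = 2^-1 by rewrite /t invfM -mulrA mulVf ?mulr1 ?gt_eqF.
(* The bound involves [phi] itself, whose linear term integrates to 0. Where [phi] is truncated the
   left side is 1, and the quadratic term outweighs a negative [t * phi u] because
   [t * |phi u| > 1/2]. *)
have pointwise u : expR (t * trunc tau u) <= 1 + (t * phi u + 4 * t ^+ 2 * phi u ^+ 2).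
  rewrite /trunc; case: ifPn => [le_tau|].
    have tphi : t * phi u <= 2^-1.
      by rewrite -tau_t ler_pM2l // (le_trans (ler_norm _)).
    apply: le_trans (expR_le_quad tphi) _; rewrite exprMn.
    have : 0 <= t ^+ 2 * phi u ^+ 2 by rewrite mulr_ge0 ?sqr_ge0.
    lra.
  rewrite -ltNge mulr0 expR0 => gt_tau; rewrite lerDl.
  have -> : t * phi u + 4 * t ^+ 2 * phi u ^+ 2 = t * (phi u + 4 * t * phi u ^+ 2) by ring.
  rewrite mulr_ge0 ?ltW //.
  have : `|phi u| <= 2 * t * `|phi u| ^+ 2.
    rewrite expr2 mulrA ler_peMl //.
    have : t * tau < t * `|phi u| by rewrite ltr_pM2l.
    rewrite tau_t; lra.
  rewrite real_normK ?num_real // => h.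
  have := ler_norm (- phi u); rewrite normrN.
  have : 0 <= 2 * t * phi u ^+ 2.
    by apply: mulr_ge0; [rewrite mulr_ge0 // ltW|exact: sqr_ge0].
  lra.
have i2 : rho.-integrable setT (fun u => (phi u ^+ 2)%:E).
  apply/integrableP; split; first by apply/measurable_EFinP; exact: measurable_funX.
  apply: (@le_lt_trans _ _ v%:E); last exact: ltry.
  apply: le_trans phi2; rewrite le_eqVlt; apply/orP; left; apply/eqP.
  by apply: eq_integral => u _; rewrite gee0_abs // lee_fin sqr_ge0.
have i1 : rho.-integrable setT (fun u => (t%:E * (phi u)%:E)%E) by exact: integrableZl.
have i3 : rho.-integrable setT (fun u => ((4 * t ^+ 2)%:E * (phi u ^+ 2)%:E)%E).
  exact: integrableZl.
have i0 : rho.-integrable setT (fun=> 1%:E : \bar K).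
  exact: finite_measure_integrable_cst.
have me : measurable_fun setT (fun u => (expR (t * trunc tau u))%:E).
  apply/measurable_EFinP; apply: measurableT_comp => //.
  by apply: measurable_funM => //; exact: measurable_trunc.
have e0 u : (0 <= (expR (t * trunc tau u))%:E)%E by rewrite lee_fin expR_ge0.
apply: (@le_trans _ _ (\int[rho]_u (1%:E +
    (t%:E * (phi u)%:E + (4 * t ^+ 2)%:E * (phi u ^+ 2)%:E)))%E).
  apply: ge0_le_integral => //.
  - apply: emeasurable_funD => //; apply: emeasurable_funD.
      exact: (measurable_int _ i1).
    exact: (measurable_int _ i3).
  - by move=> u _; rewrite -!EFinM -!EFinD lee_fin.
rewrite integralD //; last exact: integrableD.
rewrite integralD // !integralZl // phi0 mule0 add0e.
rewrite integral_cst // mul1e.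
apply: (@le_trans _ _ (1%:E + (4 * t ^+ 2)%:E * v%:E)%E).
  apply: leeD; first exact: probability_le1.
  by rewrite lee_wpmul2l // lee_fin mulr_ge0 ?sqr_ge0.
rewrite -EFinM -EFinD lee_fin.
have -> : 4 * t ^+ 2 * v = v / tau ^+ 2 by rewrite /t; field; rewrite gt_eqF.
exact: expR_ge1Dx.
Qed.

Definition tail (tau : K) u : K := if tau < `|phi u| then `|phi u| else 0.

Lemma measurable_tail tau : measurable_fun setT (tail tau).
Proof.
have mn : measurable_fun setT (fun u => `|phi u|) by exact: measurableT_comp.
by apply: measurable_fun_ifT => //; exact: measurable_fun_ltr.
Qed.

Lemma tail_ge0 tau u : 0 <= tail tau u. Proof. by rewrite /tail; case: ifP. Qed.

Variables (b N : nat) (tau ell : K).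
Hypotheses (tau0 : 0 < tau) (ell0 : 0 < ell) (tauN : tau ^+ 2 * ell = N%:R).

(** With [N = tau^2 ell] and the parameter [(2 tau)^-1], this threshold makes the exponent of
    Ville's bound [v ell - (v + 2) ell = - 2 ell]. *)
Definition bad_trunc := [set om | exists2 m, (m <= N)%N &
  (2 * v + 4) * (tau * ell) <= \sum_(j < m) trunc tau (s (b + j)%N om)].

Definition bad_tail := [set om |
  tau * ell <= \sum_(j < N) tail tau (s (b + j)%N om)].

Lemma measurable_bad_trunc : measurable bad_trunc.
Proof.
have -> : bad_trunc = \bigcup_(m in `I_N.+1)
    [set om | (2 * v + 4) * (tau * ell) <= \sum_(j < m) trunc tau (s (b + j)%N om)].
  by apply/seteqP; split=> om [m mN h]; exists m.
apply: fin_bigcup_measurable => [|m _]; first exact: finite_II.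
apply: measurable_ge_set; apply: measurable_sum => j.
by apply: measurableT_comp => //; exact: measurable_trunc.
Qed.

Let msum_tail : measurable_fun setT (fun om => \sum_(j < N) tail tau (s (b + j)%N om)).
Proof.
apply: measurable_sum => j.
by apply: measurableT_comp => //; exact: measurable_tail.
Qed.

Lemma measurable_bad_tail : measurable bad_tail.
Proof. exact: measurable_ge_set. Qed.

Lemma bad_trunc_le : (P bad_trunc <= (expR (- (2 * ell)))%:E)%E.
Proof.
set x := (2 * v + 4) * (tau * ell).
pose c := expR (v / tau ^+ 2).
have c1 : 1 <= c by rewrite -expR0 ler_expR divr_ge0 ?sqr_ge0.
have t0 : 0 <= (2 * tau)^-1 by rewrite invr_ge0 mulr_ge0 // ltW.
have Yexp m : (\int[P]_om (expR ((2 * tau)^-1 * trunc tau (s (b + m)%N om)))%:E <= c%:E)%E.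
  rewrite (ge0_integral_sample (b + m) (f := fun u => expR ((2 * tau)^-1 * trunc tau u))).
  - exact: exp_moment_trunc.
  - apply: measurableT_comp => //.
    by apply: measurable_funM => //; exact: measurable_trunc.
  - by move=> u; exact: expR_ge0.
have mtr (B : set K) : measurable B -> measurable (trunc tau @^-1` B).
  by move=> mB; rewrite -[X in measurable X]setTI; exact: measurable_trunc.
pose F m := past s (b + m).
pose Y j om := trunc tau (s (b + j)%N om).
have FM m : F m `<=` measurable by exact: past_sub_measurable.
have Ypast j m : (j < m)%N ->
    measurable_fun setT (Y j : g_sigma_algebraType (F m) -> K).
  move=> jm; apply: (measurableT_comp (measurable_trunc tau)).
  by apply: past_measurable; rewrite ltn_add2l.
have Yindep m A B : <<s F m>> A -> measurable B ->
    P (A `&` Y m @^-1` B) = (P A * P (Y m @^-1` B))%E.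
  by move=> pA mB; exact: (past_indep ms indep_s pA (mtr _ mB)).
have h : (P bad_trunc <= (c ^+ N * expR (- ((2 * tau)^-1 * x)))%:E)%E.
  exact: (ville_inequality FM Ypast Yindep x t0 c1 Yexp N).
apply: le_trans h _.
rewrite lee_fin -expRM_natr -expRD ler_expR -tauN /x.
rewrite le_eqVlt; apply/orP; left; apply/eqP; field.
by rewrite gt_eqF.
Qed.

(** Markov's inequality on the sum of [N] equal means, with [N / (tau * ell) = tau]. *)
Lemma bad_tail_le : (P bad_tail <= tau%:E * \int[rho]_u (tail tau u)%:E)%E.
Proof.
have te : 0 < tau * ell by rewrite mulr_gt0.
have sum0 om : 0 <= \sum_(j < N) tail tau (s (b + j)%N om).
  by apply: sumr_ge0 => j _; exact: tail_ge0.
have := markov_ge0 P msum_tail sum0 te.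
under [X in (_ <= X)%E -> _]eq_integral do rewrite -sumEFin.
rewrite ge0_integral_sum //; last 2 first.
- move=> j; apply/measurable_EFinP.
  by apply: measurableT_comp => //; exact: measurable_tail.
- by move=> j om _; rewrite lee_fin tail_ge0.
rewrite (eq_bigr (fun=> \int[rho]_u (tail tau u)%:E)%E); last first.
  move=> j _; exact: (ge0_integral_sample (b + j) (measurable_tail tau) (tail_ge0 tau)).
set I := (\int[rho]_u (tail tau u)%:E)%E.
have I0 : (0 <= I)%E by apply: integral_ge0 => u _; rewrite lee_fin tail_ge0.
have -> : (\sum_(j < N) I = N%:R%:E * I)%E.
  elim: (N) => [|n ih]; first by rewrite big_ord0 mul0e.
  by rewrite big_ord_recr /= ih -natr1 EFinD ge0_muleDl ?mul1e ?lee_fin.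
rewrite -lee_pdivlMl // muleA -EFinM.
have -> : (tau * ell)^-1 * N%:R = tau by rewrite -tauN; field; rewrite !gt_eqF.
by [].
Qed.

Lemma block_good om : ~ (bad_trunc `|` bad_tail) om -> forall m, (m <= N)%N ->
  \sum_(j < m) phi (s (b + j)%N om) <= (2 * v + 5) * (tau * ell).
Proof.
move=> good m mN; apply: ltW.
have h1 : \sum_(j < m) trunc tau (s (b + j)%N om) < (2 * v + 4) * (tau * ell).
  by rewrite ltNge; apply/negP => h; apply: good; left; exists m.
have h2 : \sum_(j < N) tail tau (s (b + j)%N om) < tau * ell.
  by rewrite ltNge; apply/negP => h; apply: good; right.
have h3 : \sum_(j < m) phi (s (b + j)%N om) <=
    \sum_(j < m) trunc tau (s (b + j)%N om) + \sum_(j < m) tail tau (s (b + j)%N om).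
  rewrite -big_split; apply: ler_sum => j _ /=; rewrite /trunc /tail.
  by case: leP => _; rewrite ?addr0 ?add0r // ler_norm.
have h4 : \sum_(j < m) tail tau (s (b + j)%N om) <= \sum_(j < N) tail tau (s (b + j)%N om).
  rewrite -!(big_mkord xpredT (fun j => tail tau (s (b + j)%N om))).
  by rewrite [leRHS](big_cat_nat (n := m)) //= lerDl sumr_ge0 // => j _; exact: tail_ge0.
lra.
Qed.

End block.

(** * Upper bound of the iterated logarithm *)

Section lil.
Variables (K : realType).

(** Stands for the iterated logarithm of [2 ^ k]. The offset 2 keeps it away from 0 and limits its
    relative growth to a factor 3/2 per step, as [tauS] requires. *)
Definition ell (k : nat) : K := 2 + ln k.+1%:R.
(* The truncation level for which the two terms [2 ^ k / tau k] and
   [tau k * ell k] of the deviation bound on the k-th dyadic block balance. *)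
Definition tau (k : nat) : K := Num.sqrt (2 ^+ k / ell k).

Lemma ell_ge2 k : 2 <= ell k.
Proof. by rewrite lerDl ln_ge0 // ler1n. Qed.

Lemma ell_gt0 k : 0 < ell k.
Proof. by apply: lt_le_trans (ell_ge2 k). Qed.

Lemma ellS k : ell k <= ell k.+1 <= ell k + 1.
Proof.
have k1 : 0 < k.+1%:R :> K by [].
have le1 : ln (k.+1%:R : K) <= ln k.+2%:R by rewrite ler_ln ?posrE // ler_nat.
have le2 : ln (k.+2%:R : K) <= ln k.+1%:R + 1.
  have -> : k.+2%:R = k.+1%:R * (1 + k.+1%:R^-1) :> K.
    by rewrite mulrDr mulr1 mulfV // natr1.
  have h : 0 < k.+1%:R^-1 :> K by rewrite invr_gt0.
  rewrite lnM ?posrE ?addr_gt0 // lerD2l.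
  apply: le_trans (le_ln1Dx _) _; first exact: lt_trans (ltrN10 _) h.
  by rewrite invf_le1 // ler1n.
move: le1 le2; rewrite /ell; move: (ln k.+1%:R) (ln k.+2%:R) => A B AB BA.
by apply/andP; split; lra.
Qed.

Lemma tau_gt0 k : 0 < tau k.
Proof. by rewrite sqrtr_gt0 divr_gt0 ?exprn_gt0 ?ell_gt0. Qed.

Lemma tau_sqr k : tau k ^+ 2 * ell k = (2 ^ k)%:R.
Proof.
rewrite sqr_sqrtr; last by rewrite divr_ge0 ?exprn_ge0 // ltW ?ell_gt0.
by rewrite divfK ?natrX // gt_eqF ?ell_gt0.
Qed.

(** [ell k.+1 <= ell k + 1 <= 3/2 * ell k], and [(8/7)^2 * 3/2 < 2]. *)
Lemma tauS k : 8 / 7 * tau k <= tau k.+1.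
Proof.
rewrite -(@ler_pXn2r _ 2) ?nnegrE ?mulr_ge0 ?(ltW (tau_gt0 _)) //.
rewrite exprMn -(ler_pM2r (ell_gt0 k.+1)) tau_sqr expnS natrM -tau_sqr.
have h : (8 / 7) ^+ 2 * ell k.+1 <= 2 * ell k.
  by have /andP[_ h] := ellS k; have := ell_ge2 k; lra.
by have := ler_wpM2l (sqr_ge0 (tau k)) h; lra.
Qed.

(** Growth by the ratio 8/7 bounds the sum of the earlier levels by [7 * tau n]; adding a last level
    [tau n < x] gives at most [8 * x]. The induction needs both bounds. *)
Lemma tau_tail_sum (x : K) n : 0 <= x ->
  \sum_(k < n) (if tau k < x then tau k else 0) <= 8 * x.
Proof.
move=> x0.
have [] : \sum_(k < n) (if tau k < x then tau k else 0) <= 7 * tau n /\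
    \sum_(k < n) (if tau k < x then tau k else 0) <= 8 * x; last by [].
elim: n => [|n [ih1 ih2]].
  by rewrite big_ord0; split; rewrite mulr_ge0 // ltW // tau_gt0.
have := tauS n; rewrite big_ord_recr /=; case: ifP => h t; split; lra.
Qed.

Lemma sum_inv_sqr n : \sum_(k < n.+1) (k.+1%:R ^+ 2)^-1 <= 2 - n.+1%:R^-1 :> K.
Proof.
elim: n => [|n ih]; first by rewrite big_ord1 expr1n invr1; lra.
rewrite big_ord_recr /=; apply: le_trans (lerD ih (lexx _)) _.
set a : K := n.+1%:R; have a0 : 0 < a by rewrite ltr0n.
have -> : n.+2%:R = a + 1 by rewrite natr1.
have -> : 2 - a^-1 + ((a + 1) ^+ 2)^-1 = 2 - (a + 1)^-1 - (a * (a + 1) ^+ 2)^-1.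
  by field; rewrite !gt_eqF // addr_gt0.
by rewrite gerBl invr_ge0 mulr_ge0 ?sqr_ge0 // ltW.
Qed.

Lemma exp_ell k : expR (- (2 * ell k)) <= (k.+1%:R ^+ 2)^-1 :> K.
Proof.
rewrite expRN lef_pV2 ?posrE ?expR_gt0 ?exprn_gt0 //.
rewrite -[k.+1%:R in leLHS]lnK ?posrE // -expRM_natl ler_expR.
by rewrite /ell; have := ln_ge0 (_ : 1 <= k.+1%:R :> K); lra.
Qed.

Variables (d d' : measure_display) (T : measurableType d)
  (U : measurableType d') (P : probability T K) (rho : probability U K)
  (s : nat -> T -> U).
Hypothesis ms : forall i, measurable_fun setT (s i).
Hypothesis ls : forall i A, measurable A -> pushforward P (s i) A = rho A.
Hypothesis indep_s : mutual_indep P (fun i => preimage_set_system setT (s i) measurable).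

(** A second moment suffices because the remainder probabilities are summed over [k] under the
    integral, where [tau_tail_sum] bounds them by [8 * phi ^+ 2]. *)
Lemma blocks_ae (phi : U -> K) (v : K) :
  measurable_fun setT phi -> rho.-integrable setT (EFin \o phi) ->
  (\int[rho]_u (phi u)%:E = 0)%E -> (\int[rho]_u (phi u ^+ 2)%:E <= v%:E)%E ->
  {ae P, forall om, \forall k \near \oo, forall m, (m <= 2 ^ k)%N ->
    \sum_(j < m) phi (s (2 ^ k + j)%N om) <= (2 * v + 5) * (tau k * ell k)}.
Proof.
move=> mphi iphi phi0 phi2.
pose bad k := bad_trunc s phi v (2 ^ k) (2 ^ k) (tau k) (ell k) `|`
  bad_tail s phi (2 ^ k) (2 ^ k) (tau k) (ell k).
have mbad k : measurable (bad k).
  by apply: measurableU; [exact: measurable_bad_trunc|exact: measurable_bad_tail].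
have mt k : measurable_fun setT (fun u => (tau k * tail phi (tau k) u)%:E).
  apply/measurable_EFinP; apply: measurable_funM => //; exact: measurable_tail.
have t0 k u : 0 <= tau k * tail phi (tau k) u.
  by rewrite mulr_ge0 ?tail_ge0 // ltW ?tau_gt0.
have Pbad k : (P (bad k) <= ((k.+1%:R ^+ 2)^-1)%:E +
    \int[rho]_u (tau k * tail phi (tau k) u)%:E)%E.
  apply: le_trans (measureU2 _ _ _) _.
  - exact: measurable_bad_trunc.
  - exact: measurable_bad_tail.
  apply: leeD.
    apply: (@le_trans _ _ (expR (- (2 * ell k)))%:E); last by rewrite lee_fin exp_ell.
    by apply: (bad_trunc_le ms ls indep_s) => //; [exact: tau_gt0|exact: tau_sqr].
  under eq_integral do rewrite EFinM.
  rewrite ge0_integralZl_EFin //; last 3 first.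
  - by move=> u _; rewrite lee_fin tail_ge0.
  - by apply/measurable_EFinP; exact: measurable_tail.
  - by rewrite ltW ?tau_gt0.
  by apply: (bad_tail_le ms ls) => //; [exact: tau_gt0|exact: ell_gt0|exact: tau_sqr].
have sum_bad n : (\sum_(0 <= k < n) P (bad k) <= (2 + 8 * v)%:E)%E.
  rewrite big_mkord; apply: (@le_trans _ _ (\sum_(k < n) (((k.+1%:R ^+ 2)^-1)%:E +
      \int[rho]_u (tau k * tail phi (tau k) u)%:E))%E).
    by apply: lee_sum => k _; exact: Pbad.
  rewrite big_split /= EFinD; apply: leeD.
    rewrite sumEFin lee_fin; case: n => [|n]; first by rewrite big_ord0.
    by apply: le_trans (sum_inv_sqr n) _; rewrite gerBl invr_ge0.
  have tail0 (k : 'I_n) u : setT u -> (0 <= (tau k * tail phi (tau k) u)%:E)%E.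
    by rewrite lee_fin.
  rewrite -(ge0_integral_sum rho measurableT
    (f := fun (k : 'I_n) u => (tau k * tail phi (tau k) u)%:E)) //.
  have m2 : measurable_fun setT (fun u => (phi u ^+ 2)%:E).
    by apply/measurable_EFinP; exact: measurable_funX.
  have p2 u : setT u -> (0 <= (phi u ^+ 2)%:E)%E by rewrite lee_fin sqr_ge0.
  have e8 : (0 <= 8 :> K) by [].
  apply: (@le_trans _ _ (\int[rho]_u (8%:E * (phi u ^+ 2)%:E))%E); last first.
    by rewrite ge0_integralZl_EFin // EFinM; apply: lee_wpmul2l; rewrite ?lee_fin.
  apply: ge0_le_integral => //.
  - by move=> u _; rewrite sumEFin lee_fin sumr_ge0.
  - exact: emeasurable_sum.
  - exact: measurable_funeM.
  - move=> u _; rewrite sumEFin -EFinM lee_fin.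
    have -> : \sum_(k < n) tau k * tail phi (tau k) u =
        `|phi u| * \sum_(k < n) (if tau k < `|phi u| then tau k else 0).
      rewrite big_distrr; apply: eq_bigr => k _ /=; rewrite /tail mulrC.
      by case: ifP => _; rewrite ?mulr0 ?mul0r.
    rewrite -(real_normK (num_real (phi u))) expr2 mulrCA ler_wpM2l //.
    exact: tau_tail_sum.
have bc : P (lim_sup_set bad) = 0%E.
  apply: lim_sup_set_cvg0 => //; apply: (@le_lt_trans _ _ (2 + 8 * v)%:E); last exact: ltry.
  apply: lime_le; first exact: is_cvg_nneseries.
  by apply: nearW => j; exact: sum_bad.
exists (lim_sup_set bad); split=> //.
  apply: bigcap_measurable => // k _.
  by apply: bigcup_measurable => j /= _; exact: mbad.
move=> om; apply: contra_notP => nbad /=.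
have [k0 hk0] : exists k0, forall k, (k0 <= k)%N -> ~ bad k om.
  apply: contra_notP nbad => /forallNP h n _.
  have /existsNP[k /not_implyP[nk /contrapT bk]] := h n.
  by exists k.
near=> k => m mk.
have kk0 : (k0 <= k)%N by near: k; exists k0.
exact: block_good (hk0 k kk0) m mk.
Unshelve. all: by end_near.
Qed.

End lil.

(** * From dyadic blocks to a rate along all n *)

Section lil_rate.
Variable K : realType.
Local Notation ell := (@ell K).
Local Notation tau := (@tau K).
(** This is [sqrt (2 ^ k * ell k)], the iterated logarithm scale at time [2 ^ k]. *)
Let r k := tau k * ell k.

Let r_gt0 k : 0 < r k. Proof. by rewrite mulr_gt0 ?tau_gt0 ?ell_gt0. Qed.

Let r_sqr k : r k ^+ 2 = (2 ^ k)%:R * ell k.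
Proof. by rewrite exprMn [ell k ^+ 2]expr2 mulrA tau_sqr. Qed.

Let r_ge1 k : 1 <= r k.
Proof.
rewrite -(@ler_pXn2r _ 2) ?nnegrE ?(ltW (r_gt0 k)) // r_sqr expr1n.
have h : 1 <= (2 ^ k)%:R :> K by rewrite ler1n expn_gt0.
have := ell_ge2 K k; nra.
Qed.

Let rS k : 4 / 3 * r k <= r k.+1.
Proof.
have r0 : 0 <= 4 / 3 * r k by apply: mulr_ge0 => //; exact: ltW.
rewrite -(@ler_pXn2r _ 2) ?nnegrE ?(ltW (r_gt0 _)) //.
rewrite exprMn !r_sqr expnS natrM.
have /andP[h _] := ellS K k; have e0 := ell_gt0 K k.
have p0 : 0 < (2 ^ k)%:R :> K by rewrite ltr0n expn_gt0.
have := ler_wpM2l (ltW p0) h; have := mulr_gt0 p0 e0; lra.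
Qed.

(** As [r] grows by a factor at least 4/3, the blocks up to [2 ^ k] add up to at most [3 a r k]: one
    more block gives [4 a r k <= 3 a r k.+1]. The constant from the initial segment is absorbed by
    [1 <= r k]. *)
Lemma block_sum (X : nat -> K) (a : K) : 0 <= a ->
  (\forall k \near \oo, forall m, (m <= 2 ^ k)%N ->
    `|\sum_(j < m) X (2 ^ k + j)%N| <= a * (tau k * ell k)) ->
  exists2 C : K, 0 <= C & \forall k \near \oo, forall m, (m <= 2 ^ k)%N ->
    `|\sum_(i < 2 ^ k + m) X i| <= C * (tau k * ell k).
Proof.
move=> a0 [k0 _ hk0].
pose S n := \sum_(i < n) X i.
have SD n m : S (n + m)%N = S n + \sum_(j < m) X (n + j)%N by rewrite /S big_split_ord.
pose D := `|S (2 ^ k0)%N|.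
have pow k : `|S (2 ^ (k0 + k))%N| <= D + 3 * a * r (k0 + k).
  elim: k => [|k ih].
    by rewrite addn0 -/D; have := mulr_ge0 a0 (ltW (r_gt0 k0)); lra.
  rewrite addnS expnS mul2n -addnn SD; apply: le_trans (ler_normD _ _) _.
  have := hk0 (k0 + k)%N (leq_addr _ _) _ (leqnn _); rewrite -/(r _) => h.
  have := rS (k0 + k); rewrite -/(r _) => rr.
  have := ler_wpM2l a0 rr; lra.
exists (D + 4 * a); first by have := normr_ge0 (S (2 ^ k0)%N); rewrite -/D; lra.
exists k0 => // k /= kk0 m mk; rewrite -/(S _) SD.
apply: le_trans (ler_normD _ _) _.
have := pow (k - k0)%N; rewrite subnKC // => h1.
have h2 := hk0 k kk0 m mk; rewrite -/(r _) in h2 *.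
have : D <= D * r k by apply: ler_peMr; [exact: normr_ge0|exact: r_ge1].
lra.
Qed.

Lemma ln2_ge : 2^-1 <= ln 2 :> K.
Proof.
rewrite -ler_expR lnK ?posrE //.
have := @expR_ge1Dx K (- 2^-1); rewrite expRN => h.
have e0 := expR_gt0 (2^-1 : K).
have : (1 + - 2^-1) * expR 2^-1 <= (expR 2^-1)^-1 * expR 2^-1 :> K by rewrite ler_pM2r.
by rewrite mulVf ?gt_eqF //; lra.
Qed.

(* Since [ln 2 >= 1/2], [ln ln n >= ln (k / 2)] for [2 ^ k <= n]. *)
Lemma ell_le_lnln : \forall k \near \oo, forall n, (2 ^ k <= n)%N ->
  ell k <= 3 * ln (ln n%:R).
Proof.
near=> k => n kn.
have k_ge : 2 * (expR 2 + 3) <= k%:R :> K by near: k; exact: nbhs_infty_ger.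
pose y : K := k%:R / 2.
have e2 := expR_gt0 (2 : K).
have y3 : expR 2 + 3 <= y by rewrite /y ler_pdivlMr //; lra.
have y0 : 0 < y by lra.
have lny : 2 <= ln y by rewrite -[leLHS]expRK ler_ln ?posrE //; lra.
have lnk : ln k.+1%:R <= 2 * ln y.
  have -> : 2 * ln y = ln (y * y) by rewrite lnM ?posrE //; lra.
  rewrite ler_ln; [|by rewrite posrE|by rewrite posrE mulr_gt0].
  rewrite -natr1.
  have -> : k%:R = 2 * y by rewrite /y mulrCA mulfV ?mulr1.
  have : 3 * y <= y * y by rewrite ler_pM2r //; lra.
  lra.
have n0 : 0 < n%:R :> K by rewrite ltr0n (leq_trans _ kn) // expn_gt0.
have yn : y <= ln n%:R.
  apply: (@le_trans _ _ (ln (2 ^ k)%:R)); last first.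
    by rewrite ler_ln; [rewrite ler_nat|rewrite posrE ltr0n expn_gt0|rewrite posrE].
  by rewrite natrX lnXn // -[leRHS]mulr_natl /y ler_wpM2l // ln2_ge.
have : ln y <= ln (ln n%:R) by rewrite ler_ln ?posrE // (lt_le_trans y0).
rewrite /ell; lra.
Unshelve. all: by end_near.
Qed.

Lemma lil_rate (X : nat -> K) (a : K) (lam : nat -> K) : 0 <= a ->
  (\forall k \near \oo, forall m, (m <= 2 ^ k)%N ->
    `|\sum_(j < m) X (2 ^ k + j)%N| <= a * (tau k * ell k)) ->
  (forall n, 0 < lam n) ->
  lam n * Num.sqrt (n%:R / ln (ln n%:R)) @[n --> \oo] --> +oo ->
  forall e, 0 < e ->
  \forall n \near \oo, `|\sum_(i < n) X i| <= e * (n%:R * lam n).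
Proof.
move=> a0 hX lam0 lamoo e e0; have [C C0 [k1 _ hC]] := block_sum a0 hX.
have [k2 _ hk2] := ell_le_lnln.
pose k0 := maxn k1 k2.
have hlam : \forall n \near \oo, 2 * C / e <= lam n * Num.sqrt (n%:R / ln (ln n%:R)).
  by move/cvgryPge : lamoo; apply.
near=> n.
have n2 : (2 ^ k0 <= n)%N by near: n; exists (2 ^ k0)%N.
have n0 : (0 < n)%N by rewrite (leq_trans _ n2) // expn_gt0.
pose k := trunc_log 2 n.
have /andP[kn nk] : (2 ^ k <= n < 2 ^ k.+1)%N by exact: trunc_log_bounds.
have k0k : (k0 <= k)%N by apply: trunc_log_max.
have m_le : (n - 2 ^ k <= 2 ^ k)%N.
  by rewrite leq_subLR addnn -mul2n -expnS ltnW.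
have := hC k (leq_trans (leq_maxl _ _) k0k) _ m_le; rewrite subnKC // => h1.
have h2 := hk2 k (leq_trans (leq_maxr _ _) k0k) n kn.
have hl : 2 * C / e <= lam n * Num.sqrt (n%:R / ln (ln n%:R)) by near: n.
set L := ln (ln n%:R) in h2 hl *.
have L0 : 0 < L by have := ell_gt0 K k; lra.
have nR : 0 < n%:R :> K by rewrite ltr0n.
(* From [ell k <= 3 L] and [2 ^ k <= n], the square of [r k] is at most [3 n L]. *)
have r_le : r k <= 2 * Num.sqrt (n%:R * L).
  rewrite -(@ler_pXn2r _ 2) ?nnegrE ?mulr_ge0 ?sqrtr_ge0 ?(ltW (ell_gt0 K k)) //.
  rewrite [leRHS]exprMn sqr_sqrtr ?mulr_ge0 ?ltW // r_sqr.
  have kn' : (2 ^ k)%:R <= n%:R :> K by rewrite ler_nat.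
  have s1 : (2 ^ k)%:R * ell k <= n%:R * ell k by rewrite ler_wpM2r // ltW // ell_gt0.
  have s2 : n%:R * ell k <= n%:R * (3 * L) by rewrite ler_pM2l.
  have := mulr_gt0 nR L0; lra.
apply: le_trans h1 _; apply: (@le_trans _ _ (C * (2 * Num.sqrt (n%:R * L)))).
  exact: (ler_wpM2l C0 r_le).
have sq0 : 0 <= Num.sqrt (n%:R * L) by exact: sqrtr_ge0.
(* This product converts the hypothesis on [lam n * sqrt (n / L)] into a comparison of [sqrt (n L)]
   with [n * lam n]. *)
have sqn : Num.sqrt (n%:R / L) * Num.sqrt (n%:R * L) = n%:R.
  rewrite -sqrtrM ?divr_ge0 ?ltW // mulrACA mulVf ?gt_eqF // mulr1 -expr2.
  by rewrite sqrtr_sqr gtr0_norm.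
have := ler_wpM2r sq0 hl; rewrite -[leRHS]mulrA sqn.
move=> h3.
have -> : C * (2 * Num.sqrt (n%:R * L)) = e * (2 * C / e * Num.sqrt (n%:R * L)).
  by field; rewrite gt_eqF.
by rewrite ler_pM2l // (mulrC n%:R (lam n)).
Unshelve. all: by end_near.
Qed.

End lil_rate.

(** * Least squares *)

Section borel_vectors.
Variables (K : realType) (p : nat).

Lemma measurable_continuous_cV (f : 'cV[K]_p -> K) : continuous f ->
  measurable_fun setT (f : borel_cV K p -> K).
Proof.
move=> /continuousP cf; apply: (measurability _ (RGenOpens.measurableE K)).
move=> _ [_ [a [b ->] <-]]; rewrite setTI; apply: sub_sigma_algebra.
exact/cf/interval_open.
Qed.

Lemma measurable_coord i : measurable_fun setT (fun u : borel_cV K p => (u : 'cV[K]_p) i 0).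
Proof. exact: measurable_continuous_cV (@coord_continuous _ _ _ i 0). Qed.

Lemma measurable_dotp (w : 'cV[K]_p) :
  measurable_fun setT (fun u : borel_cV K p => dotp w (u : 'cV[K]_p)).
Proof.
apply: measurable_sum => i; apply: measurable_funM; first exact: measurable_cst.
exact: measurable_coord.
Qed.

End borel_vectors.

Section least_squares.
Variables (K : realType) (p : nat).
Local Notation V := 'cV[K]_p.
Local Notation U := (borel_cV K p * K)%type.
Variable rho : probability U K.
Hypotheses (hx4 : ('E_rho[fun s => (enorm s.1 ^+ 4)%R] < +oo)%E)
  (hy4 : ('E_rho[fun s => (`|s.2| ^+ 4)%R] < +oo)%E).

Local Notation "'EE' f" := (Rintegral rho setT f) (at level 10, f at next level).
Let integ (f : U -> K) := rho.-integrable setT (EFin \o f).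
Local Notation C := (second_moment rho).

Let mx (w : V) : measurable_fun setT (fun u : U => dotp w (u.1 : V)).
Proof. exact: (measurableT_comp (@measurable_dotp K p w)). Qed.

Let mxi i : measurable_fun setT (fun u : U => (u.1 : V) i 0).
Proof. exact: (measurableT_comp (@measurable_coord K p i)). Qed.

Let my : measurable_fun setT (fun u : U => (u.2 : K)). Proof. exact: measurable_snd. Qed.

Let mnx : measurable_fun setT (fun u : U => enorm (u.1 : V)).
Proof.
exact: (measurableT_comp (measurable_continuous_cV (@enorm_continuous K p))).
Qed.

(** A single integrable function that dominates, up to constants, every polynomial integrand
    below. *)
Let moment4 (u : U) : K := 1 + enorm u.1 ^+ 4 + `|(u.2 : K)| ^+ 4.

Let integ_moment4 : integ moment4.
Proof.
have mx4 : measurable_fun setT (fun u : U => enorm (u.1 : V) ^+ 4).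
  exact: measurable_funX.
have my4 : measurable_fun setT (fun u : U => `|(u.2 : K)| ^+ 4).
  by apply: measurable_funX; exact: measurableT_comp.
have i1 : integ (fun=> 1) by exact: finite_measure_integrable_cst.
have ge0 (f : U -> K) : measurable_fun setT f -> (forall u, 0 <= f u) ->
    (\int[rho]_u (f u)%:E < +oo)%E -> integ f.
  move=> mf f0 foo; apply/integrableP; split; first exact/measurable_EFinP.
  by under eq_integral do rewrite /= ger0_norm //.
have ix : integ (fun u => enorm u.1 ^+ 4).
  apply: ge0 => //; first by move=> u; rewrite exprn_ge0 // enorm_ge0.
  by move: hx4; rewrite unlock.
have iy : integ (fun u => `|(u.2 : K)| ^+ 4).
  apply: ge0 => //.
  by move: hy4; rewrite unlock.
exact: (integrableD measurableT (integrableD measurableT i1 ix) iy).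
Qed.

Let dominated c (f : U -> K) : measurable_fun setT f ->
  (forall u, `|f u| <= c * moment4 u) -> integ f.
Proof.
move=> mf fc.
have ic : integ (fun u => c * moment4 u).
  exact: (integrableZl measurableT c integ_moment4).
apply: le_integrable ic => //; first exact/measurable_EFinP.
move=> u _ /=; rewrite lee_fin; apply: le_trans (fc u) _; exact: ler_norm.
Qed.

Let sq_le (a : K) : a ^+ 2 <= 1 + a ^+ 4.
Proof.
have : 0 <= (a ^+ 2 - 1) ^+ 2 by exact: sqr_ge0.
have : 0 <= a ^+ 2 by exact: sqr_ge0.
have -> : (a ^+ 2 - 1) ^+ 2 = a ^+ 4 - 2 * a ^+ 2 + 1 by ring.
lra.
Qed.

Let x2_le (u : U) : enorm u.1 ^+ 2 <= moment4 u.
Proof.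
rewrite /moment4; have := sq_le (enorm u.1).
have : 0 <= `|(u.2 : K)| ^+ 4 by [].
lra.
Qed.

Let y2_le (u : U) : (u.2 : K) ^+ 2 <= moment4 u.
Proof.
rewrite /moment4 -real_normK ?num_real //; have := sq_le (`|(u.2 : K)|).
have : 0 <= enorm u.1 ^+ 4 by rewrite exprn_ge0 // enorm_ge0.
lra.
Qed.

Let moment4_ge1 (u : U) : 1 <= moment4 u.
Proof. by rewrite /moment4 -addrA lerDl addr_ge0 // exprn_ge0 // enorm_ge0. Qed.

Let dotp2_le (w : V) (u : U) : dotp w u.1 ^+ 2 <= enorm w ^+ 2 * enorm u.1 ^+ 2.
Proof. by have := psd_CS w u.1 (psd1 K p); rewrite !mul1mx !enorm_sqr. Qed.

Let normM_le (a b : K) : `|a * b| <= a ^+ 2 + b ^+ 2.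
Proof.
rewrite ler_norml; have := sqr_ge0 (a + b); have := sqr_ge0 (a - b).
have := sqr_ge0 a; have := sqr_ge0 b.
rewrite (sqrrD a b) (sqrrB a b) => *; apply/andP; split; lra.
Qed.

Let integ_xx (v w : V) : integ (fun u => dotp v u.1 * dotp w u.1).
Proof.
apply: (@dominated (enorm v ^+ 2 + enorm w ^+ 2)) => [|u].
  exact: measurable_funM.
apply: le_trans (normM_le _ _) _; rewrite mulrDl.
apply: lerD; apply: le_trans (dotp2_le _ _) _; rewrite ler_wpM2l ?sqr_ge0 //.
Qed.

Let integ_xy (v : V) : integ (fun u => dotp v u.1 * (u.2 : K)).
Proof.
apply: (@dominated (enorm v ^+ 2 + 1)) => [|u]; first exact: measurable_funM.
apply: le_trans (normM_le _ _) _; rewrite mulrDl mul1r.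
by apply: lerD => //; apply: le_trans (dotp2_le _ _) _; rewrite ler_wpM2l ?sqr_ge0.
Qed.

Let integ_yy : integ (fun u => (u.2 : K) * (u.2 : K)).
Proof.
apply: (@dominated 1) => [|u]; first exact: measurable_funM.
by rewrite mul1r -expr2 ger0_norm ?sqr_ge0.
Qed.

Let integD f g : integ f -> integ g -> integ (fun u => f u + g u).
Proof. by move=> hf hg; exact: (integrableD measurableT hf hg). Qed.

Let integZ a f : integ f -> integ (fun u => a * f u).
Proof. by move=> hf; exact: (integrableZl measurableT a hf). Qed.

Let EED f g : integ f -> integ g -> EE (fun u => f u + g u) = EE f + EE g.
Proof. by move=> hf hg; rewrite -RintegralD. Qed.

Let EEZ a f : integ f -> EE (fun u => a * f u) = a * EE f.
Proof. by move=> hf; rewrite -RintegralZl. Qed.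

Let EEfin f : integ f -> (\int[rho]_u (f u)%:E = (EE f)%:E)%E.
Proof. by move=> hf; rewrite fineK //; exact: integrable_fin_num. Qed.

Let integ_sum (I : Type) (r : seq I) (f : I -> U -> K) : (forall i, integ (f i)) ->
  integ (fun u => \sum_(i <- r) f i u) /\
  EE (fun u => \sum_(i <- r) f i u) = \sum_(i <- r) EE (f i).
Proof.
move=> hf; elim: r => [|i r [ih1 ih2]].
  have -> : (fun u : U => \sum_(i <- [::]) f i u) = fun=> 0.
    by apply/funext => u; rewrite big_nil.
  rewrite big_nil; split; first exact: finite_measure_integrable_cst.
  by rewrite Rintegral_cst // mul0r.
have -> : (fun u : U => \sum_(i <- i :: r) f i u) =
    fun u => f i u + \sum_(i <- r) f i u.
  by apply/funext => u; rewrite big_cons.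
by split; [exact: integD|rewrite EED // big_cons ih2].
Qed.

Lemma second_moment_dotp (v w : V) :
  EE (fun u => dotp v u.1 * dotp w u.1) = dotp (C *m v) w.
Proof.
have ixx i j : integ (fun u => (u.1 : V) i 0 * (u.1 : V) j 0).
  have := integ_xx (delta_mx i 0) (delta_mx j 0).
  by under eq_fun do rewrite !dotp_delta.
have -> : (fun u : U => dotp v u.1 * dotp w u.1) = fun u =>
    \sum_i \sum_j (w i 0 * v j 0) * ((u.1 : V) i 0 * (u.1 : V) j 0).
  apply/funext => u; rewrite mulrC /dotp big_distrl; apply: eq_bigr => i _ /=.
  by rewrite big_distrr; apply: eq_bigr => j _ /=; ring.
have iw i j : integ (fun u => (w i 0 * v j 0) * ((u.1 : V) i 0 * (u.1 : V) j 0)).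
  exact: integZ.
rewrite (integ_sum _ (fun i => (integ_sum _ (iw i)).1)).2 /dotp.
apply: eq_bigr => i _; rewrite (integ_sum _ (iw i)).2 mxE big_distrl.
by apply: eq_bigr => j _ /=; rewrite EEZ // !mxE; ring.
Qed.

Lemma second_moment_psd : psd C.
Proof.
split=> [|v].
  by apply/matrixP => i j; rewrite !mxE; apply: eq_Rintegral => u _; rewrite mulrC.
by rewrite -second_moment_dotp; apply: Rintegral_ge0 => u _; rewrite -expr2 sqr_ge0.
Qed.

Lemma riskE w : risk rho w = (dotp (C *m w) w
  - 2 * EE (fun u => dotp w u.1 * (u.2 : K)) + EE (fun u => (u.2 : K) * (u.2 : K)))%:E.
Proof.
rewrite /risk unlock.
have -> : (\int[rho]_u ((dotp w u.1 - (u.2 : K)) ^+ 2)%:E = \int[rho]_u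
    ((dotp w u.1 * dotp w u.1 + (- 2) * (dotp w u.1 * (u.2 : K)) + (u.2 : K) * (u.2 : K)))%:E)%E.
  by apply: eq_integral => u _; congr (_%:E); ring.
have i1 : integ (fun u => (- 2) * (dotp w u.1 * (u.2 : K))) by exact: integZ.
have i2 : integ (fun u => dotp w u.1 * dotp w u.1 + (- 2) * (dotp w u.1 * (u.2 : K))).
  exact: integD.
rewrite EEfin; last exact: integD.
rewrite EED // EED // EEZ // second_moment_dotp; congr (_%:E); lra.
Qed.

Variable w0 : V.
Hypothesis w0_min : argmin setT (risk rho) w0.

Definition residual (u : U) : K := (u.2 : K) - dotp w0 u.1.

Let EE_xy (v w : V) a : EE (fun u => dotp (v + a *: w) u.1 * (u.2 : K)) =
  EE (fun u => dotp v u.1 * (u.2 : K)) + a * EE (fun u => dotp w u.1 * (u.2 : K)).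
Proof.
rewrite -EEZ // -EED //; last exact: integZ.
by apply: eq_Rintegral => u _; rewrite !dotpE; ring.
Qed.

Lemma normal_equation v : EE (fun u => dotp v u.1 * (u.2 : K)) = dotp (C *m w0) v.
Proof.
have quad t : 0 <= t * (2 * (dotp (C *m w0) v - EE (fun u => dotp v u.1 * (u.2 : K))) +
    t * dotp (C *m v) v).
  have := w0_min.2 (w0 + t *: v) I; rewrite !riskE lee_fin EE_xy.
  rewrite mulmxDr -scalemxAr !dotpE (psd_sym v w0 second_moment_psd); lra.
set a := 2 * _ in quad; set b := dotp (C *m v) v in quad.
have b0 : 0 <= b by exact: second_moment_psd.2.
suff a0 : a = 0 by rewrite /a in a0; lra.
apply/eqP; rewrite -sqrf_eq0 eq_le sqr_ge0 andbT.
have b1 : 0 < b + 1 by rewrite ltr_wpDl.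
(* [b + 1] in place of [b] avoids treating [b = 0] separately; the value is [- (a / (b + 1))^2]. *)
have := quad (- a / (b + 1)).
have -> : - a / (b + 1) * (a + - a / (b + 1) * b) = - (a / (b + 1)) ^+ 2.
  by field; rewrite gt_eqF.
rewrite oppr_ge0 exprMn pmulr_lle0 // exprn_gt0 // invr_gt0 //.
Qed.

(** Moving along Ker C preserves optimality, so uniqueness of [w0] becomes a strict property of [R]
    along Ker C. *)
Lemma risk_ker h : im_proj C *m h = 0 -> argmin setT (risk rho) (w0 + h).
Proof.
move=> Ph; have Ch : C *m h = 0.
  have <- : C *m im_proj C = C.
    apply: trmx_inj; rewrite trmx_mul im_proj_sym second_moment_psd.1.
    exact: (im_projC second_moment_psd).
  by rewrite -mulmxA Ph mulmx0.
split=> // v vT; have := w0_min.2 v vT; rewrite !riskE.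
have -> : w0 + h = w0 + 1 *: h by rewrite scale1r.
rewrite EE_xy scale1r (normal_equation h) mulmxDr Ch addr0 dotpDr.
rewrite (psd_sym w0 h second_moment_psd) Ch dotp0l.
by rewrite !addr0 mulr0 addr0.
Qed.

(** Centering is the i-th normal equation. Square integrability is where the fourth moments enter,
    through [2 |x|^2 y^2 <= |x|^4 + y^4]. *)
Lemma centered_residual i : let f := fun u : U => (u.1 : V) i 0 * residual u in
  [/\ measurable_fun setT f, rho.-integrable setT (EFin \o f),
      (\int[rho]_u (f u)%:E = 0)%E &
      exists v, (\int[rho]_u (f u ^+ 2)%:E <= v%:E)%E].
Proof.
move=> f; pose W := enorm w0.
have mf : measurable_fun setT f.
  by apply: measurable_funM => //; apply: measurable_funB.
have f2 u : f u ^+ 2 <= (2 + 2 * W ^+ 2) * moment4 u.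
  have h1 : (u.1 : V) i 0 ^+ 2 <= enorm u.1 ^+ 2.
    by rewrite -(real_normK (num_real _)) lerXn2r ?nnegrE ?enorm_ge0 ?enorm_entry.
  have h2 := dotp2_le w0 u; rewrite -/W in h2.
  have h3 : residual u ^+ 2 <= 2 * (u.2 : K) ^+ 2 + 2 * (W ^+ 2 * enorm u.1 ^+ 2).
    have : 0 <= ((u.2 : K) + dotp w0 u.1) ^+ 2 by exact: sqr_ge0.
    rewrite /residual sqrrB sqrrD; lra.
  rewrite /f exprMn; apply: le_trans (ler_pM (sqr_ge0 _) (sqr_ge0 _) h1 h3) _.
  set X := enorm u.1 ^+ 2; set Y := (u.2 : K) ^+ 2.
  have XY : 2 * (X * Y) <= X ^+ 2 + Y ^+ 2 by have := sqr_ge0 (X - Y); rewrite sqrrB; lra.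
  have e1 : moment4 u = 1 + X ^+ 2 + Y ^+ 2.
    rewrite /moment4 /X /Y -[(u.2 : K) ^+ 2]real_normK ?num_real //.
    by rewrite -!exprM.
  have W0 : 0 <= W ^+ 2 by exact: sqr_ge0.
  have := mulr_ge0 W0 (sqr_ge0 Y); have := sqr_ge0 Y; have := sqr_ge0 X.
  have := mulr_ge0 W0 (sqr_ge0 X).
  rewrite e1 mulrDr => ? ? ? ?; lra.
have f_int : integ f.
  apply: (@dominated (3 + 2 * W ^+ 2)) => // u.
  have : `|f u| <= 1 + f u ^+ 2.
    by have := normM_le (f u) 1; rewrite mulr1 expr1n addrC.
  have := f2 u; have := moment4_ge1 u; lra.
split=> //.
  rewrite EEfin //; congr (_%:E).
  have -> : EE f = EE (fun u => dotp (delta_mx i 0) u.1 * (u.2 : K) +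
      (- 1) * (dotp (delta_mx i 0) u.1 * dotp w0 u.1)).
    by apply: eq_Rintegral => u _; rewrite dotp_delta /f /residual; ring.
  rewrite EED //; last exact: integZ.
  rewrite EEZ // normal_equation second_moment_dotp.
  by rewrite (psd_sym w0 _ second_moment_psd); lra.
exists (EE (fun u => f u ^+ 2)); rewrite EEfin //.
apply: (@dominated (2 + 2 * W ^+ 2)) => [|u]; first exact: measurable_funX.
by rewrite ger0_norm ?sqr_ge0.
Qed.

Lemma centered_moment i j :
  let f := fun u : U => (u.1 : V) i 0 * (u.1 : V) j 0 - C i j in
  [/\ measurable_fun setT f, rho.-integrable setT (EFin \o f),
      (\int[rho]_u (f u)%:E = 0)%E &
      exists v, (\int[rho]_u (f u ^+ 2)%:E <= v%:E)%E].
Proof.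
move=> f.
have mf : measurable_fun setT f.
  by apply: measurable_funB => //; exact: measurable_funM.
have ixx : integ (fun u => (u.1 : V) i 0 * (u.1 : V) j 0).
  have := integ_xx (delta_mx i 0) (delta_mx j 0).
  by under eq_fun do rewrite !dotp_delta.
have f_int : integ f.
  by apply: integD => //; exact: finite_measure_integrable_cst.
have f2 u : f u ^+ 2 <= (2 + 2 * C i j ^+ 2) * moment4 u.
  have h1 k : (u.1 : V) k 0 ^+ 2 <= enorm u.1 ^+ 2.
    by rewrite -(real_normK (num_real _)) lerXn2r ?nnegrE ?enorm_ge0 ?enorm_entry.
  have h2 := ler_pM (sqr_ge0 _) (sqr_ge0 _) (h1 i) (h1 j).
  rewrite -exprMn -exprD in h2.
  set a := _ * _ in h2 *.
  have h3 : enorm u.1 ^+ (2 + 2) <= moment4 u.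
    rewrite /moment4; have : 0 <= `|(u.2 : K)| ^+ 4 by [].
    by change (2 + 2)%N with 4%N; lra.
  have h4 : f u ^+ 2 <= 2 * a ^+ 2 + 2 * C i j ^+ 2.
    have : 0 <= (a + C i j) ^+ 2 by exact: sqr_ge0.
    rewrite /f -/a sqrrB sqrrD; lra.
  have := ler_wpM2l (sqr_ge0 (C i j)) (moment4_ge1 u).
  lra.
split=> //.
  rewrite EEfin //; congr (_%:E); rewrite /f EED //; last exact: finite_measure_integrable_cst.
  rewrite Rintegral_cst // mxE.
  have -> : fine (rho setT) = 1 by rewrite (_ : rho setT = 1%E) //; exact: probability_setT.
  by rewrite mulr1 addrN.
exists (EE (fun u => f u ^+ 2)); rewrite EEfin //.
apply: (@dominated (2 + 2 * C i j ^+ 2)) => [|u]; first exact: measurable_funX.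
by rewrite ger0_norm ?sqr_ge0.
Qed.

(** The rows [g] of [im_proj C - 1] lie in Ker C, so [<g, x>^2] has mean [<C g, g> = 0]. *)
Lemma im_proj_ae : {ae rho, forall u, im_proj C *m (u.1 : V) = u.1}.
Proof.
pose g i : V := (row i (im_proj C - 1%:M))^T.
have gE i (v : V) : dotp (g i) v = (im_proj C *m v - v) i 0.
  rewrite -[v in _ - v]mul1mx -mulmxBl mxE /dotp.
  by apply: eq_bigr => j _; rewrite !mxE.
have Cg i : C *m g i = 0.
  have : (im_proj C - 1%:M) *m C = 0.
    by rewrite mulmxBl (im_projC second_moment_psd) mul1mx subrr.
  move=> /(congr1 (row i)); rewrite row_mul row0 => h.
  by rewrite -{1}second_moment_psd.1 -trmx_mul h trmx0.
have ae_i i : {ae rho, forall u, dotp (g i) (u.1 : V) = 0}.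
  have mg2 : measurable_fun setT (fun u : U => (dotp (g i) u.1 * dotp (g i) u.1)%:E).
    by apply/measurable_EFinP; exact: measurable_funM.
  have : (\int[rho]_u `|(dotp (g i) u.1 * dotp (g i) u.1)%:E| = 0)%E.
    under eq_integral => u _.
      rewrite gee0_abs; last by rewrite lee_fin -expr2 sqr_ge0.
      over.
    by rewrite EEfin // second_moment_dotp Cg dotp0l.
  move=> /(ae_eq_integral_abs rho measurableT mg2).1; apply: filterS => u /(_ I) [] /eqP.
  by rewrite mulf_eq0 orbb => /eqP.
have : {ae rho, forall u, forall i, dotp (g i) (u.1 : V) = 0}.
  exact: (filter_forall (ae_filter_ringOfSetsType rho) ae_i).
apply: (@filterS _ _ (ae_filter_ringOfSetsType rho)) => u h.
apply/eqP; rewrite -subr_eq0; apply/eqP/colP => i.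
by rewrite -gE h mxE.
Qed.

End least_squares.

(** * Empirical moments *)

Section sample.
Variables (K : realType) (p : nat).
Local Notation V := 'cV[K]_p.
Local Notation U := (borel_cV K p * K)%type.
Variable rho : probability U K.
Hypotheses (hx4 : ('E_rho[fun s => (enorm s.1 ^+ 4)%R] < +oo)%E)
  (hy4 : ('E_rho[fun s => (`|s.2| ^+ 4)%R] < +oo)%E).
Variables (d : measure_display) (T : measurableType d) (P : probability T K)
  (s : nat -> T -> U).
Hypothesis hs : iid_sample rho P s.
Variable lambda : nat -> K.
Hypothesis hlambda : forall n, 0 < lambda n.
Hypothesis hlambda0 : lambda n @[n --> \oo] --> (0 : K).
Hypothesis hlambdaoo :
  lambda n * Num.sqrt (n%:R / ln (ln n%:R)) @[n --> \oo] --> +oo.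
Local Notation C := (second_moment rho).

Lemma ae_sample (A : U -> Prop) : {ae rho, forall u, A u} ->
  {ae P, forall om, forall i, A (s i om)}.
Proof.
have [ms ls _] := hs.
move=> [N [mN N0 AN]]; apply: (@ae_foralln _ _ _ P (fun i om => A (s i om))) => i.
exists (s i @^-1` N); split.
- by rewrite -[X in measurable X]setTI; exact: ms.
- by rewrite -N0 -(ls i).
- by move=> om nA; exact: AN.
Qed.

(** [blocks_ae] bounds sums from above only, hence its use for [phi] and for its opposite. *)
Lemma lil_ae (phi : U -> K) :
  [/\ measurable_fun setT phi, rho.-integrable setT (EFin \o phi),
      (\int[rho]_u (phi u)%:E = 0)%E &
      exists v, (\int[rho]_u (phi u ^+ 2)%:E <= v%:E)%E] ->
  {ae P, forall om, forall e, 0 < e -> \forall n \near \oo,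
    `|\sum_(i < n) phi (s i om)| <= e * (n%:R * lambda n)}.
Proof.
move=> [mphi iphi phi0 [v phi2]]; have [ms ls indep_s] := hs.
have up := blocks_ae ms ls indep_s mphi iphi phi0 phi2.
have mnphi : measurable_fun setT (fun u => (- 1) * phi u) by exact: measurable_funM.
have inphi : rho.-integrable setT (EFin \o (fun u => (- 1) * phi u)).
  exact: (integrableZl measurableT (-1) iphi).
have nphi0 : (\int[rho]_u ((- 1) * phi u)%:E = 0)%E.
  under eq_integral do rewrite EFinM.
  by rewrite integralZl // phi0 mule0.
have nphi2 : (\int[rho]_u (((- 1) * phi u) ^+ 2)%:E <= v%:E)%E.
  by under eq_integral do rewrite mulN1r sqrrN.
have dn := blocks_ae ms ls indep_s mnphi inphi nphi0 nphi2.
have a0 : 0 <= 2 * v + 5.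
  have : 0 <= v.
    rewrite -lee_fin; apply: le_trans phi2.
    by apply: integral_ge0 => u _; rewrite lee_fin sqr_ge0.
  lra.
have aeF := ae_filter_ringOfSetsType P.
apply: (@filterS2 _ _ aeF) up dn => om up dn.
apply: (@lil_rate _ (fun i => phi (s i om)) _ _ a0) => //.
near=> k => m mk.
have h1 : \sum_(j < m) phi (s (2 ^ k + j)%N om) <= (2 * v + 5) * (tau K k * ell K k).
  by move: m mk; near: k.
have h2 : \sum_(j < m) (- 1) * phi (s (2 ^ k + j)%N om) <=
    (2 * v + 5) * (tau K k * ell K k).
  by move: m mk {h1}; near: k.
rewrite -big_distrr /= mulN1r in h2.
by rewrite ler_norml h1 andbT lerNl.
Unshelve. all: by end_near.
Qed.

Definition emp_cov (x : nat -> V) n : 'M[K]_p :=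
  n%:R^-1 *: \sum_(i < n) x i *m (x i)^T.

Definition emp_noise (x : nat -> V) (y : nat -> K) (w0 : V) n : V :=
  n%:R^-1 *: \sum_(i < n) (y i - dotp w0 (x i)) *: x i.

Lemma data_ae (w0 : V) : argmin setT (risk rho) w0 ->
  {ae P, forall om, let x i : V := (s i om).1 in let y i : K := (s i om).2 in
    (forall i, im_proj C *m x i = x i) /\
    forall kappa, 0 < kappa -> \forall n \near \oo,
      fnorm (emp_cov x n - C) <= kappa /\
      enorm (emp_noise x y w0 n) <= kappa * lambda n}.
Proof.
move=> w0_min; have aeF := ae_filter_ringOfSetsType P.
have ae1 := ae_sample (im_proj_ae hx4 hy4).
have ae2 : {ae P, forall om, forall i, forall e, 0 < e -> \forall n \near \oo,
    `|\sum_(k < n) (((s k om).1 : V) i 0 * residual w0 (s k om))| <= e * (n%:R * lambda n)}.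
  apply: (filter_forall aeF) => i; apply: (@lil_ae (fun u => (u.1 : V) i 0 * residual w0 u)).
  exact: (centered_residual hx4 hy4 w0_min i).
have ae3 : {ae P, forall om, forall ij : 'I_p * 'I_p, forall e, 0 < e -> \forall n \near \oo,
    `|\sum_(k < n) (((s k om).1 : V) ij.1 0 * ((s k om).1 : V) ij.2 0 - C ij.1 ij.2)|
      <= e * (n%:R * lambda n)}.
  apply: (filter_forall aeF) => ij.
  apply: (@lil_ae (fun u => (u.1 : V) ij.1 0 * (u.1 : V) ij.2 0 - C ij.1 ij.2)).
  exact: (centered_moment hx4 hy4 ij.1 ij.2).
move: ae1 ae2 ae3; apply: (@filterS3 _ _ aeF) => om h1 h2 h3.
pose x i : V := (s i om).1; pose y i : K := (s i om).2; rewrite -/x -/y.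
split; first exact: h1.
move=> kappa k0.
pose e := kappa / p.+1%:R.
have e0 : 0 < e by rewrite divr_gt0.
have pe : p%:R * e <= kappa.
  by rewrite /e mulrCA ger_pMr // ler_pdivrMr // mul1r ler_nat.
have {}h2 : \forall n \near \oo, forall i,
    `|\sum_(k < n) (x k i 0 * residual w0 (s k om))| <= e * (n%:R * lambda n).
  by apply: filter_forall => i; exact: h2.
have {}h3 : \forall n \near \oo, forall ij : 'I_p * 'I_p,
    `|\sum_(k < n) (x k ij.1 0 * x k ij.2 0 - C ij.1 ij.2)| <= e * (n%:R * lambda n).
  by apply: filter_forall => ij; exact: h3.
have lam1 : \forall n \near \oo, lambda n < 1.
  by apply: (cvgr_lt _ hlambda0).
near=> n.
have n0 : 0 < n%:R :> K by near: n; exists 1%N => // m /= ?; rewrite ltr0n.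
have h2n : forall i, `|\sum_(k < n) (x k i 0 * residual w0 (s k om))| <=
    e * (n%:R * lambda n) by near: n.
have h3n : forall ij : 'I_p * 'I_p,
    `|\sum_(k < n) (x k ij.1 0 * x k ij.2 0 - C ij.1 ij.2)| <= e * (n%:R * lambda n).
  by near: n.
have scale (S : K) : `|S| <= e * (n%:R * lambda n) -> `|n%:R^-1 * S| <= e * lambda n.
  have ni : 0 <= n%:R^-1 :> K by rewrite invr_ge0 ltW.
  move=> hS; rewrite normrM (ger0_norm ni) ler_pdivrMl //.
  by rewrite mulrCA.
have el : 0 <= e * lambda n by apply: mulr_ge0; exact: ltW.
split.
  have Mij i j : `|(emp_cov x n - C) i j| <= e * lambda n.
    have -> : (emp_cov x n - C) i j = n%:R^-1 * \sum_(k < n) (x k i 0 * x k j 0 - C i j).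
      rewrite sumrB sumr_const card_ord -(mulr_natl (C i j)) mulrBr mulKf ?gt_eqF //.
      rewrite mxE [in LHS]mxE summxE mxE; congr (_ * _ - _).
      by apply: eq_bigr => k _; rewrite mxE big_ord1 mxE.
    exact: scale (h3n (i, j)).
  apply: le_trans (fnorm_le_entries el Mij) _; rewrite mulrA.
  apply: le_trans (ler_wpM2r (ltW (hlambda n)) pe) _.
  by rewrite ger_pMr // ltW //; near: n.
have bi i : `|(emp_noise x y w0 n) i 0| <= e * lambda n.
  have -> : (emp_noise x y w0 n) i 0 = n%:R^-1 * \sum_(k < n) (x k i 0 * residual w0 (s k om)).
    rewrite mxE summxE; congr (_ * _); apply: eq_bigr => k _.
    by rewrite mxE mulrC.
  exact: scale (h2n i).
apply: le_trans (enorm_le_entries el bi) _; rewrite mulrA.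
exact: (ler_wpM2r (ltW (hlambda n)) pe).
Unshelve. all: by end_near.
Qed.

End sample.

Section empirical.
Variables (K : realType) (p : nat) (x : nat -> 'cV[K]_p) (y : nat -> K)
  (w0 : 'cV[K]_p) (P : 'M[K]_p).
Hypotheses (Psym : P^T = P) (Px : forall i, P *m x i = x i).

Lemma emp_cov_psd n : psd (emp_cov x n).
Proof.
split=> [|v].
  rewrite /emp_cov linearZ /= linear_sum; congr (_ *: _); apply: eq_bigr => i _.
  by rewrite /= trmx_mul trmxK.
rewrite /emp_cov -scalemxAl dotpZl mulr_ge0 ?invr_ge0 //.
rewrite mulmx_suml dotp_suml; apply: sumr_ge0 => i _.
rewrite -mulmxA dotp_mulmxl.
exact: dotpvv_ge0.
Qed.

Lemma emp_cov_proj n : emp_cov x n *m P = emp_cov x n.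
Proof.
rewrite /emp_cov -scalemxAl mulmx_suml; congr (_ *: _); apply: eq_bigr => i _.
by rewrite -mulmxA -[X in _ *m X]trmxK trmx_mul trmxK Psym Px.
Qed.

Lemma emp_noise_proj n : P *m emp_noise x y w0 n = emp_noise x y w0 n.
Proof.
rewrite /emp_noise -scalemxAr mulmx_sumr; congr (_ *: _); apply: eq_bigr => i _.
by rewrite -scalemxAr Px.
Qed.

End empirical.

(** * Stochastic proximal gradient iterates *)

(** Compare [z] with [z + t (u - z)], use convexity, divide by [t] and make [t] small. *)
Lemma prox_subdiff (K : realType) (p : nat) (R : 'cV[K]_p -> \bar K) (c : K) v z :
  eproper R -> econvex R -> 0 < c ->
  prox (fun u => c%:E * R u)%E v z -> subdiff R z (c^-1 *: (v - z)).
Proof.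
move=> [nR [u0 Ru0]] cR c0 [_ zmin] u.
have [rz Rz] : exists r, R z = r%:E.
  have := zmin u0 I; move: Ru0 (nR u0) (nR z).
  case: (R u0) => // r0 _ _; case: (R z) => // [rz _ _|_]; first by exists rz.
  by rewrite gt0_muley ?lte_fin // addye // -EFinM -EFinD.
rewrite Rz; case Ru : (R u) (nR u) => [ru| |] // _; last by rewrite leey.
rewrite -EFinD lee_fin dotpZl.
have main t : 0 < t < 1 ->
    c * (rz - ru) <= dotp (z - v) (u - z) + t * dotp (u - z) (u - z).
  move=> /[dup] t01 /andP[t0 t1].
  have := cR u z t t01; rewrite Ru Rz -!EFinM -EFinD.
  set m := _ + _; case Rm : (R m) (nR m) => [rm| |] // _.
  rewrite lee_fin => conv; have := zmin m I.
  rewrite Rz Rm -!EFinM -!EFinD lee_fin !enorm_sqr.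
  have -> : m - v = (z - v) + t *: (u - z).
    rewrite /m scalerBr scalerBl scale1r addrCA [LHS]addrAC -!addrA.
    by congr (_ + _); rewrite addrC -!addrA.
  rewrite (dotpDl (z - v)) !(dotpDr _ (z - v)) !dotpZl !dotpZr (dotpC (u - z) (z - v)).
  set a := dotp (z - v) (u - z); set q := dotp (u - z) (u - z).
  set n := dotp (z - v) (z - v) => h.
  have h2 : c * rm <= c * (t * ru + (1 - t) * rz) by rewrite ler_pM2l.
  have q0 : 0 <= q by exact: dotpvv_ge0.
  rewrite -(ler_pM2l t0).
  have : 0 <= t * t * q by rewrite !mulr_ge0 // ltW.
  lra.
suff h : c * (rz - ru) <= dotp (z - v) (u - z).
  have zv : v - z = - (z - v) by rewrite opprB.
  rewrite zv dotpNl -(ler_pM2l c0) mulrDr mulrA mulfV ?gt_eqF // mul1r; lra.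
set q := dotp (u - z) (u - z) in main *.
rewrite leNgt; apply/negP => lt; set e := c * (rz - ru) - dotp (z - v) (u - z).
have e0 : 0 < e by rewrite subr_gt0.
have q0 : 0 <= q by exact: dotpvv_ge0.
have q1 : 0 < 2 * (q + 1) by rewrite mulr_gt0 // ltr_wpDl.
pose t := Num.min 2^-1 (e / (2 * (q + 1))).
have t0 : 0 < t by rewrite lt_min invr_gt0 ltr0n divr_gt0.
have t1 : t < 1 by rewrite gt_min invf_lt1 // ltr1n.
have t2 : t <= e / (2 * (q + 1)) by rewrite ge_min lexx orbT.
have := main t; rewrite t0 t1 => /(_ isT).
move: t2; rewrite ler_pdivlMr // => t2 h.
have : 0 < t * q + 2 * t by rewrite ltr_wpDl ?mulr_ge0 ?mulr_gt0 // ltW.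
have := mulr_ge0 (ltW t0) q0.
by rewrite /e in t2 e0 *; lra.
Qed.

(** * Conditional expectations given the past iterates *)

Section conditional.
Variables (K : realType) (d : measure_display) (T : measurableType d)
  (Q : probability T K) (G : set (set T)).
Hypothesis GM : G `<=` measurable.

Let meas_T (f : T -> K) : measurable_fun setT (f : g_sigma_algebraType G -> K) ->
  measurable_fun setT (f : T -> K).
Proof. exact: measurable_fun_sub_sigma. Qed.

Lemma bounded_integrable (f : T -> K) M : measurable_fun setT f ->
  (forall t, `|f t| <= M) -> Q.-integrable setT (EFin \o f).
Proof.
move=> mf fM; have iM : Q.-integrable setT (EFin \o (fun=> M)).
  exact: finite_measure_integrable_cst.
apply: le_integrable iM => //; first exact/measurable_EFinP.
by move=> t _ /=; rewrite lee_fin (le_trans (fM t)) // ler_norm.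
Qed.

(** [Z] may change sign, so the product formula for nonnegative functions is applied to [Z + M] and
    the contribution of [M] is subtracted. *)
Lemma indep_integral_indic (E : set T) (Z : T -> K) M : measurable E ->
  (forall A, <<s G>> A -> Q (E `&` A) = (Q E * Q A)%E) ->
  measurable_fun setT (Z : g_sigma_algebraType G -> K) -> (forall t, `|Z t| <= M) ->
  Rintegral Q setT (fun t => Z t * \1_E t) = Rintegral Q setT Z * fine (Q E).
Proof.
move=> mE indepE mZ ZM; have mZT := meas_T mZ.
have mI : measurable_fun setT (\1_E : T -> K) by exact: measurable_indic.
have I1 t : `|(\1_E t : K)| <= 1.
  by rewrite indicE; case: (t \in E); rewrite ?normr1 ?normr0.
have iI : Q.-integrable setT (EFin \o (\1_E : T -> K)) by exact: bounded_integrable I1.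
have iZ : Q.-integrable setT (EFin \o Z) by exact: bounded_integrable ZM.
have M0 t : 0 <= Z t + M by have := ZM t; rewrite ler_norml => /andP[]; lra.
have iZI : Q.-integrable setT (EFin \o (fun t => Z t * \1_E t)).
  apply: (@bounded_integrable _ M); first exact: measurable_funM.
  move=> t; rewrite normrM; apply: le_trans (ZM t).
  by rewrite ler_piMr.
have iMI : Q.-integrable setT (EFin \o (fun t => M * \1_E t)).
  exact: (integrableZl measurableT M iI).
have icst : Q.-integrable setT (EFin \o (fun=> M)).
  exact: finite_measure_integrable_cst.
have EI : Rintegral Q setT (\1_E : T -> K) = fine (Q E).
  by rewrite /Rintegral integral_indic // setIT.
have Qfin (f : T -> K) : Q.-integrable setT (EFin \o f) ->
    (\int[Q]_t (f t)%:E = (Rintegral Q setT f)%:E)%E.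
  by move=> fi; rewrite fineK //; exact: integrable_fin_num.
have indepZI (A B : set K) : measurable A -> measurable B ->
    Q ((fun t => (Z t + M)%R) @^-1` A `&` \1_E @^-1` B) =
    (Q ((fun t => (Z t + M)%R) @^-1` A) * Q (\1_E @^-1` B))%E.
  move=> mA mB; set A' := _ @^-1` A.
  have GA : <<s G>> A'.
    have mZM : measurable_fun setT (fun t : g_sigma_algebraType G => Z t + M).
      by apply: measurable_funD => //; exact: measurable_cst.
    by have := mZM measurableT A mA; rewrite setTI.
  have mA' : measurable A'.
    by apply: (smallest_sub (@sigma_algebra_measurable _ T) GM).
  have QEA : Q (A' `&` E) = (Q A' * Q E)%E by rewrite setIC indepE // muleC.
  (* An indicator has only four preimages: everything, [E], its complement, and the empty set. *)
  rewrite preimage_indic; case: ifPn => _; case: ifPn => _ //.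
  - by rewrite setIT (_ : Q setT = 1%E) ?mule1 //; exact: probability_setT.
  - have QD : Q (A' `\` E) = (Q A' - Q (A' `&` E))%E.
      by apply: measureD => //; rewrite -ge0_fin_numE ?fin_num_measure.
    have QC : Q (~` E) = (1 - Q E)%E by exact: probability_setC.
    have QA : Q A' = (fine (Q A'))%:E by rewrite fineK // fin_num_measure.
    have QE : Q E = (fine (Q E))%:E by rewrite fineK // fin_num_measure.
    transitivity ((fine (Q A'))%:E - (fine (Q A'))%:E * (fine (Q E))%:E)%E.
      by rewrite -setDE -QA -QE -QEA; exact: QD.
    transitivity ((fine (Q A'))%:E * (1 - (fine (Q E))%:E))%E.
      by rewrite -EFinM -!EFinB -EFinM mulrBr mulr1.
    by rewrite -QA -QE -QC.
  - by rewrite setI0 measure0 mule0.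
have I0 t : 0 <= (\1_E t : K) by rewrite indicE.
have mZM : measurable_fun setT (fun t => Z t + M).
  by apply: measurable_funD => //; exact: measurable_cst.
have := indep_integralM mZM mI M0 I0 indepZI.
have -> : (\int[Q]_t ((Z t + M) * \1_E t)%:E = \int[Q]_t (Z t * \1_E t + M * \1_E t)%:E)%E.
  by apply: eq_integral => t _; rewrite mulrDl.
have iZM : Q.-integrable setT (EFin \o (fun t => Z t + M)).
  exact: (integrableD measurableT iZ icst).
have iS : Q.-integrable setT (EFin \o (fun t => Z t * \1_E t + M * \1_E t)).
  exact: (integrableD measurableT iZI iMI).
rewrite (Qfin _ iS) (Qfin _ iZM) (Qfin _ iI).
rewrite -EFinM => -[]; rewrite !RintegralD // RintegralZl // EI Rintegral_cst //.
rewrite (_ : fine (Q setT) = 1) ?mulr1; last first.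
  by rewrite (_ : Q setT = 1%E) //; exact: probability_setT.
lra.
Qed.

(** [g] is not assumed integrable, so integrals are compared only on the sets [r <= m], where it is
    bounded. Testing [g < D] and [D < g] separately turns equal integrals into a vanishing integral
    of [|D - g|]. *)
Lemma ae_eq_of_integrals (D g r : T -> K) :
  measurable_fun setT (D : g_sigma_algebraType G -> K) ->
  measurable_fun setT (g : g_sigma_algebraType G -> K) ->
  measurable_fun setT (r : g_sigma_algebraType G -> K) ->
  Q.-integrable setT (EFin \o D) ->
  (forall m : nat, exists M, forall t, r t <= m%:R -> `|g t| <= M) ->
  (forall (m : nat) A, <<s G>> A -> (forall t, A t -> r t <= m%:R) ->
    (\int[Q]_(t in A) (D t)%:E = \int[Q]_(t in A) (g t)%:E)%E) ->
  {ae Q, forall t, D t = g t}.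
Proof.
move=> mD mg mr iD gM DgE.
have sGM : <<s G>> `<=` measurable.
  by apply: smallest_sub => //; exact: sigma_algebra_measurable.
have aeF := ae_filter_ringOfSetsType Q.
have one_sided (b : T -> bool) (m : nat) :
    measurable_fun setT (b : g_sigma_algebraType G -> bool) ->
    (forall t, b t -> D t != g t) ->
    (forall t, b t -> 0 <= D t - g t) \/ (forall t, b t -> D t - g t <= 0) ->
    {ae Q, forall t, r t <= m%:R -> ~~ b t}.
  move=> mb bneq bsgn; pose A := [set t | (r t <= m%:R) && b t].
  have GA : <<s G>> A.
    have mA : measurable_fun setT (fun t : g_sigma_algebraType G => (r t <= m%:R) && b t).
      by apply: measurable_and => //; apply: measurable_fun_ler => //; exact: measurable_cst.
    by have := mA measurableT [set true] I; rewrite setTI.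
  have mA : measurable A by exact: sGM.
  have Ar t : A t -> r t <= m%:R by move=> /andP[].
  have [M hM] := gM m.
  have iDA : Q.-integrable A (EFin \o D) by exact: integrableS iD.
  have igA : Q.-integrable A (EFin \o g).
    have iM : Q.-integrable A (EFin \o (fun=> M)).
      by apply: (integrableS measurableT) => //; exact: finite_measure_integrable_cst.
    apply: le_integrable iM => //.
      by apply/measurable_EFinP; apply: measurable_funTS; exact: meas_T.
    by move=> t At /=; rewrite lee_fin (le_trans (hM t (Ar t At))) // ler_norm.
  have fin_g : (\int[Q]_(t in A) (g t)%:E)%E \is a fin_num by exact: integrable_fin_num.
  have int_abs0 : (\int[Q]_(t in A) `|(D t)%:E - (g t)%:E| = 0)%E.
    case: bsgn => sgn.
      transitivity (\int[Q]_(t in A) ((D t)%:E - (g t)%:E))%E.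
        apply: eq_integral => t; rewrite inE => /andP[_ bt].
        by rewrite gee0_abs // -EFinB lee_fin sgn.
      by rewrite integralB // (DgE m A GA Ar) subee.
    transitivity (\int[Q]_(t in A) ((g t)%:E - (D t)%:E))%E.
      apply: eq_integral => t; rewrite inE => /andP[_ bt].
      rewrite lee0_abs -?EFinB ?lee_fin ?sgn //.
      by rewrite -EFinN opprB.
    by rewrite integralB // (DgE m A GA Ar) subee.
  have mB : measurable_fun A (fun t => (D t)%:E - (g t)%:E)%E.
    apply: emeasurable_funB; apply/measurable_EFinP; apply: measurable_funTS; exact: meas_T.
  move/(ae_eq_integral_abs Q mA mB).1 : int_abs0.
  apply: (@filterS _ _ aeF) => t /= h rm; apply/negP => bt.
  have At : A t by rewrite /A /= rm bt.
  have := h At; rewrite -EFinB => -[] /eqP; rewrite subr_eq0.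
  by apply/negP; exact: bneq.
have ae_all : {ae Q, forall t, forall m : nat, r t <= m%:R -> D t = g t}.
  apply: (@ae_foralln _ _ _ Q (fun m t => r t <= m%:R -> D t = g t)) => m.
  have lt1 : {ae Q, forall t, r t <= m%:R -> ~~ (g t < D t)}.
    apply: one_sided.
    - exact: measurable_fun_ltr.
    - by move=> t; rewrite lt_neqAle eq_sym => /andP[].
    - by left=> t /ltW; rewrite subr_ge0.
  have lt2 : {ae Q, forall t, r t <= m%:R -> ~~ (D t < g t)}.
    apply: one_sided.
    - exact: measurable_fun_ltr.
    - by move=> t; rewrite lt_neqAle => /andP[].
    - by right=> t /ltW; rewrite subr_le0.
  apply: (@filterS2 _ _ aeF _ _ _ _ lt1 lt2) => t h1 h2 rm.
  by apply/eqP; rewrite eq_le !leNgt h1 // h2.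
apply: (@filterS _ _ aeF _ _ _ ae_all) => t h.
apply: (h (Num.bound `|r t|)); apply: le_trans (ler_norm _) _.
by apply: ltW; exact: archi_boundP.
Qed.

End conditional.

Section algorithm.
Variables (K : realType) (p n : nat).
Local Notation V := 'cV[K]_p.
Variables (d : measure_display) (T : measurableType d) (Q : probability T K).
Variables (R : V -> \bar K) (lambda : K) (x : nat -> V) (y : nat -> K).
Variables (alpha gamma sigma : nat -> K).
Variables (idx : nat -> T -> 'I_n) (eps w z dbar : nat -> T -> V).
Let xn (i : 'I_n) : V := x i.
Let yn (i : 'I_n) : K := y i.
Hypothesis run : rspg_run Q R lambda xn yn alpha gamma idx eps w z.
Hypothesis asm : rspg_assumptions Q xn yn alpha gamma sigma idx eps w dbar.

Definition gradient (v : V) : V :=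
  n%:R^-1 *: \sum_(j < n) (dotp v (xn j) - yn j) *: xn j.

Let comp (i : 'I_p) (j : 'I_n) (v : V) : K := (dotp v (xn j) - yn j) * xn j i 0.

Let meas_comp i j : measurable_fun setT (comp i j : borel_cV K p -> K).
Proof.
apply: measurable_funM; last exact: measurable_cst.
apply: measurable_funB; last exact: measurable_cst.
rewrite (_ : (fun _ => _) = fun v : borel_cV K p => dotp (xn j) (v : V)).
  exact: measurable_dotp.
by apply/funext => v; rewrite dotpC.
Qed.

Let gradientE v i : gradient v i 0 = \sum_j n%:R^-1 * comp i j v.
Proof. by rewrite !mxE summxE big_distrr; apply: eq_bigr => j _; rewrite !mxE. Qed.

Let comp_le i j v (m : K) : enorm v <= m ->
  `|comp i j v| <= (m * enorm (xn j) + `|yn j|) * enorm (xn j).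
Proof.
move=> vm; rewrite normrM; apply: ler_pM => //; last exact: enorm_entry.
apply: le_trans (ler_normB _ _) _; rewrite lerD2r.
apply: le_trans (dotp_CauchySchwarz _ _) _.
by rewrite ler_wpM2r ?enorm_ge0.
Qed.

(** The uniform index, independent of the past, averages the sampled gradient into the full one, and
    [eps] has conditional mean 0. The identity is tested on the events [enorm (w k t) <= m], where
    the gradient is bounded. *)
Lemma dbar_gradient k : (0 < k)%N -> {ae Q, forall t, dbar k t = gradient (w k t)}.
Proof.
move=> k0; have aeF := ae_filter_ringOfSetsType Q.
have ae_i i : {ae Q, forall t, dbar k t i 0 = gradient (w k t) i 0}.
  pose GG : set (set T) := \bigcup_(j in [set j | (1 <= j <= k)%N])
    preimage_set_system setT (w j : T -> borel_cV K p) measurable.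
  have GM : GG `<=` measurable.
    by move=> A [j _ [B mB <-]]; exact: (run_w_meas run j measurableT mB).
  have mw : measurable_fun setT (w k : g_sigma_algebraType GG -> borel_cV K p).
    move=> _ B mB; apply: sub_sigma_algebra; exists k; first by rewrite /= k0 leqnn.
    by exists B.
  have mwT : measurable_fun setT (w k : T -> borel_cV K p) by exact: run_w_meas run k.
  have mc j : measurable_fun setT (fun t : g_sigma_algebraType GG => comp i j (w k t)).
    exact: (measurableT_comp (meas_comp i j) mw).
  have mcT j : measurable_fun setT (fun t => comp i j (w k t)).
    exact: (measurableT_comp (meas_comp i j) mwT).
  have [iX iD mD DX] := asm_dbar asm k0 i.
  have [ie _ _ Deps] := asm_eps_mean asm k0 i.
  have mg : measurable_fun setT (fun t : g_sigma_algebraType GG => gradient (w k t) i 0).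
    rewrite (_ : (fun _ => _) = fun t => \sum_j n%:R^-1 * comp i j (w k t)).
      by apply: measurable_sum => j; apply: measurable_funM => //; exact: measurable_cst.
    by apply/funext => t; rewrite gradientE.
  pose bound (m : nat) j := (m%:R * enorm (xn j) + `|yn j|) * enorm (xn j).
  have bound_ge0 m j : 0 <= bound m j.
    by rewrite mulr_ge0 ?addr_ge0 ?mulr_ge0 ?enorm_ge0.
  apply: (@ae_eq_of_integrals K d T Q GG GM (fun t => dbar k t i 0)
    (fun t => gradient (w k t) i 0) (fun t => enorm (w k t))) => //.
  - by move=> _ B mB; rewrite setTI; exact: mD.
  - exact: (measurableT_comp (measurable_continuous_cV (@enorm_continuous K p)) mw).
  - move=> m; exists (\sum_j n%:R^-1 * bound m j) => t wm.
    rewrite gradientE; apply: le_trans (ler_norm_sum _ _ _) _.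
    apply: ler_sum => j _; rewrite normrM ger0_norm ?invr_ge0 //.
    by rewrite ler_wpM2l ?invr_ge0 //; exact: comp_le.
  move=> m A GA Am; rewrite (DX A GA).
  have mA : measurable A.
    by apply: (smallest_sub (@sigma_algebra_measurable _ T) GM).
  pose h t := \sum_j comp i j (w k t) * \1_A t * \1_(idx k @^-1` [set j]) t.
  pose Z j t := comp i j (w k t) * \1_A t.
  have mIA : measurable_fun setT (\1_A : g_sigma_algebraType GG -> K).
    exact: (@measurable_indic _ (g_sigma_algebraType GG)).
  have mZ j : measurable_fun setT (Z j : g_sigma_algebraType GG -> K).
    exact: measurable_funM.
  have ZM j t : `|Z j t| <= bound m j.
    rewrite /Z indicE; case: (boolP (t \in A)) => [|_]; last by rewrite mulr0 normr0.
    by rewrite inE mulr1 => At; apply: comp_le; exact: Am.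
  have mE j : measurable (idx k @^-1` [set j]) by exact: run_idx_meas run k _.
  have EZ j : Rintegral Q setT (fun t => Z j t * \1_(idx k @^-1` [set j]) t) =
      Rintegral Q setT (Z j) * n%:R^-1.
    have indepE B : <<s GG>> B ->
        Q (idx k @^-1` [set j] `&` B) = (Q (idx k @^-1` [set j]) * Q B)%E.
      move=> GB; apply: (run_idx_fresh run k0) => //.
      by exists [set j] => //; rewrite setTI.
    rewrite (indep_integral_indic GM (mE j) indepE (mZ j) (ZM j)).
    by rewrite (run_idx_unif run k j).
  have mZT j : measurable_fun setT (Z j : T -> K).
    exact: (measurable_fun_sub_sigma GM (mZ j)).
  have iZ j : Q.-integrable setT (EFin \o Z j).
    exact: (bounded_integrable Q (mZT j) (ZM j)).
  have iZE j : Q.-integrable setT (EFin \o (fun t => Z j t * \1_(idx k @^-1` [set j]) t)).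
    apply: (@bounded_integrable _ _ _ _ _ (bound m j)).
      by apply: measurable_funM => //; exact: measurable_indic.
    move=> t; rewrite normrM; apply: le_trans (ZM j t).
    by rewrite ler_piMr // indicE; case: (t \in _); rewrite ?normr1 ?normr0.
  have Qfin (f : T -> K) : Q.-integrable setT (EFin \o f) ->
      (\int[Q]_t (f t)%:E = (Rintegral Q setT f)%:E)%E.
    by move=> fi; rewrite fineK //; exact: integrable_fin_num.
  have restrict (f : T -> K) : (\int[Q]_(t in A) (f t)%:E = \int[Q]_t (f t * \1_A t)%:E)%E.
    rewrite integral_mkcond; apply: eq_integral => t _; rewrite patchE indicE.
    by case: ifP => _; rewrite ?mulr1 ?mulr0.
  transitivity (\int[Q]_(t in A) (comp i (idx k t) (w k t))%:E)%E.
    (* Integrability of the sampled gradient is obtained by subtracting [eps] from the integrable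
       direction. *)
    pose hc t := comp i (idx k t) (w k t).
    have XE t : sgd_dir xn yn idx eps w k t i 0 = hc t + eps k t i 0 by rewrite !mxE.
    have ih : Q.-integrable setT (EFin \o hc).
      have := integrableB measurableT iX ie; apply: eq_integrable => // t _.
      by rewrite /= -EFinB XE addrK.
    have ihA : Q.-integrable A (EFin \o hc) by exact: integrableS ih.
    have ieA : Q.-integrable A (EFin \o (fun t => eps k t i 0)) by exact: integrableS ie.
    transitivity (\int[Q]_(t in A) ((hc t)%:E + (eps k t i 0)%:E))%E.
      by apply: eq_integral => t _; rewrite -EFinD XE.
    rewrite integralD // -(Deps A GA).
    rewrite (_ : (\int[Q]_(t in A) ((0 : V) i 0)%:E = 0)%E) ?adde0 //.
    by under eq_integral do rewrite mxE; exact: integral0.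
  rewrite !restrict.
  transitivity (\int[Q]_t (\sum_j (Z j t * \1_(idx k @^-1` [set j]) t)%:E))%E.
    apply: eq_integral => t _; rewrite sumEFin; congr (_%:E).
    rewrite (bigD1 (idx k t)) //= big1 => [|j jk].
      by rewrite addr0 [\1_(idx k @^-1` _) t]indicE mem_set // mulr1.
    rewrite [\1_(idx k @^-1` _) t]indicE memNset ?mulr0 //= => kj.
    by move: jk; rewrite kj eqxx.
  transitivity (\sum_j (\int[Q]_t (Z j t * \1_(idx k @^-1` [set j]) t)%:E))%E.
    exact: (integral_sum measurableT iZE _ xpredT).
  transitivity (\sum_j (Rintegral Q setT (Z j) * n%:R^-1)%:E)%E.
    by apply: eq_bigr => j _; rewrite Qfin // EZ.
  transitivity (\int[Q]_t (\sum_j (n%:R^-1 * Z j t)%:E))%E; last first.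
    apply: eq_integral => t _; rewrite sumEFin gradientE big_distrl; congr (_%:E).
    by apply: eq_bigr => j _; rewrite /Z mulrA.
  have iZn j : Q.-integrable setT (EFin \o (fun t => n%:R^-1 * Z j t)).
    exact: (integrableZl measurableT n%:R^-1 (iZ j)).
  transitivity (\sum_j (\int[Q]_t (n%:R^-1 * Z j t)%:E))%E; last first.
    by apply/esym; exact: (integral_sum measurableT iZn _ xpredT).
  apply: eq_bigr => j _.
  by rewrite (Qfin _ (iZn j)) RintegralZl // mulrC.
have : {ae Q, forall t, forall i, dbar k t i 0 = gradient (w k t) i 0}.
  exact: (filter_forall aeF ae_i).
by apply: (@filterS _ _ aeF) => t h; apply/colP => i.
Qed.

Lemma gradient_emp w0 v :
  gradient v = emp_cov x n *m (v - w0) - emp_noise x y w0 n.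
Proof.
rewrite /gradient /emp_cov /emp_noise -scalemxAl -scalerBr; congr (_ *: _).
rewrite mulmx_suml -sumrB; apply: eq_bigr => j _.
rewrite -mulmxA (_ : (x j)^T *m (v - w0) = (dotp (v - w0) (x j))%:M); last first.
  apply/matrixP => a b; rewrite !ord1 !mxE eqxx mulr1n /dotp.
  by apply: eq_bigr => l _; rewrite !mxE mulrC.
rewrite mul_mx_scalar -scalerBl; congr (_ *: _).
by rewrite /xn /yn !dotpE (dotpC w0); ring.
Qed.

Lemma emp_cov_lipschitz v :
  enorm (emp_cov x n *m v) <= lipschitz_cst xn * enorm v.
Proof.
rewrite /emp_cov -scalemxAl enormZ ger0_norm ?invr_ge0 // -mulrA.
by rewrite ler_wpM2l ?invr_ge0 // opnorm_mulmx.
Qed.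

Hypotheses (hproper : eproper R) (hconvex : econvex R) (lambda0 : 0 < lambda).

(* The error in the optimality condition of the empirical problem is
   [(w - z) / gamma - (d - dbar) - Cn (w - z)]; its last term is controlled by
   the first one because [gamma * L_n < 2]. *)
Lemma run_near_stationary w0 : {ae Q, forall t, forall e, 0 < e -> \forall k \near \oo,
  exists2 eta, subdiff R (z k t) eta &
    enorm (lambda *: eta + emp_cov x n *m (z k t - w0) - emp_noise x y w0 n) <= e}.
Proof.
have aeF := ae_filter_ringOfSetsType Q.
have ae_dbar : {ae Q, forall t, forall k, (0 < k)%N -> dbar k t = gradient (w k t)}.
  apply: (@ae_foralln _ _ _ Q (fun k t => (0 < k)%N -> dbar k t = gradient (w k t))) => k.
  case: k => [|k]; first exact: (@aeW _ _ _ Q).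
  by apply: (@filterS _ _ aeF _ _ _ (dbar_gradient (ltn0Sn k))) => t ->.
apply: (@filterS3 _ _ aeF _ _ _ _ _ ae_dbar (asm_noise asm) (asm_incr asm)) => t h1 h2 h3 e e0.
(* The budget is [e/6] for [(w - z) / gamma], [e/2] for the noise, and [e/3] for [Cn (w - z)], twice
   the first because [gamma * L_n < 2]. *)
have e6 : 0 < e / 6 by rewrite divr_gt0.
have {}h2 : \forall k \near \oo, enorm (sgd_dir xn yn idx eps w k t - dbar k t) < e / 2.
  have e2 : 0 < e / 2 by rewrite divr_gt0.
  have /cvg_enormP/(_ _ e2) := h2.
  by apply: filterS => k; rewrite subr0.
move/eqoP : h3 => /(_ (e / 6) e6) h3.
near=> k.
have k0 : (0 < k)%N by near: k; exists 1%N.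
have g0 : 0 < gamma k by exact: run_gamma run k.
have /andP[a0 _] := run_alpha run k.
have h2k : enorm (sgd_dir xn yn idx eps w k t - dbar k t) < e / 2 by near: k.
set dd := sgd_dir xn yn idx eps w k t in h2k *.
have zprox := run_z run k t; rewrite -/dd in zprox.
have := prox_subdiff hproper hconvex (mulr_gt0 g0 lambda0) zprox.
set eta := _ *: _ => heta; exists eta => //.
pose Cn := emp_cov x n.
have etaE : lambda *: eta = (gamma k)^-1 *: (w k t - z k t) - dd.
  rewrite /eta scalerA invfM mulrCA mulfV ?gt_eqF // mulr1 addrAC scalerBr.
  by rewrite scalerA mulVf ?gt_eqF // scale1r.
have gE : lambda *: eta + Cn *m (z k t - w0) - emp_noise x y w0 n =
    (gamma k)^-1 *: (w k t - z k t) - (dd - dbar k t) - Cn *m (w k t - z k t).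
  have zw : z k t - w0 = (w k t - w0) - (w k t - z k t).
    by rewrite opprB [RHS]addrC addrA subrK.
  rewrite etaE zw mulmxBr (h1 k k0) (gradient_emp w0) -/Cn.
  have alg (a b c f g : V) : a - f + (b - c) - g = a - (f - (b - g)) - c.
    by apply/colP => i; rewrite !mxE; ring.
  exact: alg.
rewrite -/Cn gE.
(* The increment of [w] is [alpha k] times [z - w], so dividing by [alpha k] leaves a bound of order
   [gamma k]. *)
have wz : enorm (w k t - z k t) <= e / 6 * gamma k.
  have : enorm (w k.+1 t - w k t) <= e / 6 * (alpha k * gamma k).
    have : `|enorm (w k.+1 t - w k t)| <= e / 6 * `|alpha k * gamma k| by near: k.
    by rewrite ger0_norm ?enorm_ge0 // gtr0_norm // mulr_gt0.
  rewrite (run_w run k t).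
  have -> : (1 - alpha k) *: w k t + alpha k *: z k t - w k t =
      - (alpha k *: (w k t - z k t)).
    by apply/colP => i; rewrite !mxE; ring.
  by rewrite enormN enormZ gtr0_norm // mulrCA ler_pM2l.
have wzg : enorm ((gamma k)^-1 *: (w k t - z k t)) <= e / 6.
  by rewrite enormZ gtr0_norm ?invr_gt0 // mulrC ler_pdivrMr.
have Cwz : enorm (Cn *m (w k t - z k t)) <= e / 3.
  apply: le_trans (emp_cov_lipschitz _) _.
  have [_ gL] := asm_gamma asm k.
  set L := lipschitz_cst xn in gL *.
  have [L0|L0] := leP 0 L; last first.
    by apply: le_trans (mulr_le0_ge0 (ltW L0) (enorm_ge0 _)) _; rewrite divr_ge0 // ltW.
  apply: le_trans (ler_wpM2l L0 wz) _.
  rewrite mulrCA -[e / 3](_ : e / 6 * 2 = _); last by field.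
  by rewrite ler_pM2l // mulrC ltW.
apply: le_trans (enorm_triangle _ _) _; rewrite enormN.
apply: le_trans (lerD (enorm_triangle _ _) (lexx _)) _; rewrite enormN.
lra.
Unshelve. all: by end_near.
Qed.

End algorithm.

(** * Conclusion: combining rates, stability and stationarity *)

Theorem theorem2 (K : realType) (p : nat)
  (R : 'cV[K]_p -> \bar K) (Ms Mds : set (set 'cV[K]_p))
  (hproper : eproper R) (hlsc : lower_semicontinuous R) (hconvex : econvex R)
  (hbelow : bounded_below R) (hmirror : mirror_stratifiable R Ms Mds)
  (rho : probability (borel_cV K p * K)%type K)
  (w0 : 'cV[K]_p) (hw0 : argmin (argmin setT (risk rho)) R = [set w0])
  (hx4 : ('E_rho[fun s => (enorm s.1 ^+ 4)%R] < +oo)%E)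
  (hy4 : ('E_rho[fun s => (`|s.2| ^+ 4)%R] < +oo)%E)
  (eta0 : 'cV[K]_p) (heta0 : is_dual_vector rho R w0 eta0)
  (d : measure_display) (T : measurableType d) (P : probability T K)
  (s : nat -> T -> borel_cV K p * K) (hs : iid_sample rho P s)
  (lambda : nat -> K) (hlambda : forall n, 0 < lambda n)
  (hlambda0 : lambda n @[n --> \oo] --> (0 : K))
  (hlambdaoo :
    lambda n * Num.sqrt (n%:R / ln (ln n%:R)) @[n --> \oo] --> +oo) :
  {ae P, forall om, exists N : nat, forall n, (N <= n)%N ->
    forall (d' : measure_display) (T' : measurableType d')
      (Q : probability T' K) (alpha gamma sigma : nat -> K)
      (idx : nat -> T' -> 'I_n) (eps w z dbar : nat -> T' -> 'cV[K]_p),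
    let x (i : 'I_n) : 'cV[K]_p := (s i om).1 in
    let y (i : 'I_n) : K := (s i om).2 in
    rspg_run Q R (lambda n) x y alpha gamma idx eps w z ->
    rspg_assumptions Q x y alpha gamma sigma idx eps w dbar ->
    {ae Q, forall t, exists k0 : nat, forall k, (k0 <= k)%N ->
      strat_le (stratum Ms w0) (stratum Ms (z k t)) /\
      strat_le (stratum Ms (z k t))
               (corr_op (fconj R) (stratum Mds eta0))}}.
Proof.
have [w0_min w0_R] : argmin (argmin setT (risk rho)) R w0 by rewrite hw0.
have [[eta0_sub [a _ Ca]] eta0_opt] := heta0.
set C := second_moment rho in Ca eta0_opt *.
have psC : psd C by exact: second_moment_psd hx4 hy4.
have eta0_im : im_proj C *m eta0 = eta0 by rewrite -Ca mulmxA (im_projC psC).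
have w0_uniq (h : 'cV[K]_p) : im_proj C *m h = 0 -> (R (w0 + h)%R <= R w0)%E -> h = 0.
  move=> Ph Rh; have : argmin (argmin setT (risk rho)) R (w0 + h).
    split=> [|v hv]; first exact: (risk_ker hx4 hy4 w0_min Ph).
    exact: le_trans Rh (w0_R v hv).
  by rewrite hw0 => /= /(canRL (addKr _)); rewrite addNr.
have eta0_min q : subdiff R w0 q -> im_proj C *m q = q ->
    dotp (mp_pinv C *m eta0) eta0 <= dotp (mp_pinv C *m q) q.
  move=> qs qP; have := eta0_opt q; rewrite lee_fin; apply; split=> //.
  by exists (mp_pinv C *m q) => //; rewrite mulmxA (im_proj_comm psC).
have [delta delta0 near_strata] := mirror_near hproper hmirror eta0_sub.
have [kappa kappa0 stab] := stability hproper hlsc hconvex psC eta0_sub eta0_im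
  w0_uniq eta0_min delta0.
have aeP := ae_filter_ringOfSetsType P.
have data := data_ae hx4 hy4 hs hlambda hlambda0 hlambdaoo w0_min.
apply: (@filterS _ _ aeP _ _ _ data) => om /= [Px /(_ kappa kappa0) emp].
set xs : nat -> 'cV[K]_p := fun i => (s i om).1 in Px emp *.
set ys : nat -> K := fun i => (s i om).2 in emp *.
have small : \forall n \near \oo, lambda n < kappa by apply: (cvgr_lt _ hlambda0).
have [N _ hN] := filterI small emp.
exists N => n nN d' T' Q alpha gamma sigma idx eps w z dbar run asm.
have [lam_lt [cov_le noise_le]] := hN n nN.
have lam0 := hlambda n.
have lam_range : 0 < lambda n < kappa by rewrite lam0.
(* With [n] fixed, the tolerance required by [stability] is a fixed positive number, which the
   iterates meet for [k] large. *)
have e0 : 0 < kappa * lambda n ^+ 2 by rewrite mulr_gt0 // exprn_gt0.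
have aeQ := ae_filter_ringOfSetsType Q.
have stat := @run_near_stationary _ _ _ _ _ Q R (lambda n) xs ys _ _ _ _ _ _ _ _
  run asm hproper hconvex lam0 w0.
apply: (@filterS _ _ aeQ _ _ _ stat) => t /(_ _ e0) [k0 _ hk0].
exists k0 => k kk0; have [eta eta_sub g_le] := hk0 k kk0.
have [z_near eta_near] := stab (lambda n) (emp_cov xs n) (emp_noise xs ys w0 n)
  (z k t) eta lam_range (emp_cov_psd xs n) (emp_cov_proj (im_proj_sym C) Px n)
  (emp_noise_proj ys w0 Px n) cov_le noise_le eta_sub g_le.
exact: near_strata eta_sub z_near eta_near.
Qed.
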